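(* Let $\Omega=(0,1)$, $T>0$, $\rho_{\max}>0$, $v_{\max}>0$, $\delta>0$. Assume: (i) $v\in C^1([0,\rho_{\max}];[0,v_{\max}])$, $v'<0$, $v(0)=v_{\max}$, $v(\rho_{\max})=0$; (ii) $\bar\rho\in L^\infty\cap BV(\Omega;[\delta,\rho_{\max}])$; (iii) $\bar\rho_0,\bar\rho_1:[0,\infty)\to[\delta,\rho_{\max}]$ are bounded, Lipschitz continuous and of bounded variation. For $m\ge 1$ and $n$ sufficiently large let $\rho^{n,m}$ be the discrete density on $(0,T]\times\mathbb{R}$ produced by the follow-the-leader scheme with boundary data described in the context. Then $(\rho^{n,m}\,\mathbf 1_\Omega)_{n,m}$ converges up to a subsequence, as $n,m\to\infty$, almost everywhere on $(0,T)\times\Omega$ and in $L^1((0,T)\times\Omega)$, to a function $\rho$ which is a weak solution in the interior of $\Omega$ of $$\rho_t+[\rho\,v(\rho)]_x=0,\qquad \rho(0,\cdot)=\bar\rho .$$ That is: for every sequence $(n_j,m_j)_j$ with $n_j\to\infty$ and $m_j\to\infty$ there are a subsequence (not relabelled) and a function $\rho$ on $(0,T)\times\Omega$ such that $\rho^{n_j,m_j}\mathbf 1_\Omega\to\rho$ a.e. and in $L^1((0,T)\times\Omega)$, and for every $\varphi\in C_c^\infty([0,T)\times\Omega)$ $$\int_0^T\!\!\int_\Omega\big[\rho\,\varphi_t+\rho\,v(\rho)\,\varphi_x\big]\,dx\,dt+\int_\Omega\bar\rho(x)\,\varphi(0,x)\,dx=0 .$$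
   Context: The follow-the-leader scheme with boundary data. Fix $T>0$, $m\ge1$, and $n$ sufficiently large. Put $\tau_m=T/m$, $L=\|\bar\rho\|_{L^1(\Omega)}$, $\ell_n=L/n$, and $\bar\rho_i^k=\bar\rho_i(k\tau_m)$ for $i\in\{0,1\}$, $k\in\{0,\dots,m\}$. Put $Q=2\,T\,v_{\max}\,\rho_{\max}$, $N=\lceil Q/\ell_n\rceil$, $q_n=Q-\ell_n(N-1)\in[0,\ell_n]$. Initial positions. Set $\bar x_0^0=0$ and, recursively for $i=1,\dots,n$, $\bar x_i^0=\sup\{x\in\Omega:\int_{\bar x_{i-1}^0}^x\bar\rho(y)\,dy<\ell_n\}$ (so $\bar x_n^0=1$). The queuing particles are $\bar x_i^0=i\,\ell_n/\bar\rho_0^0$ for $i\in\{-N+1,\dots,-1\}$ and $\bar x_{-N}^0=\bar x_{-N+1}^0-q_n/\bar\rho_0^0$. Evolution. For $k=0,\dots,m-1$, on $[k\tau_m,(k+1)\tau_m]$ the $n+N+1$ particles $x_i=x_i^k$ solve $\dot x_i^k(t)=v(R_i^k(t))$ for $i\in\{-N,\dots,n-1\}$, $\dot x_n^k(t)=v(\bar\rho_1^k)$, $x_i^k(k\tau_m)=\bar x_i^k$ for $i\in\{-N,\dots,n\}$, where $R_i^k(t)=\ell_n/(x_{i+1}^k(t)-x_i^k(t))$ for $i\in\{-N+1,\dots,n-1\}$ and $R_{-N}^k(t)=q_n/(x_{-N+1}^k(t)-x_{-N}^k(t))$. Rearrangement at time $k\tau_m$, $k\ge1$. Let $x_i(k\tau_m)=x_i^{k-1}(k\tau_m)$.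 Let $h_0^k$ be the number of queuing particles (indices $i<0$) that have strictly crossed $x=0$ during $(0,k\tau_m]$, and $h_1^k$ the number of particles that have reached or crossed $x=1$ by time $k\tau_m$, i.e. the number of $i$ with $x_i(k\tau_m)\ge1$. Thus $x_{-h_0^k-1}$ is the rightmost queuing particle still in $(-\infty,0]$ and $x_{n-h_1^k+1}$ is the leftmost particle in $[1,\infty)$. Set - $\bar x_i^k=x_i(k\tau_m)$ for $i\in\{-h_0^k-1,\dots,n-h_1^k+1\}$; - $\bar x_i^k=x_{n-h_1^k+1}(k\tau_m)+(i-n+h_1^k-1)\,\ell_n/\bar\rho_1^k$ for $i\in\{n-h_1^k+2,\dots,n\}$; - $\bar x_i^k=x_{-h_0^k-1}(k\tau_m)+(i+h_0^k+1)\,\ell_n/\bar\rho_0^k$ for $i\in\{-N+1,\dots,-h_0^k-2\}$; - $\bar x_{-N}^k=\bar x_{-N+1}^k-q_n/\bar\rho_0^k$. Discrete density. For $t\in(0,T]$, $$\rho^{n,m}(t,x)=\sum_{k=0}^{m-1}\sum_{i=-N}^{n-1}R_i^k(t)\,\mathbf 1_{[x_i^k(t),x_{i+1}^k(t))}(x)\,\mathbf 1_{(k\tau_m,(k+1)\tau_m]}(t).$$ *)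

(* Defs.v *)
From mathcomp Require Import all_boot all_order all_algebra.
From mathcomp Require Import all_classical all_reals all_analysis.

Set Implicit Arguments.
Unset Strict Implicit.
Unset Printing Implicit Defensive.
Import Order.TTheory GRing.Theory Num.Theory.
Import numFieldNormedType.Exports.

Local Open Scope classical_set_scope.
Local Open Scope ring_scope.

(** [f] is C^1 on the closed interval [a, b] with derivative [df]: [df] is
    the continuous extension to [a, b] of the derivative in the interior (so
    [df a] and [df b] are the one-sided derivatives). *)
Definition C1_on (R : realType) (a b : R) (f df : R -> R) : Prop :=
  [/\ {within `[a, b], continuous f},
      {within `[a, b], continuous df} &
      forall r : R, a < r < b -> is_derive r 1 f (df r)].

(** Elements of BV(]a, b[) are classes modulo a.e. equality: some
    representative has finite pointwise variation. A BV function on the open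
    interval has limits at [a] and [b], so the closed interval used by
    [bounded_variation] makes no difference. *)
Definition BV_class (R : realType) (a b : R) (f : R -> R) : Prop :=
  exists g : R -> R, bounded_variation a b g /\
    {ae @lebesgue_measure R, forall x : R, a < x < b -> f x = g x}.

Definition BV_halfline (R : realType) (f : R -> R) : Prop :=
  exists M : R, forall b : R, 0 <= b -> (total_variation 0 b f <= M%:E)%E.

(** Particles are labelled by integers, from [- N] (end of the queue) to [n]
    (leader), where [N] is [queue_size]. *)

(** [v] is only given on [0, rhomax]; freezing it outside makes the right-hand
    side of the particle system total. Gaps between particles never drop below
    the value corresponding to the density [rhomax], so the extension plays no
    role along the evolution. *)
Definition vext (R : realType) (rhomax : R) (v : R -> R) (r : R) : R :=
  v (Num.max 0 (Num.min r rhomax)).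

Definition mass (R : realType) (rhobar : R -> R) : R :=
  \int[@lebesgue_measure R]_(x in `]0, 1[) `|rhobar x|.

Definition cell_mass (R : realType) (rhobar : R -> R) (n : nat) : R :=
  mass rhobar / n%:R.

Definition queue_mass (R : realType) (T rhomax vmax : R) : R :=
  2 * T * vmax * rhomax.

Definition queue_size (R : realType) (T rhomax vmax : R) (rhobar : R -> R)
    (n : nat) : nat :=
  `|Num.ceil (queue_mass T rhomax vmax / cell_mass rhobar n)|%N.

Definition last_mass (R : realType) (T rhomax vmax : R) (rhobar : R -> R)
    (n : nat) : R :=
  queue_mass T rhomax vmax
  - cell_mass rhobar n * ((queue_size T rhomax vmax rhobar n)%:R - 1).

Fixpoint init_inner (R : realType) (rhobar : R -> R) (n i : nat) : R :=
  if i is i'.+1 then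
    sup [set x : R | 0 < x < 1 /\
      \int[@lebesgue_measure R]_(y in `]init_inner rhobar n i', x[) rhobar y
        < cell_mass rhobar n]
  else 0.

(** [place_last N q r y] puts particle [- N] at distance [q / r] behind
    particle [- N + 1] in the configuration [y]. *)
Definition place_last (R : realType) (N : nat) (q r : R) (y : int -> R)
    (i : int) : R :=
  if i == - N%:Z then y (1 - N%:Z) - q / r else y i.

Definition init_pos (R : realType) (T rhomax vmax : R)
    (rhobar rho0 : R -> R) (n : nat) : int -> R :=
  place_last (queue_size T rhomax vmax rhobar n)
    (last_mass T rhomax vmax rhobar n) (rho0 0)
    (fun i : int => if 0 <= i then init_inner rhobar n `|i|%N
                    else i%:~R * (cell_mass rhobar n / rho0 0)).

(** Number of queuing particles [- N <= i < 0] that have crossed [0] in the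
    configuration [y]. Velocities are nonnegative and a rearrangement never
    brings a particle back across [0], so having crossed at some earlier time
    amounts to lying in (0, +oo) now. *)
Definition crossed0 (R : realType) (N : nat) (y : int -> R) : nat :=
  \sum_(j < N) (0 < y (j%:Z - N%:Z)%R)%R.

(** Number of particles [- N <= i <= n] in [1, +oo). *)
Definition crossed1 (R : realType) (N n : nat) (y : int -> R) : nat :=
  \sum_(j < (n + N).+1) (1 <= y (j%:Z - N%:Z)%R)%R.

(** Rearrangement of the configuration [y] with boundary densities [r0], [r1]
    and particle masses [l] (generic) and [q] (particle [- N]). *)
Definition rearrange (R : realType) (N n : nat) (l q r0 r1 : R)
    (y : int -> R) : int -> R :=
  let h0 := (crossed0 N y)%:Z in
  let h1 := (crossed1 N n y)%:Z in
  place_last N q r0 (fun i : int =>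
    if i < - h0 - 1 then y (- h0 - 1) + (i + h0 + 1)%:~R * (l / r0)
    else if i <= n%:Z - h1 + 1 then y i
    else y (n%:Z - h1 + 1) + (i - n%:Z + h1 - 1)%:~R * (l / r1)).

Definition tgrid (R : realType) (T : R) (m k : nat) : R := k%:R * (T / m%:R).

Definition start_pos (R : realType) (T rhomax vmax : R)
    (rhobar rho0 rho1 : R -> R) (n m : nat) (x : nat -> int -> R -> R)
    (k : nat) : int -> R :=
  if k is k'.+1 then
    rearrange (queue_size T rhomax vmax rhobar n) n
      (cell_mass rhobar n) (last_mass T rhomax vmax rhobar n)
      (rho0 (tgrid T m k)) (rho1 (tgrid T m k))
      (fun i : int => x k' i (tgrid T m k))
  else init_pos T rhomax vmax rhobar rho0 n.

Definition cell_density (R : realType) (T rhomax vmax : R) (rhobar : R -> R)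
    (n : nat) (x : nat -> int -> R -> R) (k : nat) (i : int) (t : R) : R :=
  (if i == - (queue_size T rhomax vmax rhobar n)%:Z
   then last_mass T rhomax vmax rhobar n else cell_mass rhobar n)
  / (x k (i + 1) t - x k i t).

Definition ftl_velocity (R : realType) (T rhomax vmax : R)
    (v rhobar rho1 : R -> R) (n m : nat) (x : nat -> int -> R -> R)
    (k : nat) (i : int) (t : R) : R :=
  if i == n%:Z then v (rho1 (tgrid T m k))
  else vext rhomax v (cell_density T rhomax vmax rhobar n x k i t).

(** [x k i t] is the position of particle [i] at time [t] during step [k];
    only [k < m], [- N <= i <= n] and [tgrid T m k <= t <= tgrid T m k.+1]
    matter. *)
Definition ftl_scheme (R : realType) (T rhomax vmax : R)
    (v rhobar rho0 rho1 : R -> R) (n m : nat)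
    (x : nat -> int -> R -> R) : Prop :=
  forall (k : nat) (i : int), (k < m)%N ->
    - (queue_size T rhomax vmax rhobar n)%:Z <= i <= n%:Z ->
    [/\ x k i (tgrid T m k) = start_pos T rhomax vmax rhobar rho0 rho1 n m x k i,
        {within `[tgrid T m k, tgrid T m k.+1], continuous (x k i)} &
        forall t : R, tgrid T m k < t < tgrid T m k.+1 ->
          is_derive t 1 (x k i)
            (ftl_velocity T rhomax vmax v rhobar rho1 n m x k i t)].

Definition ftl_density (R : realType) (T rhomax vmax : R) (rhobar : R -> R)
    (n m : nat) (x : nat -> int -> R -> R) (t y : R) : R :=
  let N := queue_size T rhomax vmax rhobar n in
  \sum_(k < m) \sum_(j < n + N)
    let i := j%:Z - N%:Z in
    cell_density T rhomax vmax rhobar n x k i t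
    * \1_(`[x k i t, x k (i + 1) t[%classic) y
    * \1_(`]tgrid T m k, tgrid T m k.+1]%classic) t.

Notation leb2 R := (@lebesgue_measure R \x @lebesgue_measure R)%E.

Definition domain (R : realType) (T : R) : set (R * R) := `]0, T[ `*` `]0, 1[.

Definition cvg_ae (d : measure_display) (X : measurableType d) (R : realType)
    (mu : {measure set X -> \bar R}) (D : set X) (f : nat -> X -> R)
    (g : X -> R) : Prop :=
  {ae mu, forall p : X, D p -> f j p @[j --> \oo] --> g p}.

Definition cvg_L1 (d : measure_display) (X : measurableType d) (R : realType)
    (mu : {measure set X -> \bar R}) (D : set X) (f : nat -> X -> R)
    (g : X -> R) : Prop :=
  [/\ \forall j \near \oo, mu.-integrable D (EFin \o f j),
      mu.-integrable D (EFin \o g) &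
      (\int[mu]_(p in D) `|(f j p - g p)%:E|)%E @[j --> \oo] --> 0%E].

Definition dir_t (R : realType) : R * R := (1, 0).
Definition dir_x (R : realType) : R * R := (0, 1).

(** Iterated partial derivatives, [true] standing for [x] and [false] for
    [t]. *)
Definition partials (R : realType) (phi : R * R -> R) (s : seq bool) :
    R * R -> R :=
  foldr (fun (b : bool) (f : R * R -> R) (p : R * R) =>
    'D_(if b then dir_x R else dir_t R) f p) phi s.

Definition smooth (R : realType) (phi : R * R -> R) : Prop :=
  forall s : seq bool,
    continuous (partials phi s) /\
    forall p : R * R, derivable (partials phi s) p (dir_t R) /\
                      derivable (partials phi s) p (dir_x R).

(** C_c^oo([0, T) x Omega): restrictions of functions that are smooth on the
    plane, with compact support relative to [0, T) x Omega; they need not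
    vanish at t = 0. *)
Definition test_function (R : realType) (T : R) (phi : R * R -> R) : Prop :=
  smooth phi /\
  exists K : set (R * R),
    [/\ compact K, K `<=` `[0, T[ `*` `]0, 1[ &
        forall p, (`[0, T[ `*` `]0, 1[) p -> ~ K p -> phi p = 0].

(** Weak solution, in the interior of Omega, of
    rho_t + (rho v(rho))_x = 0, rho(0, .) = rhobar. As [v] is only given on
    [0, rhomax], [rho] has to take its values there. *)
Definition weak_solution (R : realType) (T rhomax : R) (v rhobar : R -> R)
    (rho : R * R -> R) : Prop :=
  {ae leb2 R, forall p : R * R, domain T p -> 0 <= rho p <= rhomax} /\
  forall phi : R * R -> R, test_function T phi ->
    \int[leb2 R]_(p in domain T)
      (rho p * 'D_(dir_t R) phi p + rho p * v (rho p) * 'D_(dir_x R) phi p)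
    + \int[@lebesgue_measure R]_(x in `]0, 1[) (rhobar x * phi (0, x)) = 0.

(* Main.v *)
Require Import Defs.
From mathcomp Require Import all_boot all_order all_algebra.
From mathcomp Require Import all_classical all_reals all_analysis.
From mathcomp Require Import measurable_realfun ring lra zify.

Set Implicit Arguments.
Unset Strict Implicit.
Unset Printing Implicit Defensive.
Import Order.TTheory GRing.Theory Num.Theory.
Import numFieldNormedType.Exports.

Local Open Scope classical_set_scope.
Local Open Scope ring_scope.

(** The queue and the particles of Omega form one chain of cells of fixed mass.
    Barrier arguments give the maximum principle for the cell densities, which
    keeps them in [delta, rhomax], and an explicit Euler step shows that their
    total variation, boundary values included, does not grow between two
    rearrangements. A rearrangement leaves Omega untouched and replaces the
    boundary values; by the Lipschitz bounds the total variation grows by at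
    most O(T / m) at each of the m steps. As the velocities are bounded, the
    discrete densities are therefore Lipschitz in time with values in L^1,
    uniformly in n and m.

    Compactness does not go through the theorems of Helly and Aubin-Lions.
    Along an ultrafilter the densities converge at each of finitely many points
    of a space-time grid, and the two bounds above turn closeness at these points
    into closeness in L^1, whence a subsequence that converges almost
    everywhere.

    For the weak form, cut a test function phi by zero outside Omega: the sum
    over the particles of w_p phi(t, z_p(t)) has derivative the sum of
    w_p (phi_t + v_p phi_x), which differs from the integral of
    rho phi_t + rho v(rho) phi_x over Omega by O(l_n), and rearrangements do not
    change it because they only move particles outside Omega. Integrating in
    time gives the weak formulation up to O(l_n). *)

(** * Barriers and decay of the total variation *)

Section RealFunctions.
Context {R : realType}.
Implicit Types (f df : R -> R) (a b c : R).

Lemma within_itv_epsP f a b :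
  {within `[a, b], continuous f} <->
  forall t, a <= t <= b -> forall e, 0 < e ->
    exists2 d, 0 < d & forall u, a <= u <= b -> `|u - t| < d -> `|f u - f t| < e.
Proof.
split.
  move=> /subspace_continuousP cf t tab e e0.
  have := cf t; rewrite /= in_itv/= => /(_ tab) /cvgrPdist_lt /(_ e e0).
  rewrite /prop_near1 /within /= => /nbhs_ballP[d /= d0 H].
  exists d => // u uab ut; rewrite distrC; apply: H.
    by rewrite /ball/= distrC.
  by rewrite in_itv.
move=> H; apply/subspace_continuousP => t /=; rewrite in_itv/= => tab.
apply/cvgrPdist_lt => e e0; have [d d0 {}H] := H t tab e e0.
rewrite /prop_near1 /within /=; apply/nbhs_ballP; exists d => // u.
rewrite /ball/= distrC => ut; rewrite in_itv/= => uab.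
by rewrite distrC; apply: H.
Qed.

Lemma within_itvS f a b c d : a <= c -> d <= b ->
  {within `[a, b], continuous f} -> {within `[c, d], continuous f}.
Proof.
move=> ac db; apply: continuous_subspaceW => t /=; rewrite !in_itv/= => /andP[ct td].
by rewrite (le_trans ac ct) (le_trans td db).
Qed.

Lemma last_time f a b : a <= b -> {within `[a, b], continuous f} ->
  f a <= 0 -> 0 < f b ->
  exists s, [/\ a <= s, s < b, f s <= 0 & forall t, s < t <= b -> 0 < f t].
Proof.
move=> ab /within_itv_epsP cf fa fb.
pose S := [set u | a <= u <= b /\ f u <= 0].
have Sa : S a by rewrite /S/= lexx.
have hS : has_sup S by split; [exists a | exists b => u [/andP[]]].
have aS : a <= sup S by apply: ub_le_sup => //; case: hS.
have Sb : sup S <= b by apply: ge_sup; [exists a | move=> u [/andP[]]].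
have fS : f (sup S) <= 0.
  rewrite leNgt; apply/negP => fS.
  have [|d d0 H] := cf (sup S) _ _ fS; first by rewrite aS.
  have [u [uab fu] Su] := sup_adherent d0 hS.
  have uS : u <= sup S by apply: ub_le_sup => //; case: hS.
  have := H u uab; rewrite distrC ger0_norm ?subr_ge0// ltrBlDl -ltrBlDr => /(_ Su).
  by rewrite distrC ltr_norml; move/andP => [_]; lra.
exists (sup S); split => //.
  rewrite lt_neqAle Sb andbT; apply/eqP => Sbe; move: fS; rewrite Sbe; lra.
move=> t /andP[st tb]; rewrite ltNge; apply/negP => ft.
have : t <= sup S by apply: ub_le_sup => //; [case: hS | split => //; lra].
lra.
Qed.

(** At the last time when [c <= f] the mean value theorem forbids going below
    [c], so that the sign of [df] matters only in a band under the barrier. *)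
Lemma barrier_ge f df a b c eta : 0 < eta -> a <= b ->
  {within `[a, b], continuous f} ->
  (forall t, a < t < b -> is_derive t 1 f (df t)) ->
  (forall t, a < t < b -> c - eta < f t < c -> 0 <= df t) ->
  c <= f a -> forall t, a <= t <= b -> c <= f t.
Proof.
move=> eta0 ab cf hf hdf fa t /andP[a_t tb].
rewrite leNgt; apply/negP => ftc.
have cf' : {within `[a, t], continuous f} by apply: within_itvS cf.
have [|||s [as_ st fs fst]] := @last_time (fun u => c - f u) a t a_t; last 1 first.
- have := (within_itv_epsP _ _ _).1 cf' s; rewrite as_ ltW// => /(_ isT _ eta0)[d d0 H].
  pose u := Num.min t (s + d / 2).
  have su : s < u by rewrite lt_min st; lra.
  have ut : u <= t by rewrite ge_min lexx.
  have usd : u <= s + d / 2 by rewrite ge_min lexx orbT.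
  have Hf w : s < w <= u -> c - eta < f w < c.
    move=> /andP[sw wu].
    have := H w; rewrite (le_trans as_ (ltW sw)) (le_trans wu ut) => /(_ isT).
    rewrite gtr0_norm ?subr_gt0// => /(_ ltac:(lra)); rewrite ltr_norml => /andP[h1 h2].
    have := fst w; rewrite sw (le_trans wu ut) => /(_ isT) ?; lra.
  have [||w] := @MVT R f df s u su.
  + move=> w; rewrite in_itv/= => /andP[sw wu]; apply: hf; lra.
  + by apply: within_itvS cf => //; lra.
  + rewrite in_itv/= => /andP[sw wu] E.
    have h0 := Hf w ltac:(lra).
    have h1 : 0 <= df w by apply: hdf => //; lra.
    have h2 := Hf u ltac:(lra).
    have : 0 <= df w * (u - s) by apply: mulr_ge0 => //; lra.
    lra.
- apply/within_itv_epsP => u uab e e0.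
  have [d d0 H] := (within_itv_epsP _ _ _).1 cf' u uab e e0; exists d => // w wab wu.
  by rewrite opprB addrCA [c + _]addrC addrK distrC; apply: H.
- lra.
- lra.
Qed.

Lemma barrier_le f df a b c eta : 0 < eta -> a <= b ->
  {within `[a, b], continuous f} ->
  (forall t, a < t < b -> is_derive t 1 f (df t)) ->
  (forall t, a < t < b -> c < f t < c + eta -> df t <= 0) ->
  f a <= c -> forall t, a <= t <= b -> f t <= c.
Proof.
move=> eta0 ab cf hf hdf fa t tab; rewrite -lerN2.
apply: (@barrier_ge (fun x => - f x) (fun x => - df x) a b (- c) eta) => //.
- apply/within_itv_epsP => u uab e e0.
  have [d d0 H] := (within_itv_epsP _ _ _).1 cf u uab e e0; exists d => // w wab wu.
  by rewrite opprK addrC distrC; apply: H.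
- by move=> u uab; apply: is_deriveN; exact: hf.
- move=> u uab h; rewrite oppr_ge0; apply: hdf => //; lra.
- by rewrite lerN2.
Qed.

Lemma dini_nonincreasing f a b : a <= b -> {within `[a, b], continuous f} ->
  (forall t, a < t < b -> forall e, 0 < e ->
    exists2 d, 0 < d & forall h, 0 < h < d -> f (t + h) <= f t + e * h) ->
  f b <= f a.
Proof.
move=> ab cf hf.
have main a' e : a < a' < b -> 0 < e -> f b <= f a' + e * (b - a').
  move=> /andP[aa' a'b] e0; rewrite leNgt; apply/negP => fb.
  pose g u := f u - f a' - e * (u - a').
  have cg : {within `[a', b], continuous g}.
    have cf' : {within `[a', b], continuous f} by apply: within_itvS cf => //; lra.
    have -> : g = f \- (fun u => f a' + e * (u - a')).
      by apply/funext => u; rewrite /g/= opprD addrA.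
    move=> x; apply: (@continuousB _ _ _ (f : subspace `[a', b] -> R)); first exact: cf'.
    apply: continuous_subspaceT => y; apply: (@cvgD _ R^o); first exact: cvg_cst.
    apply: cvgM; first exact: cvg_cst.
    by apply: (@cvgB _ R^o); [exact: cvg_id | exact: cvg_cst].
  have [||s [as_ sb gs gst]] := @last_time g a' b (ltW a'b) cg.
  - rewrite /g; lra.
  - rewrite /g; lra.
  have [|d d0 H] := hf s _ e e0; first lra.
  pose h := Num.min (b - s) (d / 2).
  have h0 : 0 < h by rewrite lt_min; lra.
  have hb : h <= b - s by rewrite ge_min lexx.
  have hd : h <= d / 2 by rewrite ge_min lexx orbT.
  have := H h ltac:(lra); have := gst (s + h) ltac:(lra); move: gs; rewrite /g; lra.
have [->//|ab'] := eqVneq a b.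
have altb : a < b by rewrite lt_neqAle ab'.
apply/ler_addgt0Pr => e e0.
have e2 : 0 < e / 2 by lra.
have := (within_itv_epsP _ _ _).1 cf a; rewrite lexx ab => /(_ isT (e / 2) e2)[d d0 H].
pose h := Num.min ((b - a) / 2) (d / 2).
have h0 : 0 < h by rewrite lt_min; lra.
have hb : h <= (b - a) / 2 by rewrite ge_min lexx.
have hd : h <= d / 2 by rewrite ge_min lexx orbT.
pose e' := e / 2 / (b - (a + h)).
have bah : 0 < b - (a + h) by lra.
have := main (a + h) e' ltac:(lra) ltac:(by rewrite divr_gt0).
rewrite /e' divfK ?gt_eqF//.
have := H (a + h) ltac:(lra); rewrite addrAC subrr add0r gtr0_norm// => /(_ ltac:(lra)).
rewrite ltr_norml => /andP[_]; lra.
Qed.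

Lemma is_derive_eps f (df t : R) : is_derive t 1 f df -> forall e, 0 < e ->
  exists2 d, 0 < d & forall h, `|h| < d -> `|f (t + h) - f t - df * h| <= e * `|h|.
Proof.
move=> [df1 df2] e e0.
have : h^-1 *: ((f \o shift t) h%:A - f t) @[h --> 0^'] --> df.
  by rewrite -df2; exact: df1.
move=> /cvgrPdist_le /(_ e e0); rewrite /prop_near1 /= => /nbhs_ballP[d /= d0 H].
exists d => // h hd; have [->|h0] := eqVneq h 0.
  by rewrite addr0 mulr0 subrr subr0 normr0 mulr0.
have := H h; rewrite /ball/= sub0r normrN => /(_ hd h0).
rewrite /= /shift/= /(_ *: _)/= mulr1 [h + t]addrC => H1.
have -> : f (t + h) - f t - df * h = - (df - h^-1 * (f (t + h) - f t)) * h by field.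
by rewrite normrM normrN ler_wpM2r.
Qed.

End RealFunctions.

Section TotalVariationDecay.
Context {R : realType}.

Lemma finite_common_eps (P : nat) (Q : nat -> R -> Prop) :
  (forall p, (p < P)%N -> exists2 d, 0 < d & forall h, 0 < h < d -> Q p h) ->
  exists2 d, 0 < d & forall p h, (p < P)%N -> 0 < h < d -> Q p h.
Proof.
elim: P => [_|P IH H]; first by exists 1.
have [|d d0 Hd] := IH; first by move=> p pP; apply: H; rewrite ltnS ltnW.
have [e e0 He] := H P (ltnSn P).
exists (Num.min d e); first by rewrite lt_min d0.
move=> p h; rewrite lt_min ltnS leq_eqVlt => /orP[/eqP->|pP] /and3P[h0 hd he].
  by apply: He; rewrite h0.
by apply: Hd => //; rewrite h0.
Qed.

Lemma within_continuous_sum (P : nat) (F : nat -> R -> R) (A : set R) :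
  (forall p, (p < P)%N -> {within A, continuous F p}) ->
  {within A, continuous (fun t => \sum_(p < P) F p t)}.
Proof.
move=> H x; elim: P H => [|P IH] H.
  have -> : (fun t => \sum_(p < 0) F p t) = cst 0.
    by apply/funext => t; rewrite big_ord0.
  exact: cvg_cst.
have -> : (fun t => \sum_(p < P.+1) F p t) = (fun t => \sum_(p < P) F p t) \+ F P.
  by apply/funext => t; rewrite big_ord_recr.
apply: (@cvgD _ R^o); first by apply: IH => p pP; apply: H; rewrite ltnS ltnW.
exact: H.
Qed.

(** One explicit Euler step writes each new increment as a combination of two
    consecutive old ones, with total weight at most one per old increment;
    the total variation is thus nonincreasing up to [o(h)]. *)
Lemma tv_nonincreasing (P : nat) (u alpha : nat -> R -> R) (a b A : R) :
  a <= b ->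
  (forall p, (p <= P)%N -> {within `[a, b], continuous (u p)}) ->
  (forall p t, (p <= P)%N -> a < t < b ->
     is_derive t 1 (u p) (alpha p t * (u p.+1 t - u p t))) ->
  (forall p t, (p <= P)%N -> a < t < b -> 0 <= alpha p t <= A) ->
  (forall t, a < t < b -> alpha 0%N t = 0) ->
  (forall t, a < t < b -> alpha P t = 0) ->
  \sum_(p < P) `|u p.+1 b - u p b| <= \sum_(p < P) `|u p.+1 a - u p a|.
Proof.
move=> ab cu du ha a0 aP.
pose f t := \sum_(p < P) `|u p.+1 t - u p t|.
apply: (@dini_nonincreasing R f a b ab).
  apply: (@within_continuous_sum P (fun p t => `|u p.+1 t - u p t|)) => p pP x.
  apply: (@cvg_norm _ R^o); apply: (@cvgB _ R^o); apply: cu => //.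
  exact: ltnW.
move=> t tab e e0.
pose e' := e / (2 * P%:R + 1).
have P0 : 0 <= P%:R :> R by rewrite ler0n.
have e'0 : 0 < e' by rewrite divr_gt0//; lra.
have [|d d0 Hd] := @finite_common_eps P.+1 (fun p h =>
    `|u p (t + h) - u p t - alpha p t * (u p.+1 t - u p t) * h| <= e' * h).
  move=> p pP; have [d d0 H] := is_derive_eps (du p t pP tab) e'0.
  exists d => // h /andP[h0 hd]; move: (H h); rewrite gtr0_norm// => H'.
  exact: H'.
exists (Num.min d (A + 1)^-1).
  rewrite lt_min d0 invr_gt0; have := ha 0%N t (leq0n _) tab; lra.
move=> h; rewrite lt_min => /and3P[h0 hd hA].
have alh p : (p <= P)%N -> 0 <= 1 - h * alpha p t /\ 0 <= h * alpha p t.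
  move=> pP; have /andP[al0 alA] := ha p t pP tab.
  have A1 : 0 < A + 1 by lra.
  split; last by apply: mulr_ge0 => //; lra.
  rewrite subr_ge0; apply: (@le_trans _ _ (h * (A + 1))).
    by apply: ler_wpM2l; lra.
  by rewrite -ler_pdivlMr// mul1r ltW.
rewrite /f.
pose D p := u p.+1 t - u p t.
have step (p : 'I_P) : `|u p.+1 (t + h) - u p (t + h)| <=
    `|D p| + h * (alpha p.+1 t * `|D p.+1| - alpha p t * `|D p|) + 2 * e' * h.
  have pP := ltn_ord p.
  have [H1 H2] := alh p (ltnW pP); have [H3 H4] := alh p.+1 pP.
  have E1 := Hd p h ltac:(by rewrite ltnS ltnW) ltac:(by rewrite h0).
  have E2 := Hd p.+1 h ltac:(by rewrite ltnS) ltac:(by rewrite h0).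
  have -> : u p.+1 (t + h) - u p (t + h) =
     ((1 - h * alpha p t) * D p + h * alpha p.+1 t * D p.+1) +
     (u p.+1 (t + h) - u p.+1 t - alpha p.+1 t * D p.+1 * h) -
     (u p (t + h) - u p t - alpha p t * D p * h) by rewrite /D; ring.
  apply: (le_trans (ler_normB _ _)); apply: (le_trans (lerD (ler_normD _ _) (lexx _))).
  have := ler_normD ((1 - h * alpha p t) * D p) (h * alpha p.+1 t * D p.+1).
  rewrite !normrM (ger0_norm H1) -[X in X * _ * _]ger0_norm ?(ltW h0)// -normrM (ger0_norm H4).
  rewrite /D in E1 E2 *; lra.
apply: (le_trans (ler_sum _ (fun p _ => step p))).
rewrite !big_split/= -mulr_sumr.
have -> : \sum_(p < P) (alpha p.+1 t * `|D p.+1| - alpha p t * `|D p|) = 0.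
  rewrite -(big_mkord xpredT (fun p => alpha p.+1 t * `|D p.+1| - alpha p t * `|D p|)).
  by rewrite telescope_sumr// a0// aP// !mul0r subrr.
rewrite mulr0 addr0 lerD2l sumr_const card_ord -[_ *+ P]mulr_natr.
have E : e' * (2 * P%:R + 1) = e by rewrite /e' divfK// gt_eqF//; lra.
rewrite -subr_ge0.
have -> : e * h - 2 * e' * h * P%:R = e' * h by rewrite -{1}E; ring.
by rewrite mulr_ge0 // ltW.
Qed.

End TotalVariationDecay.

(** * Compactness along an ultrafilter *)

Section Compactness.
Context {d : measure_display} {X : measurableType d} {R : realType}.
Variable mu : {measure set X -> \bar R}.
Variable D : set X.
Hypothesis mD : measurable D.
Hypothesis finD : (mu D < +oo)%E.

Lemma bounded_integrable (f : X -> R) (C : R) : measurable_fun D f ->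
  (forall p, D p -> `|f p| <= C) -> mu.-integrable D (EFin \o f).
Proof.
move=> mf fC; apply: measurable_bounded_integrable => //.
exists C; split; first exact: num_real.
by move=> y Cy p Dp /=; rewrite (le_trans (fC p Dp))// ltW.
Qed.

Lemma bounded_dominated_convergence (f : nat -> X -> R) (g : X -> R) (C : R) :
  (forall k, measurable_fun D (f k)) -> measurable_fun D g ->
  (forall k p, D p -> `|f k p| <= C) -> cvg_ae mu D f g ->
  cvg_L1 mu D f g /\
  \int[mu]_(p in D) f k p @[k --> \oo] --> \int[mu]_(p in D) g p.
Proof.
move=> mf mg fC fg.
have h3 : {ae mu, forall p, D p -> (EFin \o f k) p @[k --> \oo] --> (EFin \o g) p}.
  apply: filterS fg => p fg Dp; apply: cvg_EFin; last exact: fg.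
  by near=> k.
have h4 : mu.-integrable D (EFin \o cst C).
  by apply: (@bounded_integrable (cst C) `|C|).
have h5 : {ae mu, forall p k, D p -> (`|(EFin \o f k) p| <= (EFin \o cst C) p)%E}.
  by apply: aeW => p k Dp; rewrite /= lee_fin; exact: fC.
have [ig cv0 cv] := dominated_convergence mD
  (fun k => (measurable_EFinP _ _).2 (mf k)) ((measurable_EFinP _ _).2 mg) h3 h4 h5.
split; last first.
  apply: fine_cvg; rewrite /Rintegral fineK//.
  exact: integrable_fin_num.
split => //.
by near=> k; exact: bounded_integrable (fC k).
Unshelve. all: by end_near. Qed.

(** Along an ultrafilter containing all tails, being small in the limit yields
    sets of indices on which the sequence is uniformly close; a subsequence
    with summable increments is picked in their intersections. *)
Lemma L1_subsequence (U : set_system nat) (G : set nat) (f : nat -> X -> R) (C : R) :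
  ProperFilter U -> (forall N, U [set j | (N <= j)%N]) -> U G ->
  (forall j, G j -> measurable_fun D (f j)) ->
  (forall j p, G j -> D p -> 0 <= f j p <= C) ->
  (forall e, 0 < e -> exists2 A, U A & forall i j, A i -> A j ->
     (\int[mu]_(p in D) `|f i p - f j p|%:E <= e%:E)%E) ->
  exists (sigma : nat -> nat) (g : X -> R),
    [/\ increasing_seq sigma, forall k, G (sigma k), measurable_fun D g,
        forall p, 0 <= g p <= C \/ C < 0 & cvg_ae mu D (fun k => f (sigma k)) g].
Proof.
move=> PU tailU UG mf fC cauchy.
pose eps k : R := 1 / (2 ^ (k + 1))%:R.
have eps0 k : 0 < eps k by rewrite divr_gt0// ltr0n expn_gt0.
have [A HA] : {A : nat -> set nat & forall k, U (A k) /\ forall i j, A k i -> A k j ->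
    (\int[mu]_(p in D) `|f i p - f j p|%:E <= (eps k)%:E)%E}.
  apply: (@choice _ _ (fun k Ak => U Ak /\ forall i j, Ak i -> Ak j ->
    (\int[mu]_(p in D) `|f i p - f j p|%:E <= (eps k)%:E)%E)) => k.
  by have [A UA HA] := cauchy _ (eps0 k); exists A.
pose B k := G `&` \bigcap_(i in [set i | (i < k.+1)%N]) A i.
have UB k : U (B k).
  apply: filterI => //; elim: k => [|k IH].
    by apply: filterS (HA 0%N).1 => j Aj i; rewrite /= ltnS leqn0 => /eqP ->.
  apply: filterS (filterI IH (HA k.+1).1) => j [h1 h2] i.
  by rewrite /= ltnS leq_eqVlt => /orP[/eqP-> //|]; exact: h1.
have /choice[nx Hnx] : forall ks : nat * nat, exists j, B ks.1 j /\ (ks.2 < j)%N.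
  move=> [k s]; have [j [h1 h2]] := filter_ex (filterI (UB k) (tailU s.+1)).
  by exists j.
pose sigma := fix s k := if k is k'.+1 then nx (k, s k') else nx (0, 0)%N.
have sB k : B k (sigma k) by case: k => [|k]; exact: (Hnx _).1.
have sigma_inc : increasing_seq sigma.
  by apply/increasing_seqP => k; exact: (Hnx (k.+1, sigma k)).2.
have mfs k : measurable_fun D (f (sigma k)) by apply: mf; exact: (sB k).1.
have fsC k p : D p -> 0 <= f (sigma k) p <= C by apply: fC; exact: (sB k).1.
pose h k p := `|f (sigma k.+1) p - f (sigma k) p|.
have mh k : measurable_fun D (EFin \o h k).
  by apply/measurable_EFinP; apply: measurableT_comp => //; exact: measurable_funB.
have hle k : (\int[mu]_(p in D) (h k p)%:E <= (eps k)%:E)%E.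
  apply: (HA k).2.
    by apply: (sB k.+1).2 => /=.
  by apply: (sB k).2 => /=.
have sumh : (\int[mu]_(p in D) (\sum_(0 <= k <oo) (h k p)%:E) < +oo)%E.
  have -> : (\int[mu]_(p in D) (\sum_(0 <= k <oo) (h k p)%:E) =
      \sum_(0 <= k <oo) \int[mu]_(p in D) (h k p)%:E)%E.
    by apply: (integral_nneseries mu mD mh) => k p _; rewrite lee_fin normr_ge0.
  apply: (@le_lt_trans _ _ (\sum_(0 <= k <oo) (eps k)%:E)%E).
    apply: lee_nneseries => // k _ _; apply: integral_ge0 => p _.
    by rewrite lee_fin normr_ge0.
  rewrite (cvg_lim _ (@cvg_geometric_eseries_half R 1 0))//.
  by rewrite ltry.
have mS : measurable_fun D (fun p => \sum_(0 <= k <oo) (h k p)%:E)%E.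
  apply: (@ge0_emeasurable_sum _ X R D (fun k => EFin \o h k) xpredT) => k //.
  by move=> p _ _; rewrite lee_fin normr_ge0.
have S0 p : (0 <= \sum_(0 <= k <oo) (h k p)%:E)%E.
  by apply: nneseries_ge0 => k _ _; rewrite lee_fin normr_ge0.
have iS : mu.-integrable D (fun p => \sum_(0 <= k <oo) (h k p)%:E)%E.
  apply/integrableP; split => //.
  by under eq_integral do rewrite gee0_abs//.
have aecv : {ae mu, forall p, D p -> cvgn (fun k => f (sigma k) p)}.
  apply: filterS (integrable_ae mD iS) => p + Dp => /(_ Dp) fin.
  have cvS : cvgn (series (fun k => h k p)).
    apply: nnseries_is_cvg => [k|]; first exact: normr_ge0.
    by rewrite ltey_eq fin.
  have cvS' : cvgn (series (fun k => f (sigma k.+1) p - f (sigma k) p)).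
    by apply: (@normed_cvg R R^o); exact: cvS.
  have -> : (fun k => f (sigma k) p) = (fun k => f (sigma 0%N) p +
      series (fun k => f (sigma k.+1) p - f (sigma k) p) k).
    apply/funext => k; rewrite /series/= telescope_sumr//.
    by rewrite addrC subrK.
  by apply: is_cvgD => //; exact: is_cvg_cst.
pose g p := Num.max 0 (Num.min C (fine (limn_esup (fun k => (f (sigma k) p)%:E)))).
exists sigma, g; split => //.
- by move=> k; exact: (sB k).1.
- apply: measurable_maxr => //; apply: measurable_minr => //.
  apply: measurableT_comp => //.
  by apply: measurable_fun_limn_esup => k; exact/measurable_EFinP.
- move=> p; case: (ltP C 0) => C0; [by right|left].
  by rewrite le_max lexx/= ge_max C0 ge_min lexx.
- apply: filterS aecv => p + Dp => /(_ Dp) cv.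
  suff -> : g p = limn (fun k => f (sigma k) p) by [].
  rewrite /g is_cvg_limn_esupE; last first.
    by apply/cvg_ex; eexists; apply: cvg_EFin cv; near=> k.
  rewrite (_ : limn _ = (limn (fun k => f (sigma k) p))%:E); last first.
    by apply/cvg_lim => //; apply: cvg_EFin cv; near=> k.
  rewrite /=.
  have l0 : 0 <= limn (fun k => f (sigma k) p).
    by apply: limr_ge => //; near=> k; have /andP[] := fsC k p Dp.
  have lC : limn (fun k => f (sigma k) p) <= C.
    by apply: limr_le => //; near=> k; have /andP[] := fsC k p Dp.
  by rewrite (min_idPr lC) (max_idPr l0).
Unshelve. all: by end_near. Qed.

End Compactness.

(** * Evolution of the particles *)

Section Sequences.
Context {R : realType}.

Lemma count_upward_closed (P : nat) (b : nat -> bool) :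
  (forall i j, (i <= j < P)%N -> b i -> b j) ->
  forall j, (j < P)%N -> b j = (P - \sum_(i < P) b i <= j)%N.
Proof.
elim: P => // P IH H j; rewrite ltnS => jP; rewrite big_ord_recr/=.
case bP: (b P); last first.
  have bF i : (i <= P)%N -> b i = false.
    by move=> iP; apply: contraFF bP; apply: H; rewrite iP ltnSn.
  rewrite bF// big1 ?addn0 ?subn0 ?ltnNge ?jP// => i _.
  by rewrite bF// ltnW.
rewrite addn1 subSS; move: jP; rewrite leq_eqVlt => /orP[/eqP->|jP].
  by rewrite bP leq_subr.
by apply: IH => // i i' /andP[ii' i'P]; apply: H; rewrite ii' ltnW.
Qed.

Lemma tv_splice_left (P a : nat) (u U : nat -> R) (c : R) :
  (forall j, U j = if (j <= a)%N then c else u j) ->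
  \sum_(j < P) `|U j.+1 - U j| <=
    `|c - u 0%N| + \sum_(j < P) `|u j.+1 - u j|.
Proof.
move=> UE.
suff : \sum_(j < P) `|U j.+1 - U j| <=
    `|c - u 0%N| + \sum_(j < P) `|u j.+1 - u j| - `|U P - u P|.
  by move=> /le_trans; apply; rewrite lerBlDr lerDl.
elim: P => [|P IH]; first by rewrite !big_ord0 UE/=; lra.
rewrite !big_ord_recr/=; apply: (le_trans (lerD IH (lexx _))).
suff : `|U P.+1 - U P| <= `|u P.+1 - u P| + `|U P - u P| - `|U P.+1 - u P.+1| by lra.
rewrite !UE; case: (ltnP P a) => Pa.
  rewrite (ltnW Pa) subrr normr0.
  have := ler_distD (u P) c (u P.+1); rewrite (distrC (u P)); lra.
rewrite subrr normr0 subr0; case: leqP => _; last by rewrite subrr normr0; lra.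
have := ler_distD (u P) (u P.+1) c; rewrite (distrC (u P) c); lra.
Qed.

Lemma tv_splice_right (P b : nat) (u U : nat -> R) (c : R) : (b < P)%N ->
  (forall j, U j = if (j <= b)%N then u j else c) ->
  \sum_(j < P) `|U j.+1 - U j| <=
    `|c - u P| + \sum_(j < P) `|u j.+1 - u j|.
Proof.
move=> bP UE.
suff : \sum_(j < P) `|U j.+1 - U j| <=
    \sum_(j < P) `|u j.+1 - u j| + `|U P - u P|.
  by rewrite (UE P) leqNgt bP/= addrC.
elim: P {bP} => [|P IH]; first by rewrite !big_ord0 UE/= subrr normr0 addr0.
rewrite !big_ord_recr/=; apply: (le_trans (lerD IH (lexx _))).
suff : `|U P - u P| + `|U P.+1 - U P| <= `|u P.+1 - u P| + `|U P.+1 - u P.+1| by lra.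
rewrite !UE; case: (ltnP P b) => Pb.
  rewrite (ltnW Pb) !subrr !normr0; lra.
by have := ler_distD (u P.+1) c (u P); case: leqP => bP; rewrite subrr normr0; lra.
Qed.

End Sequences.

Section Step.
Context {R : realType}.
Variables (rhomax vmax delta K : R) (v : R -> R).
Hypothesis delta_gt0 : 0 < delta.
Hypothesis delta_le : delta <= rhomax.
Hypothesis v_lip : forall a b, 0 <= a <= rhomax -> 0 <= b <= rhomax ->
  `|v a - v b| <= K * `|a - b|.
Hypothesis v_dec : forall a b, 0 <= a -> a <= b -> b <= rhomax -> v b <= v a.
Hypothesis v_0 : v 0 = vmax.
Hypothesis v_rhomax : v rhomax = 0.

Let rhomax_gt0 : 0 < rhomax. Proof. exact: lt_le_trans delta_le. Qed.

Lemma vextE r : 0 <= r <= rhomax -> vext rhomax v r = v r.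
Proof.
by move=> /andP[r0 rm]; rewrite /vext (min_idPl rm) (max_idPr r0).
Qed.

Lemma vext_ge r : rhomax <= r -> vext rhomax v r = 0.
Proof. by move=> rm; rewrite /vext (min_idPr rm) (max_idPr _) ?v_rhomax// ltW. Qed.

Lemma vext_range r : 0 <= vext rhomax v r <= vmax.
Proof.
rewrite /vext; set s := Num.max _ _.
have s0 : 0 <= s by rewrite le_max lexx.
have sm : s <= rhomax by rewrite ge_max ltW//= ge_min lexx orbT.
by rewrite -v_0 -{1}v_rhomax !v_dec.
Qed.

Lemma K_ge0 : 0 <= K.
Proof.
have := @v_lip 0 rhomax; rewrite lexx ltW//= lexx => /(_ isT isT).
rewrite sub0r normrN (gtr0_norm rhomax_gt0) => /(le_trans (normr_ge0 _)).
by rewrite pmulr_lge0.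
Qed.

Variables (M : nat) (w : nat -> R) (z : nat -> R -> R) (a b rho0 rho1 : R).
Hypothesis ab : a <= b.
Hypothesis w_gt0 : forall p, 0 < w p.
Hypothesis rho1_range : delta <= rho1 <= rhomax.

Definition gap p t := z p.+1 t - z p t.
Definition dens p t := w p / gap p t.
Definition vel p t := if p == M then v rho1 else vext rhomax v (dens p t).

Hypothesis z_cont : forall p, (p <= M)%N -> {within `[a, b], continuous (z p)}.
Hypothesis z_derive : forall p t, (p <= M)%N -> a < t < b ->
  is_derive t 1 (z p) (vel p t).
Hypothesis gap_start : forall p, (p < M)%N -> w p / rhomax <= gap p a <= w p / delta.

Lemma dens_range p t : w p / rhomax <= gap p t <= w p / delta ->
  0 < gap p t /\ delta <= dens p t <= rhomax.
Proof.
move=> /andP[g1 g2].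
have g0 : 0 < gap p t by apply: lt_le_trans g1; rewrite divr_gt0.
split => //; rewrite /dens ler_pdivlMr// ler_pdivrMr//.
by rewrite mulrC -ler_pdivlMr// g2/= mulrC -ler_pdivrMr.
Qed.

Lemma v_range_delta r : delta <= r <= rhomax -> 0 <= v r <= v delta.
Proof.
move=> /andP[r1 r2]; have r0 : 0 <= r by rewrite (le_trans _ r1)// ltW.
by rewrite -{1}v_rhomax !v_dec// ltW.
Qed.

Lemma gap_within_cont p : (p < M)%N -> {within `[a, b], continuous (gap p)}.
Proof.
move=> pM x; apply: (@cvgB _ R^o); apply: z_cont => //; exact: ltnW.
Qed.

(** Downward induction on [p]: the leader has an admissible velocity, and a
    particle with an admissible velocity keeps its follower at distance. *)
Lemma gap_bounds p t : (p < M)%N -> a <= t <= b -> w p / rhomax <= gap p t <= w p / delta.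
Proof.
suff main s : (s <= M)%N -> (forall t, a < t < b -> 0 <= vel (M - s)%N t <= v delta) /\
    ((0 < s)%N -> forall t, a <= t <= b ->
      w (M - s)%N / rhomax <= gap (M - s)%N t <= w (M - s)%N / delta).
  move=> pM tab; have [|_] := main (M - p)%N; first exact: leq_subr.
  by rewrite subn_gt0 subKn ?(ltnW pM)// => /(_ pM); apply.
clear p t; elim: s => [_|s IH sM].
  by split => // u _; rewrite subn0 /vel eqxx; exact: v_range_delta.
have [|IH1 _] := IH; first exact: ltnW.
have pM : (M - s.+1 < M)%N by lia.
have pS : ((M - s.+1).+1 = M - s)%N by lia.
move: (M - s.+1)%N pM pS => p pM pS.
have dgap u : a < u < b ->
    is_derive u 1 (gap p) (vel p.+1 u - vext rhomax v (dens p u)).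
  move=> uab; apply: is_deriveB; first exact: z_derive.
  have := @z_derive p u (ltnW pM) uab.
  by rewrite /vel ltn_eqF.
have wr0 : 0 < w p / rhomax by rewrite divr_gt0.
have G u : a <= u <= b -> w p / rhomax <= gap p u <= w p / delta.
  move=> uab; apply/andP; split.
    apply: (@barrier_ge R (gap p) _ a b _ (w p / rhomax) wr0 ab (gap_within_cont pM) dgap) => //.
      move=> u' uab' /andP[]; rewrite subrr => g0 gl.
      rewrite (vext_ge _) ?subr0 ?pS; first by have /andP[] := IH1 u' uab'.
      by rewrite /dens ler_pdivlMr// mulrC -ler_pdivlMr// ltW.
    by have /andP[] := gap_start pM.
  apply: (@barrier_le R (gap p) _ a b _ 1 ltr01 ab (gap_within_cont pM) dgap) => //.
    move=> u' uab' /andP[g0 gl].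
    have gp : 0 < gap p u' by apply: lt_trans g0; rewrite divr_gt0.
    have dd : dens p u' <= delta.
      by rewrite /dens ler_pdivrMr// mulrC -ler_pdivrMr// ltW.
    have d0 : 0 <= dens p u' by rewrite divr_ge0 ?ltW.
    rewrite vextE ?d0 ?(le_trans dd)// pS subr_le0.
    have /andP[_ /le_trans] := IH1 u' uab'; apply.
    by apply: v_dec.
  by have /andP[] := gap_start pM.
split; last by [].
move=> u uab; rewrite /vel ltn_eqF//.
have [|_ dr] := @dens_range p u; first by apply: G; lra.
rewrite vextE; last by have := delta_gt0; lra.
exact: v_range_delta.
Qed.

Lemma gap_gt0 p t : (p < M)%N -> a <= t <= b -> 0 < gap p t.
Proof. by move=> pM tab; have [] := dens_range (gap_bounds pM tab). Qed.

Lemma dens_bounds p t : (p < M)%N -> a <= t <= b -> delta <= dens p t <= rhomax.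
Proof. by move=> pM tab; have [] := dens_range (gap_bounds pM tab). Qed.

Lemma velE p t : (p < M)%N -> a <= t <= b -> vel p t = v (dens p t).
Proof.
move=> pM tab; rewrite /vel ltn_eqF// vextE//.
have := delta_gt0; have := dens_bounds pM tab; lra.
Qed.

(** The densities framed by the two boundary values, so that
    [vel p t = v (fdens p.+1 t)] for all [p <= M]. *)
Definition fdens j t :=
  if j is p.+1 then if (p < M)%N then dens p t else rho1 else rho0.

Lemma is_derive_dens p t : (p < M)%N -> a < t < b ->
  is_derive t 1 (dens p) (dens p t / gap p t * (v (dens p t) - v (fdens p.+2 t))).
Proof.
move=> pM tab; have tab' : a <= t <= b by lra.
have g0 := gap_gt0 pM tab'.
have dg : is_derive t 1 (gap p) (v (fdens p.+2 t) - v (dens p t)).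
  have -> : v (fdens p.+2 t) = vel p.+1 t.
    rewrite /=; case: ltnP => pM'; first by rewrite velE.
    by rewrite /vel eqn_leq pM pM'.
  rewrite -(velE pM tab').
  by apply: is_deriveB; apply: z_derive => //; exact: ltnW.
have dV := @is_deriveV R (gap p) t _ 1 (lt0r_neq0 g0) dg.
have : is_derive t 1 (dens p)
    (w p * (- gap p t ^- 2 * (v (fdens p.+2 t) - v (dens p t)))).
  exact: (@is_deriveZ R R^o R^o _ (w p) _ _ _ dV).
congr (is_derive _ _ _ _); rewrite /dens.
by field; rewrite gt_eqF.
Qed.

Lemma tv_step : delta <= rho0 <= rhomax ->
  (forall t, a <= t <= b ->
  \sum_(j < M.+1) `|fdens j.+1 t - fdens j t| <=
  \sum_(j < M.+1) `|fdens j.+1 a - fdens j a|).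
Proof.
move=> rho0_range t /andP[a_t tb].
have dgt := delta_gt0; have dle := delta_le.
have [<-//|at0] := eqVneq a t.
have [m0 m00 Hm0] : exists2 m0, 0 < m0 & forall p, (p < M)%N -> m0 <= w p.
  elim: (M) => [|M' [m0 m00 H]]; first by exists 1.
  exists (Num.min m0 (w M')); first by rewrite lt_min m00 w_gt0.
  move=> p; rewrite ltnS leq_eqVlt => /orP[/eqP->|pM]; first by rewrite ge_min lexx orbT.
  by rewrite ge_min H.
pose slope x y := (v x - v y) / (y - x).
have slopeE x y : slope x y * (y - x) = v x - v y.
  rewrite /slope; have [->|xy] := eqVneq y x; first by rewrite !subrr mulr0.
  by rewrite divfK// subr_eq0.
have slope_range x y : 0 <= x <= rhomax -> 0 <= y <= rhomax -> 0 <= slope x y <= K.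
  move=> xr yr; have [->|xy] := eqVneq y x.
    by rewrite /slope !subrr mul0r lexx K_ge0.
  have := v_lip xr yr.
  rewrite -slopeE normrM distrC ler_pM2r ?normr_gt0 ?subr_eq0 1?eq_sym// => h.
  rewrite (le_trans (ler_norm _) h) andbT /slope.
  case: (ltgtP x y) => [lt|lt|eq].
  - by rewrite divr_ge0// subr_ge0 ?(ltW lt)//; apply: v_dec; lra.
  - rewrite -mulrNN -invrN divr_ge0// opprB subr_ge0 ?(ltW lt)//; apply: v_dec; lra.
  - by move: xy; rewrite eq eqxx.
have frange j s : a <= s <= b -> delta <= fdens j s <= rhomax.
  move=> sab; case: j => [|p]//=; case: ifP => pM //.
  exact: dens_bounds.
pose alpha j s := if j is p.+1 then
    if (p < M)%N then dens p s / gap p s * slope (dens p s) (fdens p.+2 s) else 0 else 0.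
apply: (@tv_nonincreasing R M.+1 fdens alpha a t (rhomax ^+ 2 / m0 * K)) => //.
- have cc (c : R) : {within `[a, t], continuous (fun _ : R => c)}.
    by apply: continuous_subspaceT => ?; exact: cvg_cst.
  move=> p pM; case: p pM => [|p] pM; first exact: (cc rho0).
  rewrite /fdens; case: (ltnP p M) => pM'; last exact: (cc rho1).
  apply/subspace_continuousP => y /= yat.
  have cg := within_itvS (lexx a) tb (gap_within_cont pM').
  apply: (@cvgM R _ _ _ (fun=> w p)); first exact: cvg_cst.
  apply: cvgV; last by move/subspace_continuousP: cg; exact.
  rewrite gt_eqF// gap_gt0//.
  by move: yat; rewrite in_itv/=; lra.
- move=> [|p] s pM sab.
    rewrite /alpha mul0r; exact: is_derive_cst.
  rewrite /alpha /fdens; case: ifP => pM'; last first.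
    rewrite mul0r; exact: is_derive_cst.
  rewrite -mulrA slopeE; apply: is_derive_dens => //; lra.
- move=> [|p] s pM sab /=.
    rewrite lexx mulr_ge0 ?K_ge0// divr_ge0 ?sqr_ge0 ?ltW//.
  case: ifP => pM'; last by rewrite lexx mulr_ge0 ?K_ge0// divr_ge0 ?sqr_ge0 ?ltW.
  have sab' : a <= s <= b by lra.
  have /andP[d1 d2] := dens_bounds pM' sab'.
  have g0 := gap_gt0 pM' sab'.
  have d0 : 0 < dens p s by lra.
  have /andP[s1 s2] : 0 <= slope (dens p s) (fdens p.+2 s) <= K.
    by apply: slope_range; [lra | have := frange p.+2 s sab'; lra].
  apply/andP; split; first by rewrite mulr_ge0// divr_ge0 ?ltW.
  apply: ler_pM => //; first by rewrite divr_ge0 ?ltW.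
  have -> : dens p s / gap p s = dens p s ^+ 2 / w p.
    by rewrite /dens; field; rewrite !gt_eqF.
  apply: ler_pM; rewrite ?sqr_ge0 ?invr_ge0 ?(ltW (w_gt0 _))//.
    by apply: lerXn2r => //; rewrite nnegrE; lra.
  by rewrite lef_pV2 ?posrE//; exact: Hm0.
- by move=> s _; rewrite /alpha ltnn.
Qed.

Lemma z_nondec p s t : (p <= M)%N -> a <= s -> s <= t -> t <= b ->
  z p s <= z p t <= z p s + vmax * (t - s).
Proof.
move=> pM as_ st tb.
have cz : {within `[s, t], continuous (z p)} by apply: within_itvS (z_cont pM).
have [x|c] := @MVT_segment R (z p) (vel p) s t st _ cz.
  rewrite in_itv/= => /andP[sx xt]; apply: z_derive => //; lra.
have /andP[v0 v1] : 0 <= vel p c <= vmax.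
  rewrite /vel; case: ifP => _; last exact: vext_range.
  have dgt := delta_gt0; have dle := delta_le; have r1 := rho1_range.
  by rewrite -v_0 -{1}v_rhomax !v_dec//; lra.
rewrite in_itv/= => cst zE.
have ts : 0 <= t - s by lra.
have := mulr_ge0 v0 ts; have := ler_wpM2r ts v1; lra.
Qed.

End Step.

Section Rearrange.
Context {R : realType}.
Variables (N n : nat) (l q r0 r1 : R) (y : int -> R).
Let M := (n + N)%N.
Let Y (p : nat) := y (p%:Z - N%:Z).

(** The rearranged configuration, particles being counted from the end of the
    queue; [a] and [b] are the particles next to [0] and [1]. *)
Definition moved (a b p : nat) (Y : nat -> R) : R :=
  if p == 0%N then Y a - a.-1%:R * (l / r0) - q / r0
  else if (p < a)%N then Y a - (a - p)%:R * (l / r0)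
  else if (p <= b)%N then Y p else Y b + (p - b)%:R * (l / r1).

Lemma rearrangeE : (1 < N)%N -> (forall i j, (i <= j <= M)%N -> Y i <= Y j) ->
  Y 1%N <= 0 -> 1 <= Y M ->
  exists a b, [/\ (0 < a < N)%N, (a < b <= M)%N, Y a <= 0 /\ 1 <= Y b,
      (forall p, (a < p <= M)%N -> (p < N)%N -> 0 < Y p) &
      forall p, (p <= M)%N ->
        rearrange N n l q r0 r1 y (p%:Z - N%:Z) = moved a b p Y].
Proof.
move=> N1 incY Y1 YM.
have c0 : forall j, (j < N)%N -> (0 < Y j) = (N - crossed0 N y <= j)%N.
  apply: (@count_upward_closed N (fun j => 0 < Y j)) => i j /andP[ij jN] /lt_le_trans.
  by apply; apply: incY; rewrite ij/= /M; lia.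
have c1 : forall j, (j < M.+1)%N -> (1 <= Y j) = (M.+1 - crossed1 N n y <= j)%N.
  by apply: (@count_upward_closed M.+1 (fun j => 1 <= Y j)) => i j /andP[ij jN] /le_trans;
    apply; apply: incY; rewrite ij.
rewrite /rearrange; set h0 := crossed0 N y in c0 *; set h1 := crossed1 N n y in c1 *.
have a1 : (1 < N - h0)%N by rewrite ltnNge -c0// -leNgt.
have bM : (M.+1 - h1 <= M)%N by rewrite -c1.
have Ya : Y (N - h0.+1)%N <= 0 by rewrite leNgt c0; lia.
have Yb : 1 <= Y (M.+1 - h1)%N by rewrite c1.
have ab : (N - h0.+1 < M.+1 - h1)%N.
  rewrite ltnNge -c1; last by rewrite /M; lia.
  by rewrite -ltNge (le_lt_trans Ya).
exists (N - h0.+1)%N, (M.+1 - h1)%N; split => //.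
- lia.
- by rewrite ab.
- by move=> p /andP[ap pM] pN; rewrite c0//; lia.
have ea : - h0%:Z - 1 = (N - h0.+1)%N%:Z - N%:Z by lia.
have eb : n%:Z - h1%:Z + 1 = (M.+1 - h1)%N%:Z - N%:Z by rewrite /M in ab bM *; lia.
rewrite ea eb.
have e1 i : i + h0%:Z + 1 = i - ((N - h0.+1)%N%:Z - N%:Z) by lia.
have e2 i : i - n%:Z + h1%:Z - 1 = i - ((M.+1 - h1)%N%:Z - N%:Z).
  by rewrite -eb; lia.
have a0 : (0 < N - h0.+1)%N by lia.
move: (N - h0.+1)%N (M.+1 - h1)%N a0 ab Ya Yb bM e1 e2 {c0 c1 a1 ea eb}
  => a b a0 ab Ya Yb bM e1 e2 p pM.
pose F i := if i < a%:Z - N%:Z then y (a%:Z - N%:Z) + (i + h0%:Z + 1)%:~R * (l / r0)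
    else if i <= b%:Z - N%:Z then y i
         else y (b%:Z - N%:Z) + (i - n%:Z + h1%:Z - 1)%:~R * (l / r1).
have FE j : F (j%:Z - N%:Z) = if (j < a)%N then Y a - (a - j)%:R * (l / r0) else
   if (j <= b)%N then Y j else Y b + (j - b)%:R * (l / r1).
  rewrite /F e1 e2 ltrD2r lerD2r ltz_nat lez_nat.
  rewrite !opprB !addrA !subrK.
  case: ltnP => ja.
    by rewrite -[j%:Z - a%:Z]opprB (subzn (ltnW ja)) mulrNz mulNr -pmulrn.
  by case: leqP => jb //; rewrite (subzn (ltnW jb)) -pmulrn.
rewrite /place_last -/F /moved.
have -> : (p%:Z - N%:Z == - N%:Z) = (p == 0%N) by apply/eqP/eqP; lia.
case: eqP => [_|p0]; last exact: FE.
transitivity (F (1%N%:Z - N%:Z) - q / r0); first by [].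
rewrite FE.
case: ltnP => a1; first by rewrite subn1.
have -> : a = 1%N by lia.
by rewrite mul0r subr0 (leq_trans _ ab).
Qed.

End Rearrange.

(** What the limit argument uses of the scheme. Here and below, particles are
    counted by naturals from the end of the queue, from [0] to [M]: particle [p]
    is the particle [p - N] of the definitions. *)
Record flow {R : realType} (T : R) (m M : nat) (delta rhomax vmax l V : R)
    (v : R -> R) (w : nat -> R) (z : nat -> nat -> R -> R) : Prop := Flow {
  flow_w : forall p, 0 < w p <= l;
  flow_cont : forall k p, (k < m)%N -> (p <= M)%N ->
    {within `[tgrid T m k, tgrid T m k.+1], continuous (z k p)};
  flow_derive : forall k p t, (k < m)%N -> (p < M)%N ->
    tgrid T m k < t < tgrid T m k.+1 ->
    is_derive t 1 (z k p) (v (dens w (z k) p t));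
  flow_gap : forall k p t, (k < m)%N -> (p < M)%N ->
    tgrid T m k <= t <= tgrid T m k.+1 ->
    0 < gap (z k) p t /\ delta <= dens w (z k) p t <= rhomax;
  flow_speed : forall k p s t, (k < m)%N -> (p <= M)%N ->
    tgrid T m k <= s -> s <= t -> t <= tgrid T m k.+1 ->
    z k p s <= z k p t <= z k p s + vmax * (t - s);
  flow_tv : forall k t, (k < m)%N -> tgrid T m k <= t <= tgrid T m k.+1 ->
    \sum_(p < M.-1) `|dens w (z k) p.+1 t - dens w (z k) p t| <= V;
  flow_cover : forall k t, (k < m)%N -> tgrid T m k <= t <= tgrid T m k.+1 ->
    z k 0%N t <= 0 /\ 1 <= z k M t;
  flow_rearrange : forall k, (k.+1 < m)%N -> exists a b,
    [/\ (a < b <= M)%N, z k a (tgrid T m k.+1) <= 0 /\ 1 <= z k b (tgrid T m k.+1),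
        forall p, (a <= p <= b)%N ->
          z k.+1 p (tgrid T m k.+1) = z k p (tgrid T m k.+1),
        forall p, (p < a)%N -> z k.+1 p (tgrid T m k.+1) <= 0 &
        forall p, (b < p <= M)%N -> 1 <= z k.+1 p (tgrid T m k.+1)] }.

(** [lia] fails or diverges on contexts with many real-valued hypotheses. *)
Ltac nlia := repeat match goal with H : ?P |- _ =>
  lazymatch P with
  | is_true (leq _ _) => fail
  | is_true (andb (leq _ _) (leq _ _)) => fail
  | @eq nat _ _ => fail
  | _ => clear H
  end end; lia.

Lemma sum_drop_ends (R : realType) (P : nat) (F : nat -> R) : (0 < P)%N ->
  (forall j, 0 <= F j) -> \sum_(p < P.-1) F p.+1 <= \sum_(j < P.+1) F j.
Proof.
case: P => // P _ F0; rewrite big_ord_recl big_ord_recr/=.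
by rewrite addrCA lerDl addr_ge0.
Qed.

Section Evolution.
Context {R : realType}.
Variables (T rhomax vmax delta K L0 L1 W0 l q : R) (v rho0 rho1 : R -> R).
Variables (n m N : nat) (x : nat -> int -> R -> R).
Variable M : nat.
Hypothesis ME : M = (n + N)%N.
Let tg := tgrid T m.
Let z k (p : nat) t := x k (p%:Z - N%:Z) t.
Let w (p : nat) := if p == 0%N then q else l.

Hypothesis T_gt0 : 0 < T.
Hypothesis m_gt0 : (0 < m)%N.
Hypothesis n_gt0 : (0 < n)%N.
Hypothesis delta_gt0 : 0 < delta.
Hypothesis delta_le : delta <= rhomax.
Hypothesis vmax_gt0 : 0 < vmax.
Hypothesis v_lip : forall a b, 0 <= a <= rhomax -> 0 <= b <= rhomax ->
  `|v a - v b| <= K * `|a - b|.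
Hypothesis v_dec : forall a b, 0 <= a -> a <= b -> b <= rhomax -> v b <= v a.
Hypothesis v_0 : v 0 = vmax.
Hypothesis v_rhomax : v rhomax = 0.
Hypothesis rho0_range : forall t, 0 <= t -> delta <= rho0 t <= rhomax.
Hypothesis rho1_range : forall t, 0 <= t -> delta <= rho1 t <= rhomax.
Hypothesis rho0_lip : forall s t, 0 <= s -> s <= t -> `|rho0 t - rho0 s| <= L0 * (t - s).
Hypothesis rho1_lip : forall s t, 0 <= s -> s <= t -> `|rho1 t - rho1 s| <= L1 * (t - s).
Hypothesis q_range : 0 < q <= l.
Hypothesis queue_long : vmax * T < (N.-1)%:R * (l / rhomax).
Hypothesis z_cont : forall k p, (k < m)%N -> (p <= M)%N ->
  {within `[tg k, tg k.+1], continuous (z k p)}.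
Hypothesis z_derive : forall k p t, (k < m)%N -> (p <= M)%N ->
  tg k < t < tg k.+1 ->
  is_derive t 1 (z k p) (vel rhomax v M w (z k) (rho1 (tg k)) p t).
Hypothesis z_rearrange : forall k p, (k.+1 < m)%N -> (p <= M)%N ->
  z k.+1 p (tg k.+1) =
  rearrange N n l q (rho0 (tg k.+1)) (rho1 (tg k.+1))
    (fun i => x k i (tg k.+1)) (p%:Z - N%:Z).

Lemma tgridS (k : nat) : tg k.+1 = tg k + T / m%:R.
Proof. by rewrite /tg /tgrid -natr1 mulrDl mul1r. Qed.

Lemma tgrid_ge0 (k : nat) : 0 <= tg k.
Proof. by rewrite /tg /tgrid mulr_ge0// divr_ge0// ltW. Qed.

Lemma tgrid_le (j k : nat) : (j <= k)%N -> tg j <= tg k.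
Proof. by move=> jk; rewrite /tg /tgrid ler_wpM2r ?ler_nat// divr_ge0// ltW. Qed.

Lemma tgrid_last : tg m = T.
Proof. by rewrite /tg /tgrid mulrC divfK// pnatr_eq0 -lt0n. Qed.

(** The invariant kept between times [tg k] and [tg k.+1]. The third clause
    says that particles pass [0] one at a time, at distance at least
    [l / rhomax], hence that the queue is never used up. *)
Definition scheme_invariant k t :=
  [/\ forall p, (p < M)%N -> w p / rhomax <= gap (z k) p t <= w p / delta,
      \sum_(j < M.+1) `|fdens M w (z k) (rho0 (tg k)) (rho1 (tg k)) j.+1 t
                       - fdens M w (z k) (rho0 (tg k)) (rho1 (tg k)) j t|
        <= W0 + (L0 + L1) * tg k,
      forall p, (0 < p <= N)%N ->
        0 < z k p t \/ z k p t <= vmax * t - (N - p)%:R * (l / rhomax),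
      z k 1%N t <= vmax * t - (N.-1)%:R * (l / rhomax) &
      1 <= z k M t].

Hypothesis invariant_start : scheme_invariant 0 0.

Let w_gt0 p : 0 < w p.
Proof. by rewrite /w; case: ifP => _; have := q_range; lra. Qed.

Let N_gt1 : (1 < N)%N.
Proof.
rewrite ltnNge; apply/negP => N1; have := queue_long.
have -> : N.-1 = 0%N by nlia.
by rewrite mul0r ltNge mulr_ge0// ltW.
Qed.

Lemma invariant_step k t : (k < m)%N -> tg k <= t <= tg k.+1 ->
  scheme_invariant k (tg k) -> scheme_invariant k t.
Proof.
move=> km /andP[kt tk] [I1 I2 I3 I4 I5].
have kk : tg k <= tg k.+1 by apply: tgrid_le.
have r0 := rho0_range (tgrid_ge0 k); have r1 := rho1_range (tgrid_ge0 k).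
have ktk : tg k <= t <= tg k.+1 by rewrite kt.
have zc p : (p <= M)%N -> _ := @z_cont k p km.
have zd p t' : (p <= M)%N -> _ := @z_derive k p t' km.
have speed p : (p <= M)%N -> z k p (tg k) <= z k p t <= z k p (tg k) + vmax * (t - tg k).
  move=> pM.
  by apply: (z_nondec delta_gt0 delta_le v_dec v_0 v_rhomax r1 zc zd pM).
split.
- move=> p pM.
  exact: (gap_bounds delta_gt0 delta_le v_dec v_rhomax kk w_gt0 r1 zc zd I1 pM ktk).
- apply: le_trans I2.
  exact: (tv_step delta_gt0 delta_le v_lip v_dec v_rhomax kk w_gt0 r1 zc zd I1 r0 ktk).
- move=> p p0; have pM : (p <= M)%N by nlia.
  have sp := speed p pM; case: (I3 p p0) => h; first by left; lra.
  by right; lra.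
- have := speed 1%N ltac:(nlia); lra.
- by have := speed M (leqnn _); lra.
Qed.

Lemma invariant_lt0 k t : t <= T -> scheme_invariant k t -> z k 1%N t < 0.
Proof.
move=> tT [_ _ _ I4 _]; apply: (le_lt_trans I4).
have := queue_long; have := ler_wpM2l (ltW vmax_gt0) tT; lra.
Qed.

Lemma invariant_inc k t : scheme_invariant k t -> forall i j, (i <= j <= M)%N ->
  z k i t <= z k j t.
Proof.
move=> [I1 _ _ _ _] i j /andP[ij].
elim: j ij => [|j IH]; first by rewrite leqn0 => /eqP ->.
rewrite leq_eqVlt => /orP[/eqP->//|]; rewrite ltnS => ij jM.
apply: (le_trans (IH ij (ltnW jM))); rewrite -subr_ge0.
have /andP[h _] := I1 j jM; apply: le_trans h.
by rewrite divr_ge0 ?ltW//; exact: lt_le_trans delta_le.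
Qed.

Lemma rearrangedE k : (k.+1 < m)%N -> scheme_invariant k (tg k.+1) ->
  let Y p := z k p (tg k.+1) in
  exists a b, [/\ (0 < a < N)%N, (a < b <= M)%N, Y a <= 0 /\ 1 <= Y b,
    (forall p, (a < p <= M)%N -> (p < N)%N -> 0 < Y p) &
    forall p, (p <= M)%N -> z k.+1 p (tg k.+1) =
      moved l q (rho0 (tg k.+1)) (rho1 (tg k.+1)) a b p Y].
Proof.
move=> km I Y.
have kT : tg k.+1 <= T by rewrite -tgrid_last; apply: tgrid_le; exact: ltnW.
have incY := invariant_inc I.
have [_ _ _ _ YM] := I.
have Y1 := ltW (invariant_lt0 kT I).
rewrite /Y ME in incY YM *; have [a [b [h1 h2 h3 h4 h5]]] := @rearrangeE R N n l q (rho0 (tg k.+1))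
  (rho1 (tg k.+1)) (fun i => x k i (tg k.+1)) N_gt1 incY Y1 YM.
exists a, b; split => // p pM.
by rewrite z_rearrange ?h5// ME.
Qed.

Lemma invariant_rearrange k : (k.+1 < m)%N -> scheme_invariant k (tg k.+1) ->
  scheme_invariant k.+1 (tg k.+1).
Proof.
move=> km I; have [a [b [a0N abM [Ya Yb] Yap zE]]] := rearrangedE km I.
case: I => I1 I2 I3 I4 I5.
have t0 := tgrid_ge0 k.+1.
have r0 := rho0_range t0; have r1 := rho1_range t0.
have dgt := delta_gt0; have dle := delta_le; have qr := q_range.
have NM : (N < M)%N by nlia.
have l0 : 0 < l by lra.
set t := tg k.+1 in I1 I2 I3 I4 I5 Ya Yb Yap zE t0 r0 r1 *.
have r00 : 0 < rho0 t by lra.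
have r10 : 0 < rho1 t by lra.
have gapE p : (p < M)%N -> gap (z k.+1) p t =
    if (p < a)%N then w p / rho0 t else if (p < b)%N then gap (z k) p t else l / rho1 t.
  move=> pM; rewrite /gap !zE//; last exact: ltnW.
  rewrite /moved /=; case: (posnP p) => [->|p0].
    rewrite (_ : (0 < a)%N = true); last by nlia.
    rewrite /w eqxx; case: (ltnP 1 a) => a1.
      by rewrite subn1; ring.
    have -> : a = 1%N by nlia.
    rewrite (_ : (1 <= b)%N = true); last by nlia.
    by rewrite /=; ring.
  rewrite ?gtn_eqF//.
  case: (ltnP p a) => pa.
    rewrite (ltnW (leq_ltn_trans pa (_ : (a < b)%N))); last by nlia.
    rewrite /w gtn_eqF//.
    case: (ltnP p.+1 a) => pa'.
      have -> : (a - p = (a - p.+1).+1)%N by nlia.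
      by rewrite -natr1; ring.
    have -> : a = p.+1 by nlia.
    by rewrite subSn// subnn; ring.
  rewrite ltnNge (leq_trans pa (leqnSn p))/=.
  case: (ltnP p b) => pb; first by rewrite (ltnW pb).
  rewrite subSn//; case: ltngtP pb => // pb _.
    by rewrite -natr1; ring.
  by rewrite -pb subnn; ring.
have densE p : (p < M)%N -> dens w (z k.+1) p t =
    if (p < a)%N then rho0 t else if (p < b)%N then dens w (z k) p t else rho1 t.
  move=> pM; rewrite /dens gapE//; case: ltnP => pa.
    by have := w_gt0 p => w0; field; rewrite !gt_eqF.
  case: ltnP => // pb; rewrite /w gtn_eqF; last by nlia.
  by field; rewrite !gt_eqF.
split.
- move=> p pM; rewrite gapE//; have w0 := w_gt0 p.
  case: ltnP => pa.
    by apply/andP; split; rewrite ler_pM2l// lef_pV2 ?posrE//; lra.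
  case: ltnP => pb; first exact: I1.
  rewrite /w gtn_eqF; last by nlia.
  by apply/andP; split; rewrite ler_pM2l// lef_pV2 ?posrE//; lra.
- pose u j := fdens M w (z k) (rho0 (tg k)) (rho1 (tg k)) j t.
  pose U j := if (j <= a)%N then rho0 t else u j.
  pose U' j := if (j <= b)%N then U j else rho1 t.
  have uE j : (j <= M.+1)%N -> fdens M w (z k.+1) (rho0 t) (rho1 t) j t = U' j.
    rewrite /U' /U /u; case: j => [|p pM]; first by rewrite /= !leq0n.
    rewrite /= ; case: (ltnP p M) => pM'.
      rewrite densE//; case: (ltnP p a) => // pa.
      by rewrite (leq_trans pa _)//; nlia.
    by rewrite (_ : (p < b)%N = false)//; nlia.
  rewrite (eq_bigr (fun j : 'I_M.+1 => `|U' j.+1 - U' j|)); last first.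
    by move=> j _; rewrite (uE _ (ltn_ord j)) (uE _ (ltnW (ltn_ord j))).
  have bM : (b < M.+1)%N by nlia.
  apply: (le_trans (@tv_splice_right R M.+1 b U U' (rho1 t) bM (fun=> erefl))).
  have UM : U M.+1 = rho1 (tg k).
    by rewrite /U /u /= ltnn (_ : (M < a)%N = false)//; nlia.
  rewrite UM.
  apply: (le_trans (lerD (lexx _) (@tv_splice_left R M.+1 a u U (rho0 t) (fun=> erefl)))).
  apply: (le_trans (lerD (rho1_lip (tgrid_ge0 k) (tgrid_le (leqnSn k)))
    (lerD (rho0_lip (tgrid_ge0 k) (tgrid_le (leqnSn k))) I2))).
  by rewrite /t tgridS; lra.
- move=> p /andP[p0 pN].
  have pM : (p <= M)%N by nlia.
  rewrite zE// /moved gtn_eqF//.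
  have Ha := I3 a ltac:(nlia).
  have Ya' : z k a t <= vmax * t - (N - a)%:R * (l / rhomax) by case: Ha => //; lra.
  case: (ltnP p a) => pa.
    right.
    have -> : (N - p = (N - a) + (a - p))%N by nlia.
    rewrite natrD mulrDl.
    have : (a - p)%:R * (l / rhomax) <= (a - p)%:R * (l / rho0 t).
      by apply: ler_wpM2l => //; rewrite ler_pM2l// lef_pV2 ?posrE//; lra.
    lra.
  case: (leqP p b) => pb; first exact: I3 p ltac:(nlia).
  left; apply: (lt_le_trans ltr01); apply: (le_trans Yb).
  by rewrite lerDl mulr_ge0// divr_ge0 ?ltW.
- have Ha := I3 a ltac:(nlia).
  have Ya' : z k a t <= vmax * t - (N - a)%:R * (l / rhomax) by case: Ha => //; lra.
  rewrite zE; last by nlia.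
  rewrite /moved /=; case: (ltnP 1 a) => a1.
    have -> : (N.-1 = (N - a) + (a - 1))%N by nlia.
    rewrite natrD mulrDl.
    have : (a - 1)%:R * (l / rhomax) <= (a - 1)%:R * (l / rho0 t).
      by apply: ler_wpM2l => //; rewrite ler_pM2l// lef_pV2 ?posrE//; lra.
    lra.
  by rewrite (_ : (1 <= b)%N = true)//; nlia.
- rewrite zE// /moved gtn_eqF; last by nlia.
  rewrite (_ : (M < a)%N = false); last by nlia.
  case: ifP => // _; apply: (le_trans Yb).
  by rewrite lerDl mulr_ge0// divr_ge0 ?ltW.
Qed.

Lemma invariantP k t : (k < m)%N -> tg k <= t <= tg k.+1 -> scheme_invariant k t.
Proof.
move=> km; suff Ik : scheme_invariant k (tg k) by move=> kt; exact: invariant_step.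
elim: k km {t} => [_|k IH km].
  by rewrite /tg /tgrid mul0r.
apply: invariant_rearrange => //.
have km' : (k < m)%N by exact: ltnW.
by apply: invariant_step => //; [rewrite lexx andbT; exact: tgrid_le | exact: IH].
Qed.

Lemma scheme_flow : flow T m M delta rhomax vmax l (W0 + (L0 + L1) * T) v w z.
Proof.
have wr0 : 0 < rhomax := lt_le_trans delta_gt0 delta_le.
have kk k : tg k <= tg k.+1 by exact: tgrid_le.
have Istart k (km : (k < m)%N) : scheme_invariant k (tg k).
  by apply: invariantP => //; rewrite lexx kk.
have L0_ge0 : 0 <= L0 + L1.
  have := rho0_lip (lexx 0) ler01; have := rho1_lip (lexx 0) ler01.
  rewrite subr0 !mulr1 => /(le_trans (normr_ge0 _)) h1 /(le_trans (normr_ge0 _)) h0.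
  exact: addr_ge0.
have kT k : (k < m)%N -> tg k.+1 <= T by move=> km; rewrite -tgrid_last; exact: tgrid_le.
split.
- by move=> p; have qr := q_range; rewrite /w; case: ifP; lra.
- exact: z_cont.
- move=> k p t km pM kt.
  have r1 := rho1_range (tgrid_ge0 k).
  have [I1 _ _ _ _] := Istart k km.
  have := z_derive km (ltnW pM) kt.
  have kt' : tg k <= t <= tg k.+1 by case/andP: kt => h1 h2; rewrite /tg (ltW h1) ltW.
  rewrite (velE delta_gt0 delta_le v_dec v_rhomax (kk k) w_gt0 r1
    (fun p => @z_cont k p km) (fun p t => @z_derive k p t km) I1 pM kt'); exact.
- move=> k p t km pM kt; have [I1 _ _ _ _] := invariantP km kt.
  exact: (dens_range delta_gt0 delta_le w_gt0 (I1 p pM)).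
- move=> k p s t km pM ks st tk.
  have r1 := rho1_range (tgrid_ge0 k).
  exact: (z_nondec delta_gt0 delta_le v_dec v_0 v_rhomax r1
    (fun p => @z_cont k p km) (fun p t => @z_derive k p t km) pM ks st tk).
- move=> k t km kt; have [_ I2 _ _ _] := invariantP km kt.
  apply: (@le_trans _ _ (W0 + (L0 + L1) * tg k)); last first.
    rewrite lerD2l ler_wpM2l//; apply: le_trans (kT k km); exact: kk.
  apply: le_trans I2.
  have M0 : (0 < M)%N by nlia.
  apply: le_trans (sum_drop_ends M0 (fun j => normr_ge0 (fdens M w (z k)
    (rho0 (tg k)) (rho1 (tg k)) j.+1 t - fdens M w (z k) (rho0 (tg k)) (rho1 (tg k)) j t))).
  apply: ler_sum => p _; have pM : (p.+1 < M)%N by have := ltn_ord p; rewrite -ltnS prednK.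
  by rewrite /fdens pM (ltnW pM).
- move=> k t km kt; have I := invariantP km kt.
  have tT : t <= T by case/andP: kt => _ /le_trans; apply; exact: kT.
  split; last by case: I.
  apply: (le_trans _ (ltW (invariant_lt0 tT I))).
  by apply: (invariant_inc I); nlia.
- move=> k km.
  have I : scheme_invariant k (tg k.+1) by apply: invariantP; [exact: ltnW | rewrite lexx kk].
  have t0 := tgrid_ge0 k.+1.
  have r0 := rho0_range t0; have r1 := rho1_range t0.
  have dgt := delta_gt0; have qr := q_range.
  have [a [b [a0N abM [Ya Yb] Yap zE]]] := rearrangedE km I.
  exists a, b; split => //.
  + move=> p /andP[ap pb]; rewrite zE; last by nlia.
    by rewrite /moved gtn_eqF ?(leq_trans _ ap) ?ltnNge ?ap ?pb//; nlia.
  + move=> p pa; rewrite zE; last by nlia.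
    have q0 : 0 <= q / rho0 (tg k.+1) by rewrite divr_ge0; lra.
    have l0 : 0 <= l / rho0 (tg k.+1) by rewrite divr_ge0; lra.
    rewrite /moved; case: ifP => _.
      by have := mulr_ge0 (ler0n R a.-1) l0; lra.
    by rewrite pa; have := mulr_ge0 (ler0n R (a - p)) l0; lra.
  + move=> p /andP[bp pM]; rewrite zE; last by nlia.
    have l0 : 0 <= l / rho1 (tg k.+1) by rewrite divr_ge0; lra.
    rewrite /moved gtn_eqF; last by nlia.
    have pa : (p < a)%N = false by nlia.
    rewrite pa leqNgt bp/=.
    by have := mulr_ge0 (ler0n R (p - b)) l0; lra.
Qed.

End Evolution.

(** * Initial positions *)

Section IntervalIntegrals.
Context {R : realType}.
Notation mu := (@lebesgue_measure R).

Lemma lebesgue_itv_oo (a b : R) : a <= b -> mu `]a, b[ = (b - a)%:E.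
Proof.
rewrite le_eqVlt => /orP[/eqP->|ab]; rewrite lebesgue_measure_itv/= lte_fin.
  by rewrite ltxx subrr.
by rewrite ab.
Qed.

Lemma lebesgue_itv_oo_lty (a b : R) : (mu `]a, b[ < +oo)%E.
Proof.
case: (leP a b) => ab; first by rewrite lebesgue_itv_oo// ltry.
by rewrite lebesgue_measure_itv/= lte_fin (ltNge a) (ltW ab)/= ltry.
Qed.

Lemma itv_oo_integrable (f : R -> R) (C a b : R) :
  measurable_fun `]a, b[ f -> (forall y, a < y < b -> `|f y| <= C) ->
  mu.-integrable `]a, b[ (EFin \o f).
Proof.
move=> mf fC; apply: (@bounded_integrable _ _ _ mu _ _ (lebesgue_itv_oo_lty a b) f C) => //.
Qed.

Lemma Rintegral_oo_split (f : R -> R) (a b c : R) : a <= c -> c <= b ->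
  mu.-integrable `]a, b[ (EFin \o f) ->
  \int[mu]_(y in `]a, b[) f y =
  \int[mu]_(y in `]a, c[) f y + \int[mu]_(y in `]c, b[) f y.
Proof.
move=> ac cb int.
have e0 (u : R) : `]u, u[%classic = set0 :> set R by rewrite set_itv_ge ?bnd_simp ?ltxx.
move: ac cb; rewrite le_eqVlt => /orP[/eqP<- cb|ac].
  by rewrite e0 Rintegral_set0 add0r.
rewrite le_eqVlt => /orP[/eqP->|cb].
  by rewrite e0 Rintegral_set0 addr0.
have H := @Rintegral_itvB R f (BRight a) (BLeft b) c int.
rewrite -(H _ _) ?bnd_simp// ?ltW//.
rewrite (@Rintegral_itv_bndo_bndc R _ c f).
  by rewrite addrCA subrr addr0.
apply: integrableS int => //.
by move=> y /=; rewrite !in_itv/= => /andP[-> /lt_trans]; apply.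
Qed.

Lemma Rintegral_oo_bounds (f : R -> R) (c C a b : R) : a <= b ->
  measurable_fun `]a, b[ f ->
  {ae mu, forall y, a < y < b -> c <= f y <= C} ->
  mu.-integrable `]a, b[ (EFin \o f) ->
  c * (b - a) <= \int[mu]_(y in `]a, b[) f y <= C * (b - a).
Proof.
move=> ab mf fC int.
have cst_int (k : R) : \int[mu]_(y in `]a, b[) k = k * (b - a).
  rewrite Rintegral_cst//; congr (_ * _).
  by have /(congr1 fine) := lebesgue_itv_oo ab.
have icst (k : R) : mu.-integrable `]a, b[ (EFin \o (fun=> k)).
  by apply: (@itv_oo_integrable _ `|k|).
pose g y := Num.max c (Num.min (f y) C).
have mg : measurable_fun `]a, b[ g.
  by apply: measurable_maxr => //; apply: measurable_minr.
have gE : \int[mu]_(y in `]a, b[) f y = \int[mu]_(y in `]a, b[) g y.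
  rewrite /Rintegral; congr fine; apply: ae_eq_integral => //.
  - exact/measurable_EFinP.
  - exact/measurable_EFinP.
  - have FF : Filter (almost_everywhere mu) by exact: ae_filter_ringOfSetsType.
    apply: filterS fC => y fC /=; rewrite in_itv/= => /fC /andP[h1 h2].
    by rewrite /g (min_idPl h2) (max_idPr h1).
have [cC|cC] := leP c C; last first.
  have ba : a = b.
    apply/eqP; rewrite eq_le ab/= leNgt; apply/negP => ltab.
    have : mu `]a, b[ = 0%E.
      case: fC => A [mA A0 HA]; apply: (subset_measure0 _ mA _ A0) => //.
      move=> y /=; rewrite in_itv/= => yab; apply: HA => /= /(_ yab) /andP[h1 h2].
      by have := le_trans h1 h2; rewrite leNgt cC.
    by rewrite lebesgue_itv_oo// => -[]; lra.
  by rewrite ba subrr !mulr0 set_itv_ge ?bnd_simp ?ltxx// Rintegral_set0 lexx.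
have ig : mu.-integrable `]a, b[ (EFin \o g).
  apply: (@itv_oo_integrable _ (`|c| + `|C|)) => // y _.
  rewrite ler_norml /g le_max ge_max ge_min; apply/andP; split.
    have := ler_norm (- c); rewrite normrN => ?; have := normr_ge0 C => ?.
    by apply/orP; left; lra.
  have := ler_norm c; have := ler_norm C; have := normr_ge0 c; have := normr_ge0 C => *.
  by apply/andP; split; [lra | apply/orP; right; lra].
rewrite gE -!cst_int; apply/andP; split; apply: le_Rintegral => // y _; rewrite /g.
  by rewrite le_max lexx.
by rewrite ge_max cC ge_min lexx orbT.
Qed.

End IntervalIntegrals.

Section InitialDatum.
Context {R : realType}.
Notation mu := (@lebesgue_measure R).
Implicit Types a b c x y : R.
Variables (delta rhomax : R) (rhobar : R -> R).
Hypothesis delta_gt0 : 0 < delta.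
Hypothesis delta_le : delta <= rhomax.
Hypothesis rhobar_meas : measurable_fun (`]0, 1[%classic : set R) rhobar.
Hypothesis rhobar_range : {ae mu, forall x, 0 < x < 1 -> delta <= rhobar x <= rhomax}.

Definition clamp x := Num.max delta (Num.min (rhobar x) rhomax).

Lemma clamp_range x : delta <= clamp x <= rhomax.
Proof. by rewrite /clamp le_max lexx/= ge_max delta_le ge_min lexx orbT. Qed.

Lemma clamp_id x : delta <= rhobar x <= rhomax -> clamp x = rhobar x.
Proof. by move=> /andP[h1 h2]; rewrite /clamp (min_idPl h2) (max_idPr h1). Qed.

Lemma clamp_norm x : `|clamp x| <= rhomax.
Proof.
have /andP[h1 h2] := clamp_range x.
by rewrite ger0_norm// (le_trans _ h1)// ltW.
Qed.

Let sub01 a b : 0 <= a -> b <= 1 -> `]a, b[%classic `<=` (`]0, 1[%classic : set R).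
Proof.
move=> a0 b1 y /=; rewrite !in_itv/= => /andP[ay yb].
by rewrite (le_lt_trans a0 ay) (lt_le_trans yb b1).
Qed.

Lemma rhobar_meas_sub a b : 0 <= a -> b <= 1 -> measurable_fun `]a, b[ rhobar.
Proof. by move=> a0 b1; apply: measurable_funS rhobar_meas => //; exact: sub01. Qed.

Lemma clamp_meas_sub a b : 0 <= a -> b <= 1 -> measurable_fun `]a, b[ clamp.
Proof.
move=> a0 b1; apply: measurable_maxr => //; apply: measurable_minr => //.
exact: rhobar_meas_sub.
Qed.

Lemma clamp_ae : {ae mu, forall x, 0 < x < 1 -> rhobar x = clamp x}.
Proof.
have FF : Filter (almost_everywhere mu) by exact: ae_filter_ringOfSetsType.
by apply: filterS rhobar_range => x h /h /clamp_id.
Qed.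

Definition J a b := \int[mu]_(y in `]a, b[) clamp y.

Lemma Rintegral_clampE (h : R -> R -> R) a b : 0 <= a -> b <= 1 ->
  measurable_fun `]a, b[ (fun y => h y (rhobar y)) ->
  measurable_fun `]a, b[ (fun y => h y (clamp y)) ->
  \int[mu]_(y in `]a, b[) h y (rhobar y) = \int[mu]_(y in `]a, b[) h y (clamp y).
Proof.
move=> a0 b1 m1 m2; rewrite /Rintegral; congr fine; apply: ae_eq_integral => //.
- exact/measurable_EFinP.
- exact/measurable_EFinP.
- have FF : Filter (almost_everywhere mu) by exact: ae_filter_ringOfSetsType.
  apply: filterS clamp_ae => y fC /= yab; rewrite fC//.
  by have := sub01 a0 b1 yab; rewrite /= in_itv.
Qed.

Lemma JE a b : 0 <= a -> b <= 1 -> \int[mu]_(y in `]a, b[) rhobar y = J a b.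
Proof.
move=> a0 b1; apply: (@Rintegral_clampE (fun _ r => r)) => //.
- exact: rhobar_meas_sub.
- exact: clamp_meas_sub.
Qed.

Lemma massE : mass rhobar = J 0 1.
Proof.
rewrite /mass (@Rintegral_clampE (fun _ r => `|r|)) => //; last first.
- by apply: measurableT_comp => //; exact: clamp_meas_sub.
- by apply: measurableT_comp => //; exact: rhobar_meas_sub.
apply: eq_Rintegral => y _; rewrite ger0_norm//.
by have /andP[h _] := clamp_range y; rewrite (le_trans _ h)// ltW.
Qed.

Lemma J_split a b c : 0 <= a -> a <= c -> c <= b -> b <= 1 -> J a b = J a c + J c b.
Proof.
move=> a0 ac cb b1; apply: Rintegral_oo_split => //.
apply: (@itv_oo_integrable _ _ rhomax); first exact: clamp_meas_sub.
by move=> y _; exact: clamp_norm.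
Qed.

Lemma J_bounds a b : 0 <= a -> a <= b -> b <= 1 ->
  delta * (b - a) <= J a b <= rhomax * (b - a).
Proof.
move=> a0 ab b1; apply: Rintegral_oo_bounds => //.
- exact: clamp_meas_sub.
- by apply: aeW => y _; exact: clamp_range.
- apply: (@itv_oo_integrable _ _ rhomax); first exact: clamp_meas_sub.
  by move=> y _; exact: clamp_norm.
Qed.

Lemma J_ge a b : b <= a -> J a b = 0.
Proof.
by move=> ba; rewrite /J set_itv_ge ?Rintegral_set0// bnd_simp -leNgt.
Qed.

Variable n : nat.
Hypothesis n_gt0 : (0 < n)%N.
Let l := cell_mass rhobar n.

Lemma mass_bounds : delta <= mass rhobar <= rhomax.
Proof. by rewrite massE; have := @J_bounds 0 1; rewrite subr0 !mulr1; apply. Qed.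

Lemma cell_mass_gt0 : 0 < l.
Proof.
by rewrite divr_gt0 ?ltr0n//; have := mass_bounds; have := delta_gt0; lra.
Qed.

Lemma cell_mass_n : l * n%:R = J 0 1.
Proof. by rewrite /l /cell_mass -massE divfK// pnatr_eq0 -lt0n. Qed.

Lemma init_inner_spec i : (i <= n)%N ->
  0 <= init_inner rhobar n i <= 1 /\ J 0 (init_inner rhobar n i) = i%:R * l /\
  ((0 < i)%N -> init_inner rhobar n i.-1 <= init_inner rhobar n i).
Proof.
have l0 := cell_mass_gt0.
elim: i => [_|i IH iN]; first by rewrite /= lexx ler01 J_ge// mul0r.
have [/andP[x0 x1] [Jx _]] := IH (ltnW iN).
set x := init_inner rhobar n i in x0 x1 Jx *.
have Jx1 : l <= J x 1.
  have := @J_split 0 1 x; rewrite lexx x0 x1 lexx => /(_ isT isT isT isT).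
  rewrite Jx -cell_mass_n => E.
  have : (i%:R + 1) * l <= n%:R * l by apply: ler_wpM2r; [exact: ltW | rewrite natr1 ler_nat].
  lra.
have [z zx Jz] : exists2 z, x <= z <= 1 & J x z = l.
  have dgt := delta_gt0; have dle := delta_le.
  have cJ : {within `[x, 1], continuous (J x)}.
    apply/within_itv_epsP => t xt1 e e0; exists (e / rhomax).
      by rewrite divr_gt0//; lra.
    have main u w : x <= u -> u <= w -> w <= 1 -> `|w - u| < e / rhomax -> `|J x w - J x u| < e.
      move=> xu uw w1; rewrite (@J_split x w u)// addrAC subrr add0r.
      have := @J_bounds u w (le_trans x0 xu) uw w1 => /andP[h1 h2].
      rewrite ltr_pdivlMr ?(ger0_norm (_ : 0 <= w - u)) ?subr_ge0//; last lra.
      have : 0 <= delta * (w - u) by rewrite mulr_ge0 ?subr_ge0// ltW.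
      by move=> h3 h4; rewrite ger0_norm; lra.
    move=> u xu1; case: (leP t u) => tu ut; first by apply: main; lra.
    rewrite distrC; apply: main; try lra; by rewrite distrC.
  have [|z zx Jz] := @IVT R (J x) x 1 l x1 cJ.
    rewrite J_ge// ge_min le_max; apply/andP; split; apply/orP; [left|right]; lra.
  by exists z => //; move: zx; rewrite in_itv.
have dgt := delta_gt0.
have xz : x < z.
  by rewrite ltNge; apply/negP => zlex; move: Jz; rewrite J_ge//; lra.
set S := [set y : R | 0 < y < 1 /\ \int[mu]_(y in `]x, y[) rhobar y < cell_mass rhobar n].
have SE y : S y <-> 0 < y < z.
  rewrite /S /=; split.
    move=> [/andP[y0 y1]]; rewrite JE// ?(ltW y1)// => Jy.
    rewrite y0 ltNge; apply/negP => zy.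
    have := @J_split x y z x0 (ltW xz) zy (ltW y1).
    have := @J_bounds z y ltac:(lra) zy (ltW y1).
    have : 0 <= delta * (y - z) by rewrite mulr_ge0 ?subr_ge0// ltW.
    by rewrite -/l in Jy; lra.
  move=> /andP[y0 yz]; have y1 : y < 1 by lra.
  split; first by rewrite y0.
  rewrite JE ?(ltW y1)// -/l; case: (leP y x) => yx; first by rewrite J_ge.
  have := @J_split x z y x0 (ltW yx) (ltW yz) ltac:(lra).
  have := @J_bounds y z ltac:(lra) (ltW yz) ltac:(lra).
  have : 0 < delta * (z - y) by rewrite mulr_gt0 ?subr_gt0.
  lra.
have supS : sup S = z.
  have hub : has_ubound S by exists z => y /SE; lra.
  have ne : S !=set0 by exists (z / 2); apply/SE; lra.
  apply/eqP; rewrite eq_le; apply/andP; split.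
    by apply: ge_sup => // y /SE; lra.
  rewrite leNgt; apply/negP => sz.
  have s0 : 0 < sup S.
    by apply: (@lt_le_trans _ _ (z / 2)); [lra | apply: ub_le_sup => //; apply/SE; lra].
  have : (sup S + z) / 2 <= sup S by apply: ub_le_sup => //; apply/SE; lra.
  lra.
have -> : init_inner rhobar n i.+1 = z by rewrite -supS.
split; first lra.
split; last by move=> _; exact: ltW.
rewrite (@J_split 0 z x) ?lexx//; try lra.
Qed.

Lemma init_inner_last : init_inner rhobar n n = 1.
Proof.
have [/andP[x0 x1] [Jx _]] := init_inner_spec (leqnn n).
have := @J_split 0 1 _ (lexx 0) x0 x1 (lexx 1).
have /andP[h _] := @J_bounds _ 1 x0 x1 (lexx 1).
rewrite Jx -cell_mass_n => E.
have : delta * (1 - init_inner rhobar n n) <= 0 by lra.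
rewrite pmulr_rle0//; lra.
Qed.

Lemma init_inner_cell i : (i < n)%N ->
  [/\ 0 <= init_inner rhobar n i, init_inner rhobar n i.+1 <= 1,
      init_inner rhobar n i <= init_inner rhobar n i.+1,
      J (init_inner rhobar n i) (init_inner rhobar n i.+1) = l &
      l / rhomax <= init_inner rhobar n i.+1 - init_inner rhobar n i <= l / delta].
Proof.
move=> iN.
have [/andP[x0 x1] [Jx _]] := init_inner_spec (ltnW iN).
have [/andP[y0 y1] [Jy /(_ isT) xy]] := init_inner_spec iN.
rewrite [i.+1.-1]/= in xy.
set x := init_inner rhobar n i in x0 x1 Jx xy *.
set y := init_inner rhobar n i.+1 in y0 y1 Jy xy *.
have Jxy : J x y = l.
  have := @J_split 0 y x (lexx 0) x0 xy y1; rewrite Jx Jy -natr1; lra.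
have /andP[h1 h2] := @J_bounds x y x0 xy y1.
have dgt := delta_gt0; have dle := delta_le.
have rm0 : 0 < rhomax by lra.
rewrite Jxy in h1 h2.
by split => //; rewrite (ler_pdivrMr _ _ rm0) (ler_pdivlMr _ _ dgt) ![(y - x) * _]mulrC h1 h2.
Qed.

Hypothesis rhobar_BV : BV_class 0 1 rhobar.

(** The increments of the averages of [rhobar] are dominated by those of the
    averages of its variation function, which telescope. *)
Lemma init_tv : exists V1, 0 <= V1 /\ forall (k : nat) (x : nat -> R),
  (forall i, (i <= k)%N -> 0 <= x i <= 1) -> (forall i, (i < k)%N -> x i < x i.+1) ->
  \sum_(i < k.-1) `|J (x i.+1) (x i.+2) / (x i.+2 - x i.+1)
                    - J (x i) (x i.+1) / (x i.+1 - x i)| <= V1.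
Proof.
have [g [BVg fg]] := rhobar_BV.
pose V y := fine (total_variation 0 (Num.max 0 (Num.min y 1)) g).
have fin y : 0 <= y <= 1 -> total_variation 0 y g \is a fin_num.
  move=> /andP[y0 y1]; apply/bounded_variationP => //.
  have /(bounded_variationP _ ler01) := BVg.
  rewrite (total_variationD g y0 y1) => h; apply/bounded_variationP => //.
  by move: h; rewrite fin_numD => /andP[].
have VE y : 0 <= y <= 1 -> V y = fine (total_variation 0 y g).
  by move=> /andP[y0 y1]; rewrite /V (min_idPl y1) (max_idPr y0).
have Vg y y' : 0 <= y -> y <= y' -> y' <= 1 -> `|g y' - g y| <= V y' - V y.
  move=> y0 yy' y1; rewrite !VE; try lra.
  have f1 := fin y ltac:(lra); have f2 := fin y' ltac:(lra).
  rewrite -lee_fin EFinB !fineK// (total_variationD g y0 yy').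
  rewrite (total_variationD g y0 yy') in f2.
  have f3 : total_variation y y' g \is a fin_num by move: f2; rewrite fin_numD => /andP[].
  rewrite addeAC subee// add0e; exact: total_variation_ge.
have Vhomo : {homo V : y y' / y <= y'}.
  move=> y y' yy'; rewrite /V.
  set c := Num.max _ _; set c' := Num.max _ _.
  have c0 : 0 <= c by rewrite /c le_max lexx.
  have c1 : c' <= 1 by rewrite /c' ge_max ler01 ge_min lexx orbT.
  have cc' : c <= c' by rewrite /c /c' le_max2// le_min2.
  rewrite -!VE; try lra.
  by rewrite -subr_ge0; apply: le_trans (Vg c c' c0 cc' c1).
have V0 : V 0 = 0 by rewrite VE ?lexx ?ler01// total_variationxx.
have mV (D : set R) : measurable D -> measurable_fun D V.
  by move=> mD; exact: nondecreasing_measurable.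
have Vrange y : 0 <= y <= 1 -> 0 <= V y <= V 1.
  by move=> /andP[y0 y1]; rewrite -{1}V0 !Vhomo.
exists (V 1); split; first by rewrite -V0 Vhomo.
move=> k x x01 xinc.
have Vint a b : 0 <= a -> b <= 1 -> mu.-integrable `]a, b[ (EFin \o V).
  move=> a0 b1; apply: (@itv_oo_integrable _ _ (V 1)); first exact: mV.
  by move=> y yab; have := Vrange y ltac:(lra); rewrite ler_norml; lra.
have Jint a b : 0 <= a -> b <= 1 -> mu.-integrable `]a, b[ (EFin \o clamp).
  move=> a0 b1; apply: (@itv_oo_integrable _ _ rhomax); first exact: clamp_meas_sub.
  by move=> y _; exact: clamp_norm.
pose IV a b := \int[mu]_(y in `]a, b[) V y.
have gclamp : {ae mu, forall y, 0 < y < 1 -> clamp y = g y}.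
  have FF : Filter (almost_everywhere mu) by exact: ae_filter_ringOfSetsType.
  by apply: filterS2 fg clamp_ae => y h1 h2 h; rewrite -h1// h2.
have avg (s : R) a b (c C : R) : `|s| <= 1 -> 0 <= a -> a < b -> b <= 1 ->
    (forall y, a < y < b -> c <= V y + s * g y <= C) ->
    c <= IV a b / (b - a) + s * (J a b / (b - a)) <= C.
  move=> s1 a0 ab b1 H.
  have E : IV a b / (b - a) + s * (J a b / (b - a)) =
      (\int[mu]_(y in `]a, b[) (V y + s * clamp y)) / (b - a).
    have isJ : mu.-integrable `]a, b[ (EFin \o (fun y => s * clamp y)).
      apply: (@itv_oo_integrable _ _ (`|s| * rhomax)).
        by apply: measurable_funM => //; exact: clamp_meas_sub.
      by move=> y _; rewrite normrM ler_wpM2l// clamp_norm.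
    rewrite RintegralD//; last exact: Vint.
    by rewrite RintegralZl//; [rewrite mulrDl mulrA | exact: Jint].
  have ba : 0 < b - a by rewrite subr_gt0.
  rewrite E ler_pdivlMr// ler_pdivrMr//; apply: Rintegral_oo_bounds; first exact: ltW.
  - apply: measurable_funD; first exact: mV.
    by apply: measurable_funM => //; exact: clamp_meas_sub.
  - have FF : Filter (almost_everywhere mu) by exact: ae_filter_ringOfSetsType.
    by apply: filterS gclamp => y h yab; rewrite h; [exact: H | lra].
  - apply: (@itv_oo_integrable _ _ (V 1 + `|s| * rhomax)).
      apply: measurable_funD; first exact: mV.
      by apply: measurable_funM => //; exact: clamp_meas_sub.
    move=> y yab; apply: (le_trans (ler_normD _ _)); apply: lerD.
      by have := Vrange y ltac:(lra); rewrite ler_norml; lra.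
    by rewrite normrM ler_wpM2l// clamp_norm.
pose A i := IV (x i) (x i.+1) / (x i.+1 - x i).
have step (i : 'I_k.-1) : `|J (x i.+1) (x i.+2) / (x i.+2 - x i.+1)
                    - J (x i) (x i.+1) / (x i.+1 - x i)| <= A i.+1 - A i.
  have ik : (i.+2 <= k)%N by move: (nat_of_ord i) (ltn_ord i) => i' ik; case: (k) ik.
  have [h0 [h1 h2]] := (x01 i (ltnW (ltnW ik)), (x01 i.+1 (ltnW ik), x01 i.+2 ik)).
  have lt1 := xinc i (ltnW ik); have lt2 := xinc i.+1 ik.
  have sgn (s : R) : `|s| = 1 ->
      A i + s * (J (x i) (x i.+1) / (x i.+1 - x i)) <=
      A i.+1 + s * (J (x i.+1) (x i.+2) / (x i.+2 - x i.+1)).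
    move=> s1.
    have mono y y' : 0 <= y -> y <= y' -> y' <= 1 -> V y + s * g y <= V y' + s * g y'.
      move=> y0 yy' y1; have := Vg y y' y0 yy' y1.
      have : `|s * (g y' - g y)| = `|g y' - g y| by rewrite normrM s1 mul1r.
      move=> <-; rewrite ler_norml => /andP[+ _]; rewrite mulrBr; lra.
    pose C := V (x i.+1) + s * g (x i.+1).
    have /andP[_ b1] := @avg s (x i) (x i.+1) (V 0 + s * g 0) C ltac:(by rewrite s1)
      ltac:(lra) ltac:(lra) ltac:(lra)
      ltac:(by move=> y yab; apply/andP; split; apply: mono; lra).
    have /andP[b2 _] := @avg s (x i.+1) (x i.+2) C (V 1 + s * g 1) ltac:(by rewrite s1)
      ltac:(lra) ltac:(lra) ltac:(lra)
      ltac:(by move=> y yab; apply/andP; split; apply: mono; lra).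
    exact: le_trans b1 b2.
  have := sgn 1 ltac:(by rewrite normr1); have := sgn (-1) ltac:(by rewrite normrN1).
  by rewrite ler_norml; lra.
apply: (le_trans (ler_sum _ (fun i _ => step i))).
case: k x01 xinc step => [|k] x01 xinc _ /=; first by rewrite big_ord0 -V0 Vhomo.
rewrite -(big_mkord xpredT (fun i => A i.+1 - A i)) telescope_sumr//.
have A01 i : (i <= k)%N -> 0 <= A i <= V 1.
  move=> ik; have h0 := x01 i (leqW ik); have h1 := x01 i.+1 ik.
  have := @avg 0 (x i) (x i.+1) 0 (V 1); rewrite normr0 !mul0r addr0; apply; try lra.
    exact: xinc.
  by move=> y yab; rewrite mul0r addr0; apply: Vrange; lra.
by have := A01 k (leqnn k); have := A01 0%N (leq0n k); lra.
Qed.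

End InitialDatum.

Section C1.
Context {R : realType}.

Lemma C1_on_lipschitz (a b : R) (f df : R -> R) : a <= b -> C1_on a b f df ->
  exists K, forall x y, a <= x <= b -> a <= y <= b -> `|f x - f y| <= K * `|x - y|.
Proof.
move=> ab [cf cdf hf].
have [c _ Hc] := EVT_max ab cdf; have [d _ Hd] := EVT_min ab cdf.
pose K := Num.max (df c) (- df d).
have HK u : a <= u <= b -> `|df u| <= K.
  move=> uab; rewrite ler_norml /K; apply/andP; split.
    rewrite lerNl le_max lerN2 Hd ?orbT// in_itv//.
  by rewrite le_max Hc// in_itv.
exists K.
have main x y : a <= x -> x <= y -> y <= b -> `|f y - f x| <= K * `|y - x|.
  move=> ax xy yb.
  have [||u uxy ->] := @MVT_segment R f df x y xy.
  - by move=> u; rewrite in_itv/= => uxy; apply: hf; lra.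
  - exact: within_itvS cf.
  rewrite normrM ler_wpM2r// HK//; move: uxy; rewrite in_itv/=; lra.
move=> x y /andP[ax xb] /andP[ay yb]; case: (leP x y) => xy.
  by rewrite distrC [`|x - y|]distrC; exact: main.
exact: main (ltW xy) _.
Qed.

Lemma C1_on_nonincreasing (a b : R) (f df : R -> R) : C1_on a b f df ->
  (forall r, a <= r <= b -> df r < 0) ->
  forall x y, a <= x -> x <= y -> y <= b -> f y <= f x.
Proof.
move=> [cf cdf hf] df0 x y ax xy yb; rewrite -subr_le0.
have [||u uxy ->] := @MVT_segment R f df x y xy.
- by move=> u; rewrite in_itv/= => uxy; apply: hf; lra.
- exact: within_itvS cf.
rewrite nmulr_rle0 ?subr_ge0// df0//; move: uxy; rewrite in_itv/=; lra.
Qed.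

Lemma halfline_lipschitz (f : R -> R) : (exists K, K.-lipschitz_(`[0, +oo[) f) ->
  exists L, forall s t, 0 <= s -> s <= t -> `|f t - f s| <= L * (t - s).
Proof.
move=> [L HL]; exists L => s t s0 st.
rewrite -[X in _ <= _ * X]ger0_norm ?subr_ge0//; apply: (HL (t, s)).
by split; rewrite /= in_itv/= andbT// (le_trans s0 st).
Qed.

End C1.


Lemma tv_reparam (R : realType) (a : nat -> R) (s c P : nat) :
  let u j := a (minn (j - s) c) in
  \sum_(j < P) `|u j.+1 - u j| = \sum_(i < minn (P - s) c) `|a i.+1 - a i|.
Proof.
move=> u; elim: P => [|P IH]; first by rewrite sub0n min0n !big_ord0.
rewrite big_ord_recr /= {}IH /u; case: (leqP s P) => sP; last first.
  have -> : (P - s = 0)%N by nlia.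
  have -> : (P.+1 - s = 0)%N by nlia.
  by rewrite !min0n subrr normr0 addr0.
rewrite subSn//; move: (P - s)%N => i; case: (ltnP i c) => ic.
  by rewrite !(minn_idPl _) ?(ltnW ic)// big_ord_recr.
by rewrite !(minn_idPr _) ?(leqW ic)// subrr normr0 addr0.
Qed.

Section SchemeFlow.
Context {R : realType}.
Variables (T rhomax vmax delta K L0 L1 : R).
Variables (v rhobar rho0 rho1 : R -> R).
Hypothesis T_gt0 : 0 < T.
Hypothesis delta_gt0 : 0 < delta.
Hypothesis delta_le : delta <= rhomax.
Hypothesis vmax_gt0 : 0 < vmax.
Hypothesis v_lip : forall a b, 0 <= a <= rhomax -> 0 <= b <= rhomax ->
  `|v a - v b| <= K * `|a - b|.
Hypothesis v_dec : forall a b, 0 <= a -> a <= b -> b <= rhomax -> v b <= v a.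
Hypothesis v_0 : v 0 = vmax.
Hypothesis v_rhomax : v rhomax = 0.
Hypothesis rho0_range : forall t, 0 <= t -> delta <= rho0 t <= rhomax.
Hypothesis rho1_range : forall t, 0 <= t -> delta <= rho1 t <= rhomax.
Hypothesis rho0_lip : forall s t, 0 <= s -> s <= t -> `|rho0 t - rho0 s| <= L0 * (t - s).
Hypothesis rho1_lip : forall s t, 0 <= s -> s <= t -> `|rho1 t - rho1 s| <= L1 * (t - s).
Hypothesis rhobar_meas : measurable_fun (`]0, 1[%classic : set R) rhobar.
Hypothesis rhobar_range : {ae @lebesgue_measure R,
  forall x, 0 < x < 1 -> delta <= rhobar x <= rhomax}.
Variable V1 : R.
Hypothesis V1_tv : forall (k : nat) (x : nat -> R),
  (forall i, (i <= k)%N -> 0 <= x i <= 1) -> (forall i, (i < k)%N -> x i < x i.+1) ->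
  \sum_(i < k.-1) `|J delta rhomax rhobar (x i.+1) (x i.+2) / (x i.+2 - x i.+1)
                    - J delta rhomax rhobar (x i) (x i.+1) / (x i.+1 - x i)| <= V1.

Variable n : nat.
Hypothesis n_gt0 : (0 < n)%N.
Let l := cell_mass rhobar n.
Let N := queue_size T rhomax vmax rhobar n.
Let q := last_mass T rhomax vmax rhobar n.
Let Q := queue_mass T rhomax vmax.

Let rhomax_gt0 : 0 < rhomax. Proof. exact: lt_le_trans delta_le. Qed.
Let l_gt0 : 0 < l.
Proof. exact: (cell_mass_gt0 delta_gt0 delta_le rhobar_meas rhobar_range n_gt0). Qed.
Let Q_gt0 : 0 < Q.
Proof. by rewrite /Q /queue_mass !mulr_gt0. Qed.

Lemma queue_sizeP : (0 < N)%N /\ l * (N%:R - 1) < Q <= l * N%:R.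
Proof.
have Ql : 0 < Q / l by rewrite divr_gt0.
have NE : N%:R = (Num.ceil (Q / l))%:~R :> R.
  rewrite /N /queue_size -/l -/Q -[LHS]/((Posz _)%:~R) gez0_abs//.
  by rewrite -(ler_int R) (le_trans (ltW Ql))// ceil_ge.
have /andP[h2 h1] := ceil_itv (Q / l).
rewrite -NE in h1; rewrite intrB -NE in h2.
split; first by rewrite -(ltr_nat R); lra.
by rewrite mulrC [l * N%:R]mulrC -ltr_pdivlMr// -ler_pdivrMr// h1 h2.
Qed.

Hypothesis n_large : l < T * vmax * rhomax.

Lemma queue_long : vmax * T < N.-1%:R * (l / rhomax).
Proof.
have [N0 /andP[_ h]] := queue_sizeP.
have -> : N.-1%:R = N%:R - 1 :> R by rewrite -subn1 natrB.
rewrite mulrA ltr_pdivlMr//.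
have := n_large; move: h; rewrite /Q /queue_mass; lra.
Qed.

Lemma last_mass_range : 0 < q <= l.
Proof.
have [N0 /andP[h1 h2]] := queue_sizeP.
by rewrite /q /last_mass -/Q -/N -/l; apply/andP; split; lra.
Qed.

Definition masses (p : nat) := if p == 0%N then q else l.
Definition particles (x : nat -> int -> R -> R) k (p : nat) t := x k (p%:Z - N%:Z) t.

Lemma init_posE (p : nat) : init_pos T rhomax vmax rhobar rho0 n (p%:Z - N%:Z) =
  if p == 0%N then - N.-1%:R * (l / rho0 0) - q / rho0 0
  else if (p < N)%N then - (N - p)%:R * (l / rho0 0) else init_inner rhobar n (p - N).
Proof.
have [N0 _] := queue_sizeP.
have FE (j : nat) : (if 0 <= j%:Z - N%:Z then init_inner rhobar n `|j%:Z - N%:Z|%N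
     else (j%:Z - N%:Z)%:~R * (l / rho0 0)) =
   if (j < N)%N then - (N - j)%:R * (l / rho0 0) else init_inner rhobar n (j - N).
  rewrite subr_ge0 lez_nat; case: leqP => jN; first by rewrite distnEl.
  by rewrite -[j%:Z - N%:Z]opprB (subzn (ltnW jN)) mulrNz -pmulrn.
rewrite /init_pos /place_last -/N -/l -/q.
have -> : (p%:Z - N%:Z == - N%:Z) = (p == 0%N) by apply/eqP/eqP; nlia.
case: eqP => p0; last exact: FE.
congr (_ - _); transitivity (if 0 <= 1%N%:Z - N%:Z then init_inner rhobar n `|1%N%:Z - N%:Z|%N
     else (1%N%:Z - N%:Z)%:~R * (l / rho0 0)); first by [].
rewrite FE; case: (ltnP 1 N) => N1; first by rewrite subn1.
have -> : N = 1%N by nlia.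
by rewrite /= oppr0 mul0r.
Qed.

Variables (m : nat) (x : nat -> int -> R -> R).
Hypothesis m_gt0 : (0 < m)%N.
Hypothesis x_scheme : ftl_scheme T rhomax vmax v rhobar rho0 rho1 n m x.
Let M := (n + N)%N.
Let z := particles x.

Lemma particles_start (p : nat) : (p <= M)%N -> z 0%N p 0 =
  if p == 0%N then - N.-1%:R * (l / rho0 0) - q / rho0 0
  else if (p < N)%N then - (N - p)%:R * (l / rho0 0) else init_inner rhobar n (p - N).
Proof.
move=> pM; have pN : - N%:Z <= p%:Z - N%:Z <= n%:Z.
  by rewrite -/M in pM *; move: pM; rewrite /M => pM; apply/andP; split; nlia.
have [+ _ _] := x_scheme m_gt0 pN.
by rewrite /tgrid mul0r /start_pos init_posE.
Qed.

Lemma invariant_start :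
  scheme_invariant T rhomax vmax delta L0 L1 (2 * rhomax + V1) l q rho0 rho1 m N x M 0 0.
Proof.
have [N0 _] := queue_sizeP.
have lst := last_mass_range.
have N1 : (1 < N)%N.
  rewrite ltnNge; apply/negP => N1; have := queue_long.
  have -> : N.-1 = 0%N by nlia.
  by rewrite mul0r ltNge mulr_ge0// ltW.
have zE := particles_start.
pose z0 := z 0%N.
have ME : M = (n + N)%N by [].
have r0 := rho0_range (lexx 0); have r1 := rho1_range (lexx 0).
have dgt := delta_gt0; have dle := delta_le; have lgt := l_gt0; have rgt := rhomax_gt0.
have r00 : 0 < rho0 0 by lra.
have gapE p : (p < M)%N -> gap z0 p 0 =
   if (p < N)%N then masses p / rho0 0
   else init_inner rhobar n (p - N).+1 - init_inner rhobar n (p - N).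
  move=> pM; rewrite /gap /z0 !zE//; last exact: ltnW.
  rewrite [p.+1 == 0%N]/=.
  case: (ltnP p N) => pN; last first.
    rewrite (_ : (p.+1 < N)%N = false) ?(gtn_eqF (leq_trans N0 pN)) ?subSn//.
    by apply/negbTE; rewrite -leqNgt leqW.
  have -> : (if (p.+1 < N)%N then - (N - p.+1)%:R * (l / rho0 0)
       else init_inner rhobar n (p.+1 - N)) = - (N - p.+1)%:R * (l / rho0 0).
    case: ltnP => // h; have -> : p.+1 = N by nlia.
    by rewrite subnn /= oppr0 mul0r.
  rewrite /masses; case: eqP => [->|/eqP p0]; first by rewrite subn1; ring.
  by rewrite -[in X in _ - - X%:R * _](subnSK pN) -natr1; ring.
pose y i := init_inner rhobar n i.
pose a i := J delta rhomax rhobar (y i) (y i.+1) / (y i.+1 - y i).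
have cell i (iN : (i < n)%N) :=
  init_inner_cell delta_gt0 delta_le rhobar_meas rhobar_range n_gt0 iN.
have lr : 0 < l / rhomax by rewrite divr_gt0.
have aE i : (i < n)%N -> a i = l / (y i.+1 - y i) /\ delta <= a i <= rhomax.
  move=> iN; have [_ _ _ Ji /andP[g1 g2]] := cell i iN.
  have g0 : 0 < y i.+1 - y i := lt_le_trans lr g1.
  rewrite /a Ji -/l; split => //.
  rewrite ler_pdivlMr// ler_pdivrMr// mulrC [rhomax * _]mulrC.
  by rewrite -(ler_pdivlMr _ _ dgt) -(ler_pdivrMr _ _ rgt) g1 g2.
have densE p : (p < M)%N -> dens masses z0 p 0 =
   if (p < N)%N then rho0 0 else a (p - N)%N.
  move=> pM; rewrite /dens gapE//; case: ltnP => pN.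
    have w0 : 0 < masses p by rewrite /masses; case: ifP => _; lra.
    by field; rewrite !gt_eqF.
  rewrite /masses gtn_eqF; last exact: leq_trans N0 pN.
  by have [-> _] := aE (p - N)%N ltac:(nlia).
split.
- move=> p pM; rewrite -/z0 gapE//; have w0 : 0 < masses p.
    by rewrite /masses; case: ifP => _; lra.
  case: ltnP => pN.
    by rewrite !ler_pM2l// !lef_pV2 ?posrE// andbC.
  rewrite gtn_eqF; last exact: leq_trans N0 pN.
  by have [_ _ _ _] := cell (p - N)%N ltac:(nlia).
- have -> : tgrid T m 0 = 0 by rewrite /tgrid mul0r.
  rewrite -/z0 mulr0 addr0.
  pose u j := a (minn (j - N.+1) n.-1).
  pose U j := if (j <= N)%N then rho0 0 else u j.
  pose U' j := if (j <= M)%N then U j else rho1 0.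
  have uE j : (j <= M.+1)%N -> fdens M masses z0 (rho0 0) (rho1 0) j 0 = U' j.
    rewrite /U' /U /u; case: j => [|p pM]; first by rewrite /= !leq0n.
    rewrite /=; case: (ltnP p M) => pM' //.
    rewrite densE//; case: (ltnP p N) => // pN.
    by congr a; rewrite subSS; nlia.
  rewrite (eq_bigr (fun j : 'I_M.+1 => `|U' j.+1 - U' j|)); last first.
    by move=> j _; rewrite (uE _ (ltn_ord j)) (uE _ (ltnW (ltn_ord j))).
  have u_range j : delta <= u j <= rhomax.
    by have [] := aE (minn (j - N.+1) n.-1) ltac:(nlia).
  apply: (le_trans (@tv_splice_right R M.+1 M U U' (rho1 0) (ltnSn M) (fun=> erefl))).
  apply: (le_trans (lerD (lexx _) (@tv_splice_left R M.+1 N u U (rho0 0) (fun=> erefl)))).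
  have h1 : `|rho1 0 - U M.+1| <= rhomax.
    rewrite /U (_ : (M < N)%N = false); last by nlia.
    by have := u_range M.+1; rewrite ler_norml; lra.
  have h0 : `|rho0 0 - u 0%N| <= rhomax by have := u_range 0%N; rewrite ler_norml; lra.
  have h2 : \sum_(j < M.+1) `|u j.+1 - u j| <= V1.
    rewrite (tv_reparam a N.+1 n.-1 M.+1).
    have -> : minn (M.+1 - N.+1) n.-1 = n.-1 by nlia.
    apply: V1_tv => i iN.
      by have [] := init_inner_spec delta_gt0 delta_le rhobar_meas rhobar_range n_gt0 iN.
    by have [_ _ _ _ /andP[h _]] := cell i iN; rewrite -subr_gt0 (lt_le_trans lr h).
  lra.
- move=> p /andP[p0 pN]; right; have := zE p ltac:(nlia); rewrite /z /particles => ->.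
  rewrite gtn_eqF// mulr0 sub0r; case: ltnP => pN'.
    rewrite mulNr lerN2 ler_wpM2l// ler_pM2l// lef_pV2 ?posrE//; lra.
  have -> : p = N by nlia.
  by rewrite subnn mul0r oppr0.
- have := zE 1%N ltac:(nlia); rewrite /z /particles => ->.
  rewrite /= N1 mulr0 sub0r mulNr lerN2 subn1 ler_wpM2l// ler_pM2l// lef_pV2 ?posrE//; lra.
- have := zE M (leqnn M); rewrite /z /particles => ->.
  have MN : (M < N)%N = false by nlia.
  have M0 : (0 < M)%N by nlia.
  rewrite MN gtn_eqF//.
  have -> : (M - N)%N = n by nlia.
  by rewrite (init_inner_last delta_gt0 delta_le rhobar_meas rhobar_range n_gt0).
Qed.

Lemma masses_total : M%:R * l <= mass rhobar + Q + l.
Proof.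
have [_ /andP[h _]] := queue_sizeP.
have E := cell_mass_n delta_gt0 delta_le rhobar_meas rhobar_range n_gt0.
rewrite -/l -(massE delta_gt0 delta_le rhobar_meas rhobar_range) in E.
by rewrite /M natrD; lra.
Qed.

Lemma scheme_is_flow : flow T m M delta rhomax vmax l
  (2 * rhomax + V1 + (L0 + L1) * T) v masses z.
Proof.
apply: (@scheme_flow R T rhomax vmax delta K L0 L1 (2 * rhomax + V1) l q v rho0 rho1
  n m N x M erefl T_gt0 m_gt0 n_gt0 delta_gt0 delta_le vmax_gt0 v_lip v_dec v_0 v_rhomax
  rho0_range rho1_range rho0_lip rho1_lip last_mass_range queue_long).
- move=> k p km pM; have pN : - N%:Z <= p%:Z - N%:Z <= n%:Z.
    by move: pM; rewrite /M => pM; apply/andP; split; nlia.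
  by have [] := x_scheme km pN.
- move=> k p t km pM kt; have pN : - N%:Z <= p%:Z - N%:Z <= n%:Z.
    by move: pM; rewrite /M => pM; apply/andP; split; nlia.
  have [_ _ /(_ t kt)] := x_scheme km pN.
  congr (is_derive _ _ _ _); rewrite /ftl_velocity /vel.
  have -> : (p%:Z - N%:Z == n%:Z) = (p == M).
    by rewrite /M; apply/eqP/eqP; nlia.
  case: eqP => // _; rewrite /cell_density /dens /gap -/N -/l -/q.
  have -> : (p%:Z - N%:Z == - N%:Z) = (p == 0%N) by apply/eqP/eqP; nlia.
  by have -> : p%:Z - N%:Z + 1 = p.+1%:Z - N%:Z by nlia.
- move=> k p km pM; have pN : - N%:Z <= p%:Z - N%:Z <= n%:Z.
    by move: pM; rewrite /M => pM; apply/andP; split; nlia.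
  by have [-> _ _] := x_scheme km pN.
- exact: invariant_start.
Qed.


End SchemeFlow.

(** * Bounds on the discrete density *)

Section StepFunctions.
Context {R : realType}.
Notation mu := (@lebesgue_measure R).
Implicit Types (z r : nat -> R) (y : R) (f g h : R -> R).

Lemma indic_co (a b y : R) : \1_(`[a, b[%classic) y = ((a <= y) && (y < b))%:R :> R.
Proof.
rewrite indicE (_ : (y \in _) = ((a <= y) && (y < b)))//.
by apply/idP/idP => [/set_mem|h]; [|apply: mem_set]; rewrite /= in_itv.
Qed.

Definition step_fun (M : nat) z r y := \sum_(p < M) r p * \1_(`[z p, z p.+1[%classic) y.

Lemma step_fun_measurable M z r (D : set R) : measurable_fun D (step_fun M z r).
Proof.
by apply: measurable_sum => p; apply: measurable_funM.
Qed.

Lemma cell_exists (M : nat) z y : z 0%N <= y -> y < z M ->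
  exists2 p, (p < M)%N & z p <= y < z p.+1.
Proof.
elim: M => [|M IH] y0 yM; first by move: y0; rewrite leNgt yM.
case: (ltP y (z M)) => yM'; last by exists M => //; rewrite yM' yM.
by have [p pM h] := IH y0 yM'; exists p => //; rewrite ltnS ltnW.
Qed.

Lemma step_fun_cell (M : nat) z r y p : (forall q, (q < M)%N -> z q <= z q.+1) ->
  (p < M)%N -> z p <= y < z p.+1 -> step_fun M z r y = r p.
Proof.
move=> zinc pM /andP[h1 h2].
have zle i j : (i <= j)%N -> (j <= M)%N -> z i <= z j.
  elim: j => [|j IH]; first by rewrite leqn0 => /eqP ->.
  rewrite leq_eqVlt => /orP[/eqP->//|]; rewrite ltnS => ij jM.
  by apply: (le_trans (IH ij (ltnW jM))); exact: zinc.
rewrite /step_fun (bigD1 (Ordinal pM))//= big1 ?addr0.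
  by rewrite indic_co h1 h2 mulr1.
move=> q; rewrite -val_eqE/= indic_co => qp.
have [qp'|pq|/eqP] := ltngtP q p; last by rewrite (negbTE qp).
  have : z q.+1 <= y by apply: le_trans h1; apply: zle => //; exact: ltnW.
  by rewrite leNgt => /negbTE ->; rewrite andbF mulr0.
have : y < z q by apply: (lt_le_trans h2); apply: zle => //; exact: ltnW.
by rewrite ltNge => /negbTE ->; rewrite mulr0.
Qed.

Lemma step_fun_abel (M : nat) z r y : (0 < M)%N ->
  (forall p, (p < M)%N -> z p <= z p.+1) -> z 0%N <= y -> y < z M ->
  step_fun M z r y = r 0%N + \sum_(p < M.-1) (r p.+1 - r p) * (z p.+1 <= y)%R%:R.
Proof.
case: M => // M _ zinc y0 yM; rewrite /=.
suff main P : (P <= M)%N -> step_fun P.+1 z r y =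
    r 0%N + \sum_(p < P) (r p.+1 - r p) * (z p.+1 <= y)%R%:R - r P * (z P.+1 <= y)%R%:R.
  by rewrite main// leNgt yM mulr0 subr0.
have cellE p : (p <= M)%N -> \1_(`[z p, z p.+1[%classic) y =
    (z p <= y)%R%:R - (z p.+1 <= y)%R%:R :> R.
  move=> pM; rewrite indic_co ltNge; have zp := zinc p pM.
  case: (leP (z p.+1) y) => h; last by rewrite andbT subr0.
  by rewrite (le_trans zp h) subrr.
elim: P => [_|P IH PM].
  by rewrite /step_fun big_ord_recr !big_ord0 /= cellE// y0 /=; ring.
rewrite /step_fun big_ord_recr/= -/(step_fun P.+1 z r y) IH ?(ltnW PM)//.
by rewrite cellE// big_ord_recr/=; ring.
Qed.

Lemma integral_step_le (D : set R) (P : nat) (c a b : nat -> R) : measurable D ->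
  (forall p, (p < P)%N -> 0 <= c p) -> (forall p, (p < P)%N -> a p <= b p) ->
  (\int[mu]_(y in D) (\sum_(p < P) c p * \1_(`[a p, b p[%classic) y)%:E
   <= (\sum_(p < P) c p * (b p - a p))%:E)%E.
Proof.
move=> mD; elim: P => [|P IH] c0 ab.
  under eq_integral => y _ do rewrite big_ord0.
  by rewrite integral0 big_ord0.
under eq_integral => y _ do rewrite big_ord_recr/= EFinD.
have cP := c0 P (ltnSn P); have abP := ab P (ltnSn P).
have mi p : measurable_fun D (fun y => (c p * \1_(`[a p, b p[%classic) y)%:E).
  apply/measurable_EFinP; exact: measurable_funM.
have mS : measurable_fun D (fun y => (\sum_(p < P) c p * \1_(`[a p, b p[%classic) y)%:E).
  apply/measurable_EFinP; apply: measurable_sum => p.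
  by apply/measurable_EFinP; exact: mi.
have S0 y : D y -> (0 <= (\sum_(p < P) c p * \1_(`[a p, b p[%classic) y)%:E)%E.
  move=> _; rewrite lee_fin sumr_ge0// => p _; rewrite mulr_ge0// c0//.
  by rewrite ltnS ltnW.
have cP0 y : D y -> (0 <= (c P * \1_(`[a P, b P[%classic) y)%:E)%E.
  by move=> _; rewrite lee_fin mulr_ge0.
have E := ge0_integralD mu mD S0 mS cP0 (mi P).
rewrite /= in E; rewrite {}E.
rewrite big_ord_recr/= EFinD; apply: leeD.
  by apply: IH => p pP; [apply: c0 | apply: ab]; rewrite ltnS ltnW.
under eq_integral => y _ do rewrite EFinM.
rewrite ge0_integralZl//; last by apply/measurable_EFinP; exact: measurable_indic.
rewrite EFinM; apply: lee_wpmul2l; first by rewrite lee_fin.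
rewrite integral_indic//.
apply: (@le_trans _ _ (mu `[a P, b P[%classic)).
  apply: le_measure; rewrite ?inE; [apply: measurableI => //| |];
    by [exact: measurable_itv | exact: subIsetl].
rewrite lebesgue_measure_itv/= lte_fin; case: ifP => // _.
by rewrite lee_fin subr_ge0.
Qed.

Definition L1dist (f g : R -> R) : \bar R := (\int[mu]_(y in `]0%R, 1%R[) `|f y - g y|%:E)%E.

Lemma L1distC f g : L1dist f g = L1dist g f.
Proof. by apply: eq_integral => y _; rewrite distrC. Qed.

Lemma L1dist_eq f g f' g' : (forall y, 0 < y < 1 -> f y = f' y) ->
  (forall y, 0 < y < 1 -> g y = g' y) -> L1dist f g = L1dist f' g'.
Proof.
by move=> ff' gg'; apply: eq_integral => y; rewrite inE/= in_itv/= => y01;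
  rewrite ff'// gg'.
Qed.

Lemma L1dist_triangle f g h :
  measurable_fun (`]0, 1[%classic : set R) f -> measurable_fun (`]0, 1[%classic : set R) g ->
  measurable_fun (`]0, 1[%classic : set R) h -> (L1dist f h <= L1dist f g + L1dist g h)%E.
Proof.
move=> mf mg mh; rewrite /L1dist.
have md (u u' : R -> R) : measurable_fun (`]0, 1[%classic : set R) u ->
    measurable_fun (`]0, 1[%classic : set R) u' ->
    measurable_fun (`]0, 1[%classic : set R) (fun y => `|u y - u' y|%:E).
  move=> mu1 mu2; apply/measurable_EFinP; apply: measurableT_comp => //.
  exact: measurable_funB.
rewrite -ge0_integralD//; try exact: md.
apply: ge0_le_integral => //; try exact: md.
  by apply: emeasurable_funD; exact: md.
by move=> y _; rewrite -EFinD lee_fin ler_distD.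
Qed.

Section TwoConfigurations.
Variables (M : nat) (z z' r r' : nat -> R).
Hypothesis M_gt0 : (0 < M)%N.
Hypothesis z_inc : forall p, (p < M)%N -> z p <= z p.+1.
Hypothesis z'_inc : forall p, (p < M)%N -> z' p <= z' p.+1.
Hypothesis z_cover : z 0%N <= 0 /\ 1 <= z M.
Hypothesis z'_cover : z' 0%N <= 0 /\ 1 <= z' M.

Lemma L1dist_shift : (forall p, (p <= M)%N -> z p <= z' p) ->
  (L1dist (step_fun M z' r') (step_fun M z r) <=
   (\sum_(p < M) `|r' p - r p| * (z' p.+1 - z' p) +
    \sum_(p < M.-1) `|r p.+1 - r p| * (z' p.+1 - z p.+1))%:E)%E.
Proof.
move=> zz'.
have pM1 p : (p < M.-1)%N -> (p.+1 < M)%N by case: (M) => // -[].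
pose f1 y := \sum_(p < M) `|r' p - r p| * \1_(`[z' p, z' p.+1[%classic) y.
pose f2 y := \sum_(p < M.-1) `|r p.+1 - r p| * \1_(`[z p.+1, z' p.+1[%classic) y.
have mf1 : measurable_fun (`]0, 1[%classic : set R) (EFin \o f1).
  apply/measurable_EFinP; apply: measurable_sum => p; exact: measurable_funM.
have mf2 : measurable_fun (`]0, 1[%classic : set R) (EFin \o f2).
  apply/measurable_EFinP; apply: measurable_sum => p; exact: measurable_funM.
have f10 y : 0 <= f1 y by rewrite sumr_ge0// => p _; rewrite mulr_ge0.
have f20 y : 0 <= f2 y by rewrite sumr_ge0// => p _; rewrite mulr_ge0.
have main : (L1dist (step_fun M z' r') (step_fun M z r) <=
    \int[mu]_(y in `]0%R, 1%R[) (f1 y + f2 y)%:E)%E.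
  apply: ge0_le_integral => //.
  - apply/measurable_EFinP; apply: measurableT_comp => //.
    by apply: measurable_funB; exact: step_fun_measurable.
  - exact: (emeasurable_funD mf1 mf2).
  move=> y; rewrite /= in_itv/= => /andP[y0 y1]; rewrite lee_fin.
  have [z0 zM] := z_cover; have [z'0 z'M] := z'_cover.
  have -> : step_fun M z' r' y - step_fun M z r y =
      \sum_(p < M) (r' p - r p) * \1_(`[z' p, z' p.+1[%classic) y +
      \sum_(p < M.-1) (r p.+1 - r p) * ((z' p.+1 <= y)%R%:R - (z p.+1 <= y)%R%:R).
    rewrite [step_fun M z r y]step_fun_abel//; try lra.
    have := @step_fun_abel M z' r y M_gt0 z'_inc ltac:(lra) ltac:(lra).
    rewrite /step_fun => E.
    under [X in _ = X + _]eq_bigr => p _ do rewrite mulrBl.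
    under [X in _ = _ + X]eq_bigr => p _ do rewrite mulrBr.
    by rewrite !sumrB E; ring.
  apply: (le_trans (ler_normD _ _)); apply: lerD.
    apply: (le_trans (ler_norm_sum _ _ _)); apply: ler_sum => p _.
    by rewrite normrM [X in _ * X]ger0_norm.
  apply: (le_trans (ler_norm_sum _ _ _)); apply: ler_sum => p _.
  rewrite normrM ler_wpM2l// indic_co ltNge.
  have zzp := zz' p.+1 (ltnW (pM1 p (ltn_ord p))).
  case: (leP (z' p.+1) y) => h; last by rewrite sub0r normrN andbT ger0_norm.
  by rewrite (le_trans zzp h) subrr normr0.
apply: (le_trans main).
under eq_integral do rewrite EFinD.
rewrite ge0_integralD//; try by move=> y _; rewrite lee_fin.
rewrite EFinD; apply: leeD.
  exact: (@integral_step_le _ M (fun p => `|r' p - r p|) z' (fun p => z' p.+1)).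
apply: (@integral_step_le _ M.-1 (fun p => `|r p.+1 - r p|) (fun p => z p.+1)
  (fun p => z' p.+1)) => // p pM.
by apply: zz'; exact/ltnW/pM1.
Qed.

End TwoConfigurations.

(** Between two points at distance less than [h], only the interfaces [z p.+1]
    at distance less than [h] on the left of [y] matter. *)
Lemma step_fun_osc (M : nat) z r y y0 (h : R) : (0 < M)%N ->
  (forall p, (p < M)%N -> z p <= z p.+1) -> z 0%N <= y0 -> y < z M ->
  y0 <= y -> y < y0 + h ->
  `|step_fun M z r y - step_fun M z r y0| <=
  \sum_(p < M.-1) `|r p.+1 - r p| * \1_(`[z p.+1, z p.+1 + h[%classic) y.
Proof.
move=> M0 zinc y00 yM y0y yh.
rewrite !step_fun_abel//; try lra.
rewrite opprD addrACA subrr add0r -sumrB.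
apply: (le_trans (ler_norm_sum _ _ _)); apply: ler_sum => p _.
rewrite -mulrBr normrM ler_wpM2l// indic_co.
case: (leP (z p.+1) y0) => h1; first by rewrite (le_trans h1 y0y) subrr normr0.
rewrite subr0 ger0_norm//; case: (leP (z p.+1) y) => //= h2.
by rewrite (_ : (y < z p.+1 + h)%R = true)//; lra.
Qed.

Lemma L1dist_sample (M M' : nat) z z' r r' (H : nat) (eta : R) :
  (0 < M)%N -> (0 < M')%N -> (0 < H)%N -> 0 <= eta ->
  (forall p, (p < M)%N -> z p <= z p.+1) -> z 0%N <= 0 /\ 1 <= z M ->
  (forall p, (p < M')%N -> z' p <= z' p.+1) -> z' 0%N <= 0 /\ 1 <= z' M' ->
  (forall c : nat, (c < H)%N -> `|step_fun M z r (c%:R / H%:R)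
                                 - step_fun M' z' r' (c%:R / H%:R)| <= eta) ->
  (L1dist (step_fun M z r) (step_fun M' z' r') <=
   ((\sum_(p < M.-1) `|r p.+1 - r p|) / H%:R +
    (\sum_(p < M'.-1) `|r' p.+1 - r' p|) / H%:R + eta)%:E)%E.
Proof.
move=> M0 M'0 H0 eta0 zinc [z0 zM] z'inc [z'0 z'M] Heta.
have HR : 0 < H%:R :> R by rewrite ltr0n.
have hR : 0 < H%:R^-1 :> R by rewrite invr_gt0.
pose F M z r y := \sum_(p < M.-1) `|r p.+1 - r p| *
  \1_(`[z p.+1, z p.+1 + H%:R^-1[%classic) y : R.
have mF M0' u s : measurable_fun (`]0, 1[%classic : set R) (EFin \o F M0' u s).
  apply/measurable_EFinP; apply: measurable_sum => p; exact: measurable_funM.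
have mF' M0' u s : measurable_fun (`]0, 1[%classic : set R) (F M0' u s).
  exact/measurable_EFinP.
have F0 M0' u s y : 0 <= F M0' u s y by rewrite sumr_ge0// => p _; rewrite mulr_ge0.
have IF M0' u s : (\int[mu]_(y in `]0%R, 1%R[) (F M0' u s y)%:E <=
    ((\sum_(p < M0'.-1) `|s p.+1 - s p|) / H%:R)%:E)%E.
  rewrite mulr_suml.
  have H1 := @integral_step_le (`]0, 1[%classic : set R) M0'.-1 (fun p => `|s p.+1 - s p|)
    (fun p => u p.+1) (fun p => u p.+1 + H%:R^-1).
  apply: (@le_trans _ _ _ _ _ (H1 _ _ _)) => //; first by move=> p _; rewrite lerDl ltW.
  by rewrite lee_fin; apply: ler_sum => p _; rewrite addrAC subrr add0r.
have main : (L1dist (step_fun M z r) (step_fun M' z' r') <=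
    \int[mu]_(y in `]0%R, 1%R[) (F M z r y + (F M' z' r' y + eta))%:E)%E.
  apply: ge0_le_integral => //.
  - apply/measurable_EFinP; apply: measurableT_comp => //.
    by apply: measurable_funB; exact: step_fun_measurable.
  - apply/measurable_EFinP; apply: measurable_funD; first exact: mF'.
    by apply: measurable_funD => //; exact: mF'.
  move=> y; rewrite /= in_itv/= => /andP[y0 y1]; rewrite lee_fin.
  pose c := Num.truncn (y * H%:R).
  have /andP[c1 c2] : c%:R <= y * H%:R < c.+1%:R by apply: truncn_itv; rewrite mulr_ge0 ?ltW.
  have cH : (c < H)%N.
    by rewrite -(ltr_nat R); apply: (le_lt_trans c1); rewrite gtr_pMl.
  have x1 : c%:R / H%:R <= y by rewrite ler_pdivrMr.
  have x2 : y < c%:R / H%:R + H%:R^-1.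
    by rewrite -[X in _ + X]mul1r -mulrDl natr1 ltr_pdivlMr.
  have x0 : 0 <= c%:R / H%:R :> R by rewrite divr_ge0.
  have h1 := @step_fun_osc M z r y (c%:R / H%:R) H%:R^-1 M0 zinc ltac:(lra) ltac:(lra) x1 x2.
  have h2 := @step_fun_osc M' z' r' y (c%:R / H%:R) H%:R^-1 M'0 z'inc ltac:(lra) ltac:(lra) x1 x2.
  have h3 := Heta c cH.
  rewrite -/(F M z r y) in h1; rewrite -/(F M' z' r' y) distrC in h2.
  apply: (le_trans (ler_distD (step_fun M z r (c%:R / H%:R)) _ _)); apply: lerD => //.
  apply: (le_trans (ler_distD (step_fun M' z' r' (c%:R / H%:R)) _ _)).
  by rewrite addrC; apply: lerD.
apply: (le_trans main).
have m3 : measurable_fun (`]0, 1[%classic : set R) (fun _ : R => eta%:E).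
  exact: measurable_cst.
have m23 : measurable_fun (`]0, 1[%classic : set R) (fun y => (F M' z' r' y + eta)%:E).
  by apply/measurable_EFinP; apply: measurable_funD => //; exact: mF'.
have p1 y : (`]0, 1[%classic : set R) y -> (0 <= (F M z r y)%:E)%E by rewrite lee_fin.
have p2 y : (`]0, 1[%classic : set R) y -> (0 <= (F M' z' r' y)%:E)%E by rewrite lee_fin.
have p3 y : (`]0, 1[%classic : set R) y -> (0 <= eta%:E)%E by rewrite lee_fin.
have p23 y : (`]0, 1[%classic : set R) y -> (0 <= (F M' z' r' y + eta)%:E)%E.
  by rewrite lee_fin addr_ge0.
have m01 : measurable (`]0, 1[%classic : set R) by exact: measurable_itv.
have E1 : (\int[mu]_(y in `]0%R, 1%R[) (F M z r y + (F M' z' r' y + eta))%:E =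
    \int[mu]_(y in `]0%R, 1%R[) (F M z r y)%:E +
    \int[mu]_(y in `]0%R, 1%R[) (F M' z' r' y + eta)%:E)%E.
  exact: (ge0_integralD mu m01 p1 (mF M z r) p23 m23).
have E2 : (\int[mu]_(y in `]0%R, 1%R[) (F M' z' r' y + eta)%:E =
    \int[mu]_(y in `]0%R, 1%R[) (F M' z' r' y)%:E +
    \int[mu]_(y in `]0%R, 1%R[) eta%:E)%E.
  exact: (ge0_integralD mu m01 p2 (mF M' z' r') p3 m3).
have E3 : (\int[mu]_(y in `]0%R, 1%R[) eta%:E)%E = eta%:E.
  rewrite integral_cst// -[RHS]mule1.
  by have := lebesgue_itv_oo (@ler01 R); rewrite subr0 => <-.
rewrite E1 E2 E3 addeA EFinD; apply: leeD => //.
by rewrite EFinD; apply: leeD; exact: IF.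
Qed.

End StepFunctions.

Lemma is_derive_lincomb (R : realType) (P : nat) (c : nat -> R) (g : nat -> R -> R)
  (dg : nat -> R) (t : R) : (forall p, (p < P)%N -> is_derive t 1 (g p) (dg p)) ->
  is_derive t 1 (fun s => \sum_(p < P) c p * g p s) (\sum_(p < P) c p * dg p).
Proof.
elim: P => [_|P IH H].
  rewrite big_ord0 (_ : (fun _ => _) = cst 0); first exact: is_derive_cst.
  by apply/funext => s; rewrite big_ord0.
rewrite big_ord_recr/= (_ : (fun _ => _) =
    (fun s => \sum_(p < P) c p * g p s) + (fun s => c P * g P s)); last first.
  by apply/funext => s; rewrite big_ord_recr.
apply: is_deriveD; first by apply: IH => p pP; apply: H; rewrite ltnS ltnW.
exact: (@is_deriveZ R R^o R^o _ (c P) _ _ _ (H P (ltnSn P))).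
Qed.

Section FlowDensity.
Context {R : realType}.
Variables (T : R) (m M : nat) (delta rhomax vmax l V K : R).
Variables (v : R -> R) (w : nat -> R) (z : nat -> nat -> R -> R).
Hypothesis T_gt0 : 0 < T.
Hypothesis m_gt0 : (0 < m)%N.
Hypothesis M_gt0 : (0 < M)%N.
Hypothesis delta_gt0 : 0 < delta.
Hypothesis delta_le : delta <= rhomax.
Hypothesis vmax_ge0 : 0 <= vmax.
Hypothesis K_ge0 : 0 <= K.
Hypothesis v_lip : forall a b, 0 <= a <= rhomax -> 0 <= b <= rhomax ->
  `|v a - v b| <= K * `|a - b|.
Hypothesis Hflow : flow T m M delta rhomax vmax l V v w z.
Let tg := tgrid T m.

Definition rho (k : nat) (t y : R) : R :=
  step_fun M (fun p => z k p t) (fun p => dens w (z k) p t) y.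

Lemma flow_inc k t : (k < m)%N -> tg k <= t <= tg k.+1 ->
  forall p, (p < M)%N -> z k p t <= z k p.+1 t.
Proof.
move=> km kt p pM; have [g0 _] := flow_gap Hflow km pM kt.
by rewrite -subr_ge0 ltW.
Qed.

Lemma rho_range k t y : (k < m)%N -> tg k <= t <= tg k.+1 -> 0 <= y < 1 ->
  delta <= rho k t y <= rhomax.
Proof.
move=> km kt y01; have [z0 zM] := flow_cover Hflow km kt.
have y0 : z k 0%N t <= y by lra.
have yM : y < z k M t by lra.
have [p pM zp] := @cell_exists R M (fun p => z k p t) y y0 yM.
rewrite /rho (step_fun_cell _ (flow_inc km kt) pM zp).
by have [] := flow_gap Hflow km pM kt.
Qed.

Let CL := rhomax * (K * V + vmax) + vmax * V.

Lemma flow_V_ge0 : 0 <= V.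
Proof.
have t01 : tg 0 <= tg 0 <= tg 1.
  by rewrite lexx /tg /tgrid ler_wpM2r ?ler_nat// divr_ge0// ltW.
by apply: le_trans (flow_tv Hflow m_gt0 t01); apply: sumr_ge0.
Qed.

Lemma flow_C_ge0 : 0 <= CL.
Proof.
have V0 := flow_V_ge0; have d0 := delta_gt0; have dm := delta_le.
have r0 : 0 <= rhomax by lra.
by rewrite addr_ge0 ?mulr_ge0// addr_ge0// mulr_ge0.
Qed.

Lemma gap_variation k s t : (k < m)%N -> tg k <= s -> s <= t -> t <= tg k.+1 ->
  \sum_(p < M) `|gap (z k) p t - gap (z k) p s| <= (K * V + vmax) * (t - s).
Proof.
move=> km ks st tk.
have [P ME] : exists P, M = P.+1 by exists M.-1; rewrite prednK.
rewrite ME big_ord_recr/= mulrDl; apply: lerD; last first.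
  have PM : (P < M)%N by rewrite ME.
  have := flow_speed Hflow km PM ks st tk.
  have := flow_speed Hflow km (ltnW PM) ks st tk.
  by rewrite /gap ler_norml -ME; lra.
pose c p := Num.sg (gap (z k) p t - gap (z k) p s).
have -> : \sum_(p < P) `|gap (z k) p t - gap (z k) p s| =
    \sum_(p < P) c p * gap (z k) p t - \sum_(p < P) c p * gap (z k) p s.
  by rewrite -sumrB; apply: eq_bigr => p _; rewrite -mulrBr /c normrEsg.
pose d (p : nat) u := v (dens w (z k) p.+1 u) - v (dens w (z k) p u).
have [||u ust ->] := @MVT_segment R (fun u => \sum_(p < P) c p * gap (z k) p u)
    (fun u => \sum_(p < P) c p * d p u) s t st.
- move=> u; rewrite in_itv/= => ust.
  apply: (@is_derive_lincomb R P c (gap (z k)) (fun p => d p u) u) => p pP.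
  have pM : (p.+1 < M)%N by rewrite ME ltnS.
  apply: is_deriveB; apply: (flow_derive Hflow km) => //; try lra.
  + by move: ks tk; rewrite /tg; lra.
  + exact: ltnW.
  + by move: ks tk; rewrite /tg; lra.
- apply: (@within_continuous_sum R P (fun p u => c p * gap (z k) p u)) => p pP x.
  have pM : (p.+1 < M)%N by rewrite ME ltnS.
  apply: (@cvgM R _ _ _ (fun=> c p)); first exact: cvg_cst.
  have cz q (qM : (q <= M)%N) := within_itvS ks tk (flow_cont Hflow km qM).
  apply: (@cvgB _ R^o); [exact: (cz _ (ltnW pM)) | exact: (cz _ (ltnW (ltnW pM)))].
rewrite ler_wpM2r ?subr_ge0//.
have kst : tg k <= u <= tg k.+1 by move: ust; rewrite in_itv/=; lra.
apply: (le_trans (ler_norm _)); apply: (le_trans (ler_norm_sum _ _ _)).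
apply: (@le_trans _ _ (K * \sum_(p < P) `|dens w (z k) p.+1 u - dens w (z k) p u|)).
  rewrite mulr_sumr; apply: ler_sum => p _.
  have pM : (p.+1 < M)%N by rewrite ME ltnS.
  have [_ h1] := flow_gap Hflow km pM kst.
  have [_ h2] := flow_gap Hflow km (ltnW pM) kst.
  have d0 := delta_gt0.
  rewrite normrM -[leRHS]mul1r; apply: ler_pM => //.
    by rewrite /c normr_sg lern1; case: (_ == _).
  by apply: v_lip; lra.
rewrite ler_wpM2l//.
by have := flow_tv Hflow km kst; rewrite ME.
Qed.

Lemma rho_lipschitz_step k s t : (k < m)%N -> tg k <= s -> s <= t -> t <= tg k.+1 ->
  (L1dist (rho k t) (rho k s) <= (CL * (t - s))%:E)%E.
Proof.
move=> km ks st tk.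
have kks : tg k <= s <= tg k.+1 by rewrite ks (le_trans st).
have kkt : tg k <= t <= tg k.+1 by rewrite tk (le_trans ks).
have d0 := delta_gt0; have dm := delta_le.
apply: le_trans (L1dist_shift _ _ M_gt0 (flow_inc km kks) (flow_inc km kkt)
  (flow_cover Hflow km kks) (flow_cover Hflow km kkt) _) _.
  by move=> p pM; have := flow_speed Hflow km pM ks st tk; lra.
rewrite lee_fin /CL mulrDl; apply: lerD.
  apply: (@le_trans _ _ (rhomax * \sum_(p < M) `|gap (z k) p t - gap (z k) p s|)).
    rewrite mulr_sumr; apply: ler_sum => p _; have pM := ltn_ord p.
    have [g1 r1] := flow_gap Hflow km pM kks.
    have [g2 r2] := flow_gap Hflow km pM kkt.
    rewrite -/(gap (z k) p t) -[X in _ * X <= _](ger0_norm (ltW g2)) -normrM.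
    have -> : (dens w (z k) p t - dens w (z k) p s) * gap (z k) p t =
        - (dens w (z k) p s * (gap (z k) p t - gap (z k) p s)).
      by rewrite /dens; field; rewrite !gt_eqF.
    by rewrite normrN normrM ler_wpM2r// ger0_norm; lra.
  by rewrite -mulrA ler_wpM2l ?gap_variation//; lra.
rewrite mulrAC [leRHS]mulrC; have V0 := flow_V_ge0.
apply: (@le_trans _ _ (\sum_(p < M.-1) `|dens w (z k) p.+1 s - dens w (z k) p s| *
    (vmax * (t - s)))).
  apply: ler_sum => p _; rewrite ler_wpM2l//.
  have pM : (p.+1 <= M)%N by rewrite (leq_trans (ltn_ord p))// leq_pred.
  by have := flow_speed Hflow km pM ks st tk; lra.
rewrite -mulr_suml ler_wpM2r ?mulr_ge0 ?subr_ge0//.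
exact: (flow_tv Hflow km kks).
Qed.

Lemma rho_rearrange k y : (k.+1 < m)%N -> 0 < y < 1 ->
  rho k.+1 (tg k.+1) y = rho k (tg k.+1) y.
Proof.
move=> km y01; set t := tg k.+1.
have kk j : tg j <= tg j.+1.
  by rewrite /tg /tgrid ler_wpM2r ?ler_nat// divr_ge0// ltW.
have kt : tg k <= t <= tg k.+1 by rewrite lexx kk.
have kt' : tg k.+1 <= t <= tg k.+2 by rewrite lexx kk.
have km' := ltnW km.
have inc := flow_inc km' kt.
have [a [b [abM [za zb] keep _ _]]] := flow_rearrange Hflow km.
have [z0 zM] := flow_cover Hflow km' kt.
have y0 : z k 0%N t <= y by lra.
have yM : y < z k M t by lra.
have [p pM zp] := @cell_exists R M (fun p => z k p t) y y0 yM.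
have zle i j : (i <= j)%N -> (j <= M)%N -> z k i t <= z k j t.
  elim: j => [|j IH]; first by rewrite leqn0 => /eqP ->.
  rewrite leq_eqVlt => /orP[/eqP->//|]; rewrite ltnS => ij jM.
  by apply: (le_trans (IH ij (ltnW jM))); exact: inc.
have ap : (a <= p)%N.
  rewrite leqNgt; apply/negP => pa.
  by have := zle p.+1 a pa ltac:(by case/andP: abM => h1 h2; exact: leq_trans (ltnW h1) h2); lra.
have pb : (p < b)%N.
  rewrite ltnNge; apply/negP => bp.
  by have := zle b p bp (ltnW pM); lra.
have e1 : z k.+1 p t = z k p t by apply: keep; rewrite ap ltnW.
have e2 : z k.+1 p.+1 t = z k p.+1 t by apply: keep; rewrite pb leqW.
rewrite /rho (step_fun_cell _ inc pM zp).
rewrite (step_fun_cell _ (flow_inc km kt') pM); first by rewrite /dens /gap e1 e2.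
by rewrite e1 e2.
Qed.

Lemma rho_measurable k t (D : set R) : measurable_fun D (rho k t).
Proof. exact: step_fun_measurable. Qed.

Lemma rho_lipschitz d k s t : (k + d < m)%N -> tg k <= s <= tg k.+1 ->
  tg (k + d) <= t <= tg (k + d).+1 -> s <= t ->
  (L1dist (rho (k + d) t) (rho k s) <= (CL * (t - s))%:E)%E.
Proof.
elim: d t => [t|d IH t] kdm /andP[ks sk].
  by rewrite addn0 => /andP[kt tk] st; apply: rho_lipschitz_step => //; rewrite -(addn0 k).
rewrite addnS => /andP[kt tk] st.
have kk j : tg j <= tg j.+1.
  by rewrite /tg /tgrid ler_wpM2r ?ler_nat// divr_ge0// ltW.
have kdm' : (k + d < m)%N by rewrite (leq_trans _ kdm)// addnS.
have kdS : ((k + d).+1 < m)%N by rewrite -addnS.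
have sS : s <= tg (k + d).+1.
  apply: (le_trans sk); rewrite /tg /tgrid ler_wpM2r ?ler_nat ?ltnS ?leq_addr//.
  by rewrite divr_ge0// ltW.
apply: (le_trans (L1dist_triangle (rho_measurable _ _ (D := _))
  (rho_measurable (k + d).+1 (tg (k + d).+1) (D := _)) (rho_measurable _ _ (D := _)))).
have -> : CL * (t - s) = CL * (t - tg (k + d).+1) + CL * (tg (k + d).+1 - s) by ring.
rewrite EFinD; apply: leeD; first exact: rho_lipschitz_step.
rewrite (@L1dist_eq _ _ _ (rho (k + d) (tg (k + d).+1)) (rho k s))//.
  by apply: IH; rewrite // ?ks ?sk ?kk ?lexx.
by move=> y y01; exact: rho_rearrange.
Qed.

Lemma tgrid_locate t : 0 < t <= T -> exists2 k, (k < m)%N & tg k < t <= tg k.+1.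
Proof.
move=> /andP[t0 tT].
have tm : t <= tg m by rewrite /tg /tgrid mulrC divfK// pnatr_eq0 -lt0n.
elim: (m) tm => [|k IH]; first by rewrite {1}/tg /tgrid mul0r leNgt t0.
move=> tk; case: (leP t (tg k)) => tk'.
  by have [j jk h] := IH tk'; exists j => //; exact: ltnW.
by exists k => //; rewrite tk' tk.
Qed.

(** The discrete density [ftl_density] in the present indexing. *)
Definition density (t y : R) : R :=
  \sum_(k < m) rho k t y * \1_(`]tg k, tg k.+1]%classic) t.

Lemma densityE k t y : (k < m)%N -> tg k < t <= tg k.+1 -> density t y = rho k t y.
Proof.
move=> km /andP[kt tk].
have tle i j : (i <= j)%N -> tg i <= tg j.
  by move=> ij; rewrite /tg /tgrid ler_wpM2r ?ler_nat// divr_ge0// ltW.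
rewrite /density (bigD1 (Ordinal km))//= big1 ?addr0.
  by rewrite indicE mem_set ?mulr1//= in_itv/= kt.
move=> j; rewrite -val_eqE/= => jk; rewrite indicE memNset ?mulr0//=.
rewrite in_itv/= => /andP[h1 h2]; have [jk'|kj|/eqP] := ltngtP j k; last by rewrite (negbTE jk).
  by have := tle _ _ jk'; lra.
by have := tle _ _ kj; lra.
Qed.

Lemma density_lipschitz s t : 0 < s -> s <= t -> t <= T ->
  (L1dist (density t) (density s) <= (CL * (t - s))%:E)%E.
Proof.
move=> s0 st tT.
have [k km ks] := @tgrid_locate s ltac:(lra).
have [j jm jt] := @tgrid_locate t ltac:(lra).
rewrite (@L1dist_eq _ _ _ (rho j t) (rho k s)); last 2 first.
- by move=> y _; exact: densityE.
- by move=> y _; exact: densityE.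
have kj : (k <= j)%N.
  rewrite leqNgt; apply/negP => jk.
  have : tg j.+1 <= tg k by rewrite /tg /tgrid ler_wpM2r ?ler_nat// divr_ge0// ltW.
  by lra.
rewrite -(subnKC kj) in jm jt *.
by apply: rho_lipschitz => //; lra.
Qed.

Lemma density_range t y : 0 < t <= T -> 0 <= y < 1 -> delta <= density t y <= rhomax.
Proof.
move=> tT y01; have [k km kt] := tgrid_locate tT.
by rewrite (densityE _ km kt) rho_range//; lra.
Qed.

End FlowDensity.

Section Domain.
Context {R : realType}.
Notation mu := (@lebesgue_measure R).
Variable T : R.
Hypothesis T_gt0 : 0 < T.

Lemma domain_measurable : measurable (domain T).
Proof. by apply: measurableX; exact: measurable_itv. Qed.

Lemma domain_finite : ((leb2 R) (domain T) < +oo)%E.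
Proof.
have h : (mu `]0%R, T[ * mu `]0%R, 1%R[ < +oo)%E.
  by rewrite (lebesgue_itv_oo (ltW T_gt0)) (lebesgue_itv_oo (@ler01 R)) -EFinM ltry.
by rewrite /domain product_measure1E; [exact: h| exact: measurable_itv..].
Qed.

Lemma integral_domain_le (F : R * R -> R) (c : R) :
  measurable_fun [set: R * R] F -> (forall p, 0 <= F p) ->
  (forall t, 0 < t < T -> (\int[mu]_(y in `]0%R, 1%R[) (F (t, y))%:E <= c%:E)%E) ->
  (\int[leb2 R]_(p in domain T) (F p)%:E <= (c * T)%:E)%E.
Proof.
move=> mF F0 Hc.
pose G := (EFin \o F) \_ (domain T).
have mG : measurable_fun [set: R * R] G.
  apply/(measurable_restrict (EFin \o F) domain_measurable measurableT).
  apply: measurable_funTS; exact/measurable_EFinP.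
have G0 p : (0 <= G p)%E.
  by rewrite /G patchE; case: ifP => // _; rewrite lee_fin.
have -> : (\int[leb2 R]_(p in domain T) (F p)%:E = \int[leb2 R]_p G p)%E.
  refine (@integral_mkcond _ _ R (leb2 R) (domain T) (EFin \o F)).
have -> : (\int[leb2 R]_p G p = \int[mu]_t fubini_F mu G t)%E.
  refine (@fubini_tonelli1 _ _ _ _ R (@lebesgue_measure R) (@lebesgue_measure R) G mG G0).
pose Inn t := (\int[mu]_(y in `]0%R, 1%R[) (F (t, y))%:E)%E.
have GE t : fubini_F mu G t = (Inn \_ `]0%R, T[) t.
  rewrite /fubini_F patchE; case: ifPn => tT.
    rewrite [RHS]integral_mkcond; apply: eq_integral => y _.
    rewrite /G !patchE; congr (if _ then _ else _).
    apply/idP/idP => [/set_mem[_ /= h]|/set_mem h]; first by rewrite mem_set.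
    by rewrite mem_set//; split => //; exact: set_mem tT.
  apply: integral0_eq => y _; rewrite /G patchE; case: ifPn => // /set_mem[/= h _].
  by move: tT; rewrite mem_set.
have GF : fubini_F mu G = Inn \_ (`]0, T[%classic : set R) by apply/funext => t; exact: GE.
have mg : measurable_fun [set: R]
    (Inn \_ (`]0%R, T[%classic : set R)).
  rewrite -GF; exact: measurable_fun_fubini_tonelli_F.
rewrite GF.
have -> : (\int[mu]_t (Inn \_ (`]0%R, T[%classic : set R)) t = \int[mu]_(t in `]0%R, T[) Inn t)%E.
  refine (esym (@integral_mkcond _ _ R (@lebesgue_measure R) `]0%R, T[ Inn)).
have mInn : measurable_fun (`]0, T[%classic : set R) Inn.
  have := (measurable_restrict Inn (measurable_itv `]0%R, T[) measurableT).2 mg.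
  by rewrite setTI.
have le1 : (\int[mu]_(t in `]0%R, T[) Inn t <= \int[mu]_(t in `]0%R, T[) (cst c%:E t))%E.
  apply: ge0_le_integral => //.
  by move=> t _; apply: integral_ge0 => y _; rewrite lee_fin.
apply: (le_trans le1).
rewrite integral_cst// EFinM lee_wpmul2l//.
  have := Hc (T / 2) ltac:(have := T_gt0; lra); apply: le_trans.
  by apply: integral_ge0 => y _; rewrite lee_fin.
have h := lebesgue_itv_oo (ltW T_gt0); rewrite subr0 in h.
by move: (lexx (T%:E : \bar R)); rewrite -{1}h.
Qed.

End Domain.

Section Measurability.
Context {R : realType}.

Lemma within_continuous_measurable (f : R -> R) (a b : R) :
  {within `[a, b], continuous f} -> measurable_fun [set: R] (f \_ `]a, b]).
Proof.
move=> cf; have mab : measurable (`]a, b]%classic : set R) by exact: measurable_itv.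
apply/(measurable_restrict f mab measurableT); rewrite setTI.
apply: (@measurable_funS _ _ _ _ `[a, b]%classic) => //.
  by move=> t /=; rewrite !in_itv/= => /andP[/ltW -> ->].
exact: subspace_continuous_measurable_fun.
Qed.

Variables (T : R) (m M : nat) (delta rhomax vmax l V : R).
Variables (v : R -> R) (w : nat -> R) (z : nat -> nat -> R -> R).
Hypothesis Hflow : flow T m M delta rhomax vmax l V v w z.

Lemma flow_dens_cont k p : (k < m)%N -> (p < M)%N ->
  {within `[tgrid T m k, tgrid T m k.+1], continuous (dens w (z k) p)}.
Proof.
move=> km pM; apply/subspace_continuousP => t /= tk.
have cz q (qM : (q <= M)%N) := (@subspace_continuousP _ _ _ _).1 (flow_cont Hflow km qM).
have [g0 _] := @flow_gap _ _ _ _ _ _ _ _ _ _ _ _ Hflow k p t km pM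
  ltac:(by move: tk; rewrite in_itv).
apply: (@cvgM R _ _ _ (fun=> w p)); first exact: cvg_cst.
apply: cvgV; first by rewrite gt_eqF.
by apply: (@cvgB _ R^o); apply: cz => //; exact: ltnW.
Qed.

Lemma density_measurable : measurable_fun [set: R * R]
  (fun p : R * R => density T m M w z p.1 p.2).
Proof.
rewrite /density /rho /step_fun.
have -> : (fun p : R * R => \sum_(k < m) (\sum_(i < M) dens w (z k) i p.1 *
    \1_(`[z k i p.1, z k i.+1 p.1[%classic) p.2) *
    \1_(`]tgrid T m k, tgrid T m k.+1]%classic) p.1) =
  (fun p => \sum_(k < m) \sum_(i < M)
    (dens w (z k) i \_ `]tgrid T m k, tgrid T m k.+1]) p.1 *
    ((if (z k i \_ `]tgrid T m k, tgrid T m k.+1]) p.1 <= p.2 then 1 else 0) -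
     (if (z k i.+1 \_ `]tgrid T m k, tgrid T m k.+1]) p.1 <= p.2 then 1 else 0))).
  apply/funext => -[t y] /=; apply: eq_bigr => k _; rewrite mulr_suml.
  apply: eq_bigr => i _; rewrite indic_co indicE !patchE.
  case: (boolP (t \in _)) => kt; last by rewrite mulr0 mul0r.
  have kt' : tgrid T m k <= t <= tgrid T m k.+1.
    by move/set_mem: kt; rewrite /= in_itv/= => /andP[/ltW -> ->].
  have [/ltW g0 _] := flow_gap Hflow (ltn_ord k) (ltn_ord i) kt'.
  rewrite subr_ge0 in g0.
  rewrite mulr1 ltNge; congr (_ * _).
  case: (leP (z k i.+1 t) y) => h; first by rewrite (le_trans g0 h) subrr.
  by rewrite andbT subr0; case: ifP.
apply: measurable_sum => k; apply: measurable_sum => i.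
have mz j : (j <= M)%N ->
    measurable_fun [set: R] (z k j \_ `]tgrid T m k, tgrid T m k.+1]).
  by move=> jM; apply: within_continuous_measurable; exact: (flow_cont Hflow (ltn_ord k) jM).
have mi j : (j <= M)%N -> measurable_fun [set: R * R]
   (fun p : R * R => if (z k j \_ `]tgrid T m k, tgrid T m k.+1]) p.1 <= p.2 then 1 else 0 : R).
  move=> jM; apply: measurable_fun_ifT => //; apply: measurable_fun_ler => //.
  exact: (measurableT_comp (mz j jM) measurable_fst).
apply: measurable_funM.
  apply: (measurableT_comp _ measurable_fst).
  by apply: within_continuous_measurable; exact: flow_dens_cont.
by apply: measurable_funB; apply: mi => //; exact: ltnW.
Qed.

End Measurability.

Section Ultra.
Context {R : realType}.
Variable U : set_system nat.
Hypothesis UU : UltraFilter U.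

Lemma ultra_close (G : set nat) (a : nat -> R) (C eta : R) : 0 < eta -> U G ->
  (forall j, G j -> 0 <= a j <= C) ->
  exists2 A, U A & forall i j, A i -> A j -> `|a i - a j| <= eta.
Proof.
move=> eta0 UG aC.
have aU : U (a @^-1` (`[0, C]%classic : set R)).
  by apply: filterS UG => j Gj; have := aC j Gj; rewrite /= in_itv/=.
have [c [_ ac]] := @segment_compact R 0 C (fmap a U) _ aU.
have Uc : U [set j | `|c - a j| < eta / 2].
  have [//|Un] := in_ultra_setVsetC [set j | `|c - a j| < eta / 2] UU.
  have [||y [[j hj <-] hy]] :=
    ac [set a j | j in ~` [set j | `|c - a j| < eta / 2]] (ball c (eta / 2)).
  - by rewrite /fmap /=; apply: filterS Un => j hj; exists j.
  - by apply: nbhsx_ballx; lra.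
  - by case: hj.
exists [set j | `|c - a j| < eta / 2] => // i j /= hi hj.
have := ler_distD c (a i) (a j); rewrite (distrC (a i) c); lra.
Qed.

Lemma ultra_finite (P : nat) (Q : nat -> nat -> nat -> Prop) :
  (forall p, (p < P)%N -> exists2 A, U A & forall i j, A i -> A j -> Q p i j) ->
  exists2 A, U A & forall i j p, (p < P)%N -> A i -> A j -> Q p i j.
Proof.
elim: P => [_|P IH H]; first by exists setT => //; exact: filterT.
have [|A UA HA] := IH; first by move=> p pP; apply: H; rewrite ltnS ltnW.
have [B UB HB] := H P (ltnSn P).
exists (A `&` B); first exact: filterI.
move=> i j p; rewrite ltnS leq_eqVlt => /orP[/eqP->|pP] [Ai Bi] [Aj Bj].
  exact: HB.
exact: HA.
Qed.

End Ultra.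

Section Cauchy.
Context {R : realType}.
Variables (T delta rhomax vmax V K : R) (v : R -> R).
Variables (m M : nat -> nat) (l : nat -> R) (w : nat -> nat -> R).
Variable z : nat -> nat -> nat -> R -> R.
Variables (U : set_system nat) (G : set nat).
Hypothesis UU : UltraFilter U.
Hypothesis UG : U G.
Hypothesis T_gt0 : 0 < T.
Hypothesis delta_gt0 : 0 < delta.
Hypothesis delta_le : delta <= rhomax.
Hypothesis vmax_ge0 : 0 <= vmax.
Hypothesis K_ge0 : 0 <= K.
Hypothesis v_lip : forall a b, 0 <= a <= rhomax -> 0 <= b <= rhomax ->
  `|v a - v b| <= K * `|a - b|.
Hypothesis m_gt0 : forall j, G j -> (0 < m j)%N.
Hypothesis M_gt0 : forall j, G j -> (0 < M j)%N.
Hypothesis Hflow : forall j, G j ->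
  flow T (m j) (M j) delta rhomax vmax (l j) V v (w j) (z j).

Let d j := density T (m j) (M j) (w j) (z j).
Let CL := rhomax * (K * V + vmax) + vmax * V.

Lemma density_sample j i (s eta : R) (H : nat) : G i -> G j -> 0 < s <= T ->
  0 <= eta -> (0 < H)%N ->
  (forall c : nat, (c < H)%N -> `|d i s (c%:R / H%:R) - d j s (c%:R / H%:R)| <= eta) ->
  (L1dist (d i s) (d j s) <= (V / H%:R + V / H%:R + eta)%:E)%E.
Proof.
move=> Gi Gj sT eta0 H0 Heta.
have [ki kim kis] := tgrid_locate (m_gt0 Gi) sT.
have [kj kjm kjs] := tgrid_locate (m_gt0 Gj) sT.
have di y : d i s y = rho (M i) (w i) (z i) ki s y by exact: densityE.
have dj y : d j s y = rho (M j) (w j) (z j) kj s y by exact: densityE.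
have kis' : tgrid T (m i) ki <= s <= tgrid T (m i) ki.+1 by lra.
have kjs' : tgrid T (m j) kj <= s <= tgrid T (m j) kj.+1 by lra.
rewrite (@L1dist_eq _ _ _ (rho (M i) (w i) (z i) ki s) (rho (M j) (w j) (z j) kj s)) //.
have HR : 0 <= H%:R^-1 :> R by rewrite invr_ge0.
apply: le_trans (L1dist_sample (M_gt0 Gi) (M_gt0 Gj) H0 eta0
  (flow_inc (Hflow Gi) kim kis') (flow_cover (Hflow Gi) kim kis')
  (flow_inc (Hflow Gj) kjm kjs') (flow_cover (Hflow Gj) kjm kjs') _) _.
  by move=> c cH; have := Heta c cH; rewrite di dj.
rewrite lee_fin lerD2r; apply: lerD; rewrite ler_wpM2r//.
  exact: (flow_tv (Hflow Gi) kim kis').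
exact: (flow_tv (Hflow Gj) kjm kjs').
Qed.

Lemma density_L1dist j i (t eta : R) (B H : nat) : G i -> G j -> 0 < t < T ->
  0 <= eta -> (0 < H)%N -> (0 < B)%N ->
  (forall b : nat, (b < B)%N -> forall c : nat, (c < H)%N ->
    `|d i (b.+1%:R * T / B%:R) (c%:R / H%:R) - d j (b.+1%:R * T / B%:R) (c%:R / H%:R)| <= eta) ->
  (L1dist (d i t) (d j t) <= (2 * (CL * T / B%:R) + (2 * V / H%:R + eta))%:E)%E.
Proof.
move=> Gi Gj /andP[t0 tT] eta0 H0 B0 Heta.
have T0 := T_gt0.
have BR : 0 < B%:R :> R by rewrite ltr0n.
pose b := Num.truncn (t * B%:R / T).
have /andP[b1 b2] : b%:R <= t * B%:R / T < b.+1%:R.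
  by apply: truncn_itv; rewrite divr_ge0 ?mulr_ge0 ?ltW.
rewrite ler_pdivlMr// in b1; rewrite ltr_pdivrMr// in b2.
have bB : (b < B)%N.
  rewrite -(ltr_nat R) -(ltr_pM2r T0); apply: (le_lt_trans b1).
  by rewrite mulrC ltr_pM2l.
pose s := b.+1%:R * T / B%:R.
have ts : t <= s by rewrite /s ler_pdivlMr// ltW.
have sT : s <= T.
  by rewrite /s ler_pdivrMr// mulrC ler_pM2l// ler_nat.
have st : s - t <= T / B%:R.
  rewrite lerBlDr /s -natr1 mulrDl mul1r mulrDl addrC lerD2l ler_pdivrMr//.
have C0 : 0 <= CL.
  exact: (flow_C_ge0 T_gt0 (m_gt0 Gi) delta_gt0 delta_le vmax_ge0 K_ge0 (Hflow Gi)).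
have lip k : G k -> (L1dist (d k s) (d k t) <= (CL * T / B%:R)%:E)%E.
  move=> Gk.
  apply: le_trans (density_lipschitz T_gt0 (m_gt0 Gk) (M_gt0 Gk) delta_gt0 delta_le
    vmax_ge0 K_ge0 v_lip (Hflow Gk) t0 ts sT) _.
  by rewrite lee_fin -mulrA ler_wpM2l.
have mm k u : measurable_fun (`]0, 1[%classic : set R) (d k u).
  apply: measurable_sum => q; apply: measurable_funM => //; exact: step_fun_measurable.
apply: (le_trans (L1dist_triangle (mm i t) (mm i s) (mm j t))).
apply: (le_trans (leeD (lexx _) (L1dist_triangle (mm i s) (mm j s) (mm j t)))).
have -> : 2 * (CL * T / B%:R) + (2 * V / H%:R + eta) =
  CL * T / B%:R + ((V / H%:R + V / H%:R + eta) + CL * T / B%:R) by ring.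
rewrite EFinD; apply: leeD; first by rewrite L1distC lip.
rewrite EFinD; apply: leeD; last exact: lip.
apply: density_sample => //; first lra.
by move=> c cH; exact: Heta.
Qed.

Definition cut_density j (p : R * R) : R := d j p.1 p.2 * \1_(`]0, 1[%classic) p.2.

Lemma cut_density_measurable j : G j -> measurable_fun [set: R * R] (cut_density j).
Proof.
move=> Gj; apply: measurable_funM; first exact: (density_measurable (Hflow Gj)).
by apply: (measurableT_comp _ measurable_snd); exact: measurable_indic.
Qed.

Lemma density_cauchy (e : R) : 0 < e -> exists2 A, U A & forall i j, A i -> A j ->
  (\int[leb2 R]_(p in domain T) `|cut_density i p - cut_density j p|%:E <= e%:E)%E.
Proof.
move=> e0; have T0 := T_gt0.
have [i0 Gi0] := filter_ex UG.
have V0 : 0 <= V := flow_V_ge0 T_gt0 (m_gt0 Gi0) (Hflow Gi0).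
have C0 : 0 <= CL.
  exact: (flow_C_ge0 T_gt0 (m_gt0 Gi0) delta_gt0 delta_le vmax_ge0 K_ge0 (Hflow Gi0)).
pose eta := e / (3 * T).
have eta0 : 0 < eta by rewrite divr_gt0//; lra.
pose B := (Num.truncn (2 * (CL * T) / eta)).+1.
pose H := (Num.truncn (2 * V / eta)).+1.
have BR : 0 < B%:R :> R by rewrite ltr0n.
have HR : 0 < H%:R :> R by rewrite ltr0n.
have hB : 2 * (CL * T / B%:R) <= eta.
  have /ltW : 2 * (CL * T) / eta < B%:R by exact: truncnS_gt.
  by rewrite ler_pdivrMr// => h; rewrite mulrA ler_pdivrMr// [eta * _]mulrC.
have hH : 2 * V / H%:R <= eta.
  have /ltW : 2 * V / eta < H%:R by exact: truncnS_gt.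
  by rewrite ler_pdivrMr// => h; rewrite ler_pdivrMr// [eta * _]mulrC.
pose Q b c i j := `|d i (b.+1%:R * T / B%:R) (c%:R / H%:R) -
    d j (b.+1%:R * T / B%:R) (c%:R / H%:R)| <= eta.
have [A UA HA] : exists2 A, U A & forall i j b, (b < B)%N -> A i -> A j ->
    forall c, (c < H)%N -> Q b c i j.
  apply: (ultra_finite UU (Q := fun b i j => forall c, (c < H)%N -> Q b c i j)) => b bB.
  have [|A UA HA] := @ultra_finite U UU H (Q b); last first.
    by exists A => // i j Ai Aj c cH; exact: HA.
  move=> c cH; apply: (ultra_close UU (C := rhomax) eta0 UG) => j Gj.
  have sT : 0 < b.+1%:R * T / B%:R <= T.
    rewrite divr_gt0 ?mulr_gt0// ler_pdivrMr// mulrC ler_pM2l// ler_nat bB.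
    by [].
  have c01 : 0 <= (c%:R / H%:R : R) < 1.
    by rewrite divr_ge0//= ltr_pdivrMr// mul1r ltr_nat.
  have := density_range T_gt0 (m_gt0 Gj) (Hflow Gj) sT c01.
  by have := delta_gt0; rewrite -/(d j); lra.
exists (A `&` G); first exact: filterI.
move=> i j [Ai Gi] [Aj Gj].
pose F p := `|cut_density i p - cut_density j p|.
have mF : measurable_fun [set: R * R] F.
  apply: measurableT_comp => //.
  by apply: measurable_funB; exact: cut_density_measurable.
have F0 p : 0 <= F p by exact: normr_ge0.
have main t : 0 < t < T -> (\int[@lebesgue_measure R]_(y in `]0%R, 1%R[) (F (t, y))%:E <=
    (3 * eta)%:E)%E.
  move=> tT; apply: (@le_trans _ _ (L1dist (d i t) (d j t))).
    rewrite le_eqVlt; apply/orP; left; apply/eqP; apply: eq_integral => y /set_mem y01.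
    by rewrite /F /cut_density /= indicE mem_set// !mulr1.
  apply: (le_trans (density_L1dist Gi Gj tT (ltW eta0) (ltn0Sn _) (ltn0Sn _)
    (fun b bB c cH => HA i j b bB Ai Aj c cH))).
  rewrite lee_fin -/B -/H; lra.
apply: (le_trans (integral_domain_le T_gt0 mF F0 main)).
rewrite lee_fin /eta; have -> : 3 * (e / (3 * T)) * T = e by field; rewrite gt_eqF.
by [].
Qed.

End Cauchy.

(** * Test functions *)

Section Partials.
Context {R : realType}.
Implicit Types (f : R * R -> R) (t x : R).

Lemma is_derive_fst f t x : derivable f (t, x) (dir_t R) ->
  is_derive t 1 (fun s => f (s, x)) ('D_(dir_t R) f (t, x)).
Proof.
have E : (fun h : R => h^-1 *: (((fun s => f (s, x)) \o shift t) (h *: 1) - f (t, x))) =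
    (fun h : R => h^-1 *: ((f \o shift (t, x)) (h *: dir_t R) - f (t, x))).
  apply/funext => h; rewrite /= /shift.
  by rewrite -[h *: dir_t R + (t, x)]/(h * 1 + t, h * 0 + x) mulr0 add0r.
move=> df; split; first by rewrite /derivable E.
by rewrite /derive E.
Qed.

Lemma is_derive_snd f t x : derivable f (t, x) (dir_x R) ->
  is_derive x 1 (fun y => f (t, y)) ('D_(dir_x R) f (t, x)).
Proof.
have E : (fun h : R => h^-1 *: (((fun y => f (t, y)) \o shift x) (h *: 1) - f (t, x))) =
    (fun h : R => h^-1 *: ((f \o shift (t, x)) (h *: dir_x R) - f (t, x))).
  apply/funext => h; rewrite /= /shift.
  by rewrite -[h *: dir_x R + (t, x)]/(h * 0 + t, h * 1 + x) mulr0 add0r.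
move=> df; split; first by rewrite /derivable E.
by rewrite /derive E.
Qed.

Lemma continuous_pair_eps f t x : {for (t, x), continuous f} -> forall e, 0 < e ->
  exists2 d, 0 < d & forall s y, `|s - t| < d -> `|y - x| < d -> `|f (s, y) - f (t, x)| < e.
Proof.
move=> cf e e0; have /cvgrPdist_lt /(_ e e0) /nbhs_ballP[d /= d0 H] := cf.
exists d => // s y st yx; rewrite distrC; apply: H.
by split => /=; rewrite /ball/= distrC.
Qed.

Lemma is_derive_of_eps (f : R -> R) (df t : R) :
  (forall e, 0 < e -> exists2 d, 0 < d &
     forall h, `|h| < d -> `|f (t + h) - f t - df * h| <= e * `|h|) ->
  is_derive t 1 f df.
Proof.
move=> H.
have cv : h^-1 *: ((f \o shift t) (h *: 1) - f t) @[h --> 0^'] --> df.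
  apply/cvgrPdist_le => e e0; have [d d0 Hd] := H e e0.
  apply/nbhs_ballP; exists d => // h; rewrite /ball/= sub0r normrN => hd h0.
  rewrite /= /shift/= /GRing.scale/= mulr1 [h + t]addrC.
  have hn : 0 < `|h| by rewrite normr_gt0.
  have -> : df - h^-1 * (f (t + h) - f t) = - (f (t + h) - f t - df * h) / h by field.
  by rewrite normrM normrN normfV ler_pdivrMr// Hd.
split; first by apply/cvg_ex; exists df.
exact: cvg_lim cv.
Qed.

(** Chain rule along a curve; each variable is moved in turn and the mean value
    theorem is applied to the partial derivatives. *)
Lemma is_derive_curve f (X : R -> R) (X' t : R) :
  (forall p, derivable f p (dir_t R)) -> (forall p, derivable f p (dir_x R)) ->
  continuous ('D_(dir_t R) f) -> continuous ('D_(dir_x R) f) ->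
  is_derive t 1 X X' ->
  is_derive t 1 (fun s => f (s, X s))
    ('D_(dir_t R) f (t, X t) + X' * 'D_(dir_x R) f (t, X t)).
Proof.
move=> dt dx ct cx dX.
set ft := 'D_(dir_t R) f; set fx := 'D_(dir_x R) f.
have mvt_t s y u : exists2 c, `|c - s| <= `|u - s| & f (u, y) - f (s, y) = ft (c, y) * (u - s).
  have cf a b : {within `[a, b], continuous (fun r => f (r, y))}.
    apply: derivable_within_continuous => r _.
    by have [] := is_derive_fst (dt (r, y)).
  have D r := is_derive_fst (dt (r, y)).
  case: (leP s u) => su.
    have [c] := MVT_segment su (fun r _ => D r) (cf s u).
    rewrite in_itv/= => cI E; exists c => //.
    by rewrite !ger0_norm ?subr_ge0//; lra.
  have [c] := MVT_segment (ltW su) (fun r _ => D r) (cf u s).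
  rewrite in_itv/= => cI E; exists c.
    by rewrite distrC [`|u - s|]distrC !ger0_norm ?subr_ge0//; lra.
  have {}E : f (s, y) - f (u, y) = ft (c, y) * (s - u) by exact: E.
  by rewrite -opprB E; ring.
have mvt_x s y u : exists2 c, `|c - y| <= `|u - y| & f (s, u) - f (s, y) = fx (s, c) * (u - y).
  have cf a b : {within `[a, b], continuous (fun r => f (s, r))}.
    apply: derivable_within_continuous => r _.
    by have [] := is_derive_snd (dx (s, r)).
  have D r := is_derive_snd (dx (s, r)).
  case: (leP y u) => yu.
    have [c] := MVT_segment yu (fun r _ => D r) (cf y u).
    rewrite in_itv/= => cI E; exists c => //.
    by rewrite !ger0_norm ?subr_ge0//; lra.
  have [c] := MVT_segment (ltW yu) (fun r _ => D r) (cf u y).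
  rewrite in_itv/= => cI E; exists c.
    by rewrite distrC [`|u - y|]distrC !ger0_norm ?subr_ge0//; lra.
  have {}E : f (s, y) - f (s, u) = fx (s, c) * (y - u) by exact: E.
  by rewrite -opprB E; ring.
change (continuous ft) in ct; change (continuous fx) in cx.
change (is_derive t 1 (fun s => f (s, X s)) (ft (t, X t) + X' * fx (t, X t))).
clearbody ft fx.
apply: is_derive_of_eps => e e0.
pose A := `|X'| + 1 + `|fx (t, X t)|.
have A0 : 0 < A by rewrite /A; have := normr_ge0 X'; have := normr_ge0 (fx (t, X t)); lra.
pose e1 := Num.min 1 (e / (1 + 2 * A)).
have den0 : 0 < 1 + 2 * A by lra.
have e10 : 0 < e1 by rewrite lt_min ltr01 divr_gt0.
have e11 : e1 <= 1 by rewrite ge_min lexx.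
have e1e : e1 * (1 + 2 * A) <= e by rewrite -ler_pdivlMr// ge_min lexx orbT.
have [d1 d10 H1] := continuous_pair_eps (ct (t, X t)) e10.
have [d2 d20 H2] := continuous_pair_eps (cx (t, X t)) e10.
have [d3 d30 H3] := is_derive_eps dX e10.
pose dm := Num.min d1 d2.
have dm0 : 0 < dm by rewrite lt_min d10.
exists (Num.min d3 (Num.min dm (dm / A))).
  by rewrite lt_min d30 /= lt_min dm0 divr_gt0.
move=> h; rewrite lt_min => /andP[h3]; rewrite lt_min => /andP[hm hA].
have /andP[hm1 hm2] : (`|h| < d1) && (`|h| < d2) by rewrite -lt_min.
have dX3 := H3 h h3.
have Xh : `|X (t + h) - X t| <= A * `|h|.
  have -> : X (t + h) - X t = (X (t + h) - X t - X' * h) + X' * h by ring.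
  apply: (le_trans (ler_normD _ _)); rewrite normrM.
  have := normr_ge0 (fx (t, X t)) => n1; have := normr_ge0 h => n2.
  have := ler_wpM2r n2 e11; have := mulr_ge0 n1 n2.
  rewrite /A; lra.
have Xm : `|X (t + h) - X t| < dm.
  by apply: (le_lt_trans Xh); rewrite mulrC -ltr_pdivlMr.
have [Xm1 Xm2] : `|X (t + h) - X t| < d1 /\ `|X (t + h) - X t| < d2.
  by move: Xm; rewrite lt_min => /andP.
have [c1 c1h E1] := mvt_t t (X (t + h)) (t + h).
have [c2 c2h E2] := mvt_x t (X t) (X (t + h)).
rewrite addrAC subrr add0r in c1h E1.
have F1 := H1 c1 (X (t + h)) (le_lt_trans c1h hm1) Xm1.
have F2 := H2 t c2 ltac:(by rewrite subrr normr0) (le_lt_trans c2h Xm2).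
have -> : f (t + h, X (t + h)) - f (t, X t) - (ft (t, X t) + X' * fx (t, X t)) * h =
  (ft (c1, X (t + h)) - ft (t, X t)) * h +
  (fx (t, c2) - fx (t, X t)) * (X (t + h) - X t) +
  fx (t, X t) * (X (t + h) - X t - X' * h).
  have -> : f (t + h, X (t + h)) - f (t, X t) =
    (f (t + h, X (t + h)) - f (t, X (t + h))) + (f (t, X (t + h)) - f (t, X t)) by ring.
  by rewrite E1 E2; ring.
apply: (le_trans (ler_normD _ _)); apply: (le_trans (lerD (ler_normD _ _) (lexx _))).
rewrite !normrM.
have n2 := normr_ge0 h.
have g1 : `|ft (c1, X (t + h)) - ft (t, X t)| * `|h| <= e1 * `|h|.
  by rewrite ler_wpM2r// ltW.
have g2 : `|fx (t, c2) - fx (t, X t)| * `|X (t + h) - X t| <= e1 * (A * `|h|).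
  by apply: ler_pM => //; exact: ltW.
have g3 : `|fx (t, X t)| * `|X (t + h) - X t - X' * h| <= A * (e1 * `|h|).
  apply: ler_pM => //; rewrite /A; have := normr_ge0 X'; lra.
have := ler_wpM2r n2 e1e; lra.
Qed.

End Partials.

(** A test function and its partial derivatives, extended by zero across the
    lateral boundary of [0, T] x (0, 1). *)
Record cut_test {R : realType} (T : R) (phi : R * R -> R) (ph pt px : R -> R -> R)
    (L C : R) : Prop := CutTest {
  cut_L : 0 <= L;
  cut_in : forall t x, 0 <= t <= T -> 0 < x < 1 ->
    [/\ ph t x = phi (t, x), pt t x = 'D_(dir_t R) phi (t, x) &
        px t x = 'D_(dir_x R) phi (t, x)];
  cut_out : forall t x, 0 <= t <= T -> x <= 0 \/ 1 <= x ->
    [/\ ph t x = 0, pt t x = 0 & px t x = 0];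
  cut_final : forall x, ph T x = 0;
  cut_lip : forall t x y, 0 <= t <= T ->
    [/\ `|ph t x - ph t y| <= L * `|x - y|, `|pt t x - pt t y| <= L * `|x - y| &
        `|px t x - px t y| <= L * `|x - y|];
  cut_bound : forall t x, 0 <= t <= T -> `|pt t x| <= C /\ `|px t x| <= C;
  cut_cont : forall (X : R -> R) a b, {within `[a, b], continuous X} ->
    [/\ {within `[a, b], continuous (fun s => ph s (X s))},
        {within `[a, b], continuous (fun s => pt s (X s))} &
        {within `[a, b], continuous (fun s => px s (X s))}];
  cut_derive : forall (X : R -> R) X' t, 0 < t < T -> is_derive t 1 X X' ->
    is_derive t 1 (fun s => ph s (X s)) (pt t (X t) + X' * px t (X t)) }.

Section CutTest.
Context {R : realType}.
Implicit Types (t x : R).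

Lemma eq0_limit (g : R -> R) t : {for t, continuous g} ->
  (forall d, 0 < d -> exists2 s, `|s - t| < d & g s = 0) -> g t = 0.
Proof.
move=> cg H; apply/eqP; rewrite -normr_le0; apply/ler_addgt0Pr => e e0; rewrite add0r.
have /cvgrPdist_lt /(_ e e0) /nbhs_ballP[d /= d0 Hd] := cg.
have [s st gs] := H d d0; have := Hd s; rewrite /ball/= distrC => /(_ st).
by rewrite gs subr0 => /ltW.
Qed.

Lemma is_derive_near0 (f : R -> R) (df t d : R) : is_derive t 1 f df -> 0 < d ->
  (forall s, `|s - t| < d -> f s = 0) -> df = 0.
Proof.
move=> Df d0 Hf; apply/eqP; rewrite -normr_le0; apply/ler_addgt0Pr => e e0.
rewrite add0r; have [d1 d10 H] := is_derive_eps Df e0.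
pose h := Num.min d d1 / 2.
have h0 : 0 < Num.min d d1 by rewrite lt_min d0.
have m1 : Num.min d d1 <= d by rewrite ge_min lexx.
have m2 : Num.min d d1 <= d1 by rewrite ge_min lexx orbT.
have hd : h < d by rewrite /h; lra.
have hd1 : h < d1 by rewrite /h; lra.
have hp : 0 < h by rewrite /h; lra.
have f1 : f (t + h) = 0 by apply: Hf; rewrite addrAC subrr add0r gtr0_norm.
have f2 : f t = 0 by apply: Hf; rewrite subrr normr0.
have := H h; rewrite (gtr0_norm hp) => /(_ hd1).
by rewrite f1 f2 subrr sub0r normrN normrM (gtr0_norm hp) ler_pM2r.
Qed.

Lemma is_derive_near_eq (f g : R -> R) (dg t d : R) : is_derive t 1 g dg -> 0 < d ->
  (forall s, `|s - t| < d -> f s = g s) -> is_derive t 1 f dg.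
Proof.
move=> Dg d0 fg; apply: is_derive_of_eps => e e0.
have [d1 d10 H] := is_derive_eps Dg e0.
exists (Num.min d d1); first by rewrite lt_min d0.
move=> h; rewrite lt_min => /andP[hd hd1].
have e1 : f (t + h) = g (t + h) by apply: fg; rewrite addrAC subrr add0r.
have e2 : f t = g t by apply: fg; rewrite subrr normr0.
by rewrite e1 e2; exact: H.
Qed.

Lemma is_derive_near_close (X : R -> R) (X' t e : R) : is_derive t 1 X X' -> 0 < e ->
  exists2 d, 0 < d & forall s, `|s - t| < d -> `|X s - X t| < e.
Proof.
move=> DX e0; have [d d0 H] := is_derive_eps DX ltr01.
have A0 : 0 < 1 + `|X'| by have := normr_ge0 X'; lra.
exists (Num.min d (e / (1 + `|X'|))); first by rewrite lt_min d0 divr_gt0.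
move=> s; rewrite lt_min => /andP[sd]; rewrite ltr_pdivlMr// => sA.
have E : t + (s - t) = s by ring.
have := H (s - t) sd; rewrite E => h.
have -> : X s - X t = (X s - X t - X' * (s - t)) + X' * (s - t) by ring.
apply: (le_lt_trans (ler_normD _ _)); rewrite normrM; lra.
Qed.

Variables (T : R) (phi : R * R -> R).
Hypothesis T_gt0 : 0 < T.
Hypothesis Hphi : test_function T phi.
Let ft := 'D_(dir_t R) phi.
Let fx := 'D_(dir_x R) phi.

Let phi_cont : continuous phi := (Hphi.1 [::]).1.
Let phi_dt p : derivable phi p (dir_t R) := ((Hphi.1 [::]).2 p).1.
Let phi_dx p : derivable phi p (dir_x R) := ((Hphi.1 [::]).2 p).2.
Let ft_cont : continuous ft := (Hphi.1 [:: false]).1.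
Let fx_cont : continuous fx := (Hphi.1 [:: true]).1.
Let ft_dx p : derivable ft p (dir_x R) := ((Hphi.1 [:: false]).2 p).2.
Let fx_dx p : derivable fx p (dir_x R) := ((Hphi.1 [:: true]).2 p).2.
Let ftx_cont : continuous ('D_(dir_x R) ft) := (Hphi.1 [:: true; false]).1.
Let fxx_cont : continuous ('D_(dir_x R) fx) := (Hphi.1 [:: true; true]).1.

Lemma continuous_fst_slice (g : R * R -> R) t x : continuous g ->
  {for t, continuous (fun s => g (s, x))}.
Proof.
move=> cg; apply/cvgrPdist_lt => e e0.
have [d d0 H] := continuous_pair_eps (cg (t, x)) e0.
apply/nbhs_ballP; exists d => // s; rewrite /ball/= => st.
by rewrite distrC; apply: H; rewrite ?subrr ?normr0// distrC.
Qed.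

Lemma test_strip : exists a, [/\ 0 < a, a < 2^-1 &
  forall t x, 0 <= t <= T -> 0 < x < 1 -> x < a \/ 1 - a < x ->
    [/\ phi (t, x) = 0, ft (t, x) = 0 & fx (t, x) = 0]].
Proof.
have T0 := T_gt0.
have [_ [K [cK KS phi0]]] := Hphi.
have cKx : compact (snd @` K).
  apply: continuous_compact => //; apply: continuous_subspaceT => p; exact: cvg_snd.
have clKx : closed (snd @` K) by apply: compact_closed => //; exact: norm_hausdorff.
have out b : (forall x, 0 < x < 1 -> x != b) ->
    exists2 d, 0 < d & forall x, `|x - b| < d -> ~ (snd @` K) x.
  move=> hb; have : open (~` (snd @` K)) by exact: closed_openC.
  move=> /(_ b) [] .
    move=> [[s y] Ksy /= yb]; have [_ /=] := KS _ Ksy.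
    by rewrite in_itv/= => /hb; rewrite yb eqxx.
  move=> d /= d0 H; exists d => // x xb; apply: H; rewrite /ball/= distrC; exact: xb.
have [d0 d00 H0] := out 0 (fun x h => ltac:(by rewrite gt_eqF; lra)).
have [d1 d10 H1] := out 1 (fun x h => ltac:(by rewrite lt_eqF; lra)).
pose a := Num.min 4^-1 (Num.min d0 d1).
have a0 : 0 < a by rewrite !lt_min d00 d10 andbT; lra.
have a4 : a <= 4^-1 by rewrite ge_min lexx.
have ad0 : a <= d0 by rewrite !ge_min lexx orbT.
have ad1 : a <= d1 by rewrite !ge_min lexx !orbT.
pose S x := 0 < x < 1 /\ (x < a \/ 1 - a < x).
have nK x : S x -> ~ (snd @` K) x.
  move=> [x01 [xa|xa]]; first by apply: H0; rewrite subr0 gtr0_norm; lra.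
  by apply: H1; rewrite distrC gtr0_norm; lra.
have S_open x : S x -> exists2 d, 0 < d & forall y, `|y - x| < d -> S y.
  move=> [x01 [xa|xa]].
    exists (Num.min x (a - x)); first by rewrite lt_min; lra.
    move=> y; rewrite lt_min !ltr_norml => h; split; [lra | left; lra].
  exists (Num.min (1 - x) (x - (1 - a))); first by rewrite lt_min; lra.
  move=> y; rewrite lt_min !ltr_norml => h; split; [lra | right; lra].
have phiS t x : 0 <= t < T -> S x -> phi (t, x) = 0.
  move=> t0T Sx; apply: phi0; first by split; rewrite /= in_itv/=; [|case: Sx].
  by move=> Ktx; apply: (nK x Sx); exists (t, x).
have near_T d : 0 < d -> exists2 s, `|s - T| < d & 0 < s < T.
  move=> dd; exists (T - Num.min d T / 2).
    have m1 : Num.min d T <= d by rewrite ge_min lexx.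
    have m0 : 0 < Num.min d T by rewrite lt_min dd.
    by rewrite addrAC subrr add0r normrN gtr0_norm; lra.
  have m1 : Num.min d T <= T by rewrite ge_min lexx orbT.
  have m0 : 0 < Num.min d T by rewrite lt_min dd.
  lra.
have near_0 d : 0 < d -> exists2 s, `|s - 0| < d & 0 < s < T.
  move=> dd; exists (Num.min d T / 2).
    have m1 : Num.min d T <= d by rewrite ge_min lexx.
    have m0 : 0 < Num.min d T by rewrite lt_min dd.
    by rewrite subr0 gtr0_norm; lra.
  have m1 : Num.min d T <= T by rewrite ge_min lexx orbT.
  have m0 : 0 < Num.min d T by rewrite lt_min dd.
  lra.
have phiS' t x : 0 <= t <= T -> S x -> phi (t, x) = 0.
  move=> /andP[t0 tT] Sx; have [tT'|tT'] := eqVneq t T; last first.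
    by apply: phiS => //; rewrite t0 lt_neqAle tT'.
  rewrite tT'; apply: (eq0_limit (continuous_fst_slice (t := T) (x := x) phi_cont)) => d dd.
  by have [s h1 h2] := near_T d dd; exists s => //; apply: phiS => //; lra.
have fxS t x : 0 <= t <= T -> S x -> fx (t, x) = 0.
  move=> t0T Sx; have [d dd Hd] := S_open x Sx.
  refine (is_derive_near0 (is_derive_snd (@phi_dx (t, x))) dd _) => y yx.
  by apply: phiS' => //; exact: Hd.
have ftS0 t x : 0 < t < T -> S x -> ft (t, x) = 0.
  move=> t0T Sx.
  have dd : 0 < Num.min t (T - t) by rewrite lt_min; lra.
  refine (is_derive_near0 (is_derive_fst (@phi_dt (t, x))) dd _) => s.
  rewrite lt_min !ltr_norml => h; apply: phiS' => //; lra.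
have ftS t x : 0 <= t <= T -> S x -> ft (t, x) = 0.
  move=> t0T Sx.
  have [->|t0] := eqVneq t 0.
    apply: (eq0_limit (continuous_fst_slice (t := 0) (x := x) ft_cont)) => d dd.
    by have [s h1 h2] := near_0 d dd; exists s => //; exact: ftS0.
  have [->|tT] := eqVneq t T.
    apply: (eq0_limit (continuous_fst_slice (t := T) (x := x) ft_cont)) => d dd.
    by have [s h1 h2] := near_T d dd; exists s => //; exact: ftS0.
  apply: ftS0 => //; move: t0T => /andP[h1 h2].
  by rewrite !lt_neqAle h1 h2 eq_sym t0 tT.
exists a; split => //; first lra.
by move=> t x tT x01 xa; split; [exact: phiS'|exact: ftS|exact: fxS].
Qed.

Lemma continuous_rect_bounded (g : R * R -> R) : continuous g ->
  exists C, 0 <= C /\ forall t x, 0 <= t <= T -> 0 <= x <= 1 -> `|g (t, x)| <= C.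
Proof.
move=> cg.
have cK : compact (`[0, T]%classic `*` `[0, 1]%classic : set (R * R)).
  by apply: compact_setX; exact: segment_compact.
have : compact (g @` (`[0, T]%classic `*` `[0, 1]%classic)).
  by apply: continuous_compact => //; apply: continuous_subspaceT.
move=> /compact_bounded[C0 [_ HC]].
exists (`|C0| + 1); split; first by rewrite addr_ge0.
move=> t x tT x01; apply: (HC (`|C0| + 1)).
  by have := ler_norm C0; lra.
by exists (t, x) => //; split; rewrite /= in_itv.
Qed.

Lemma snd_lipschitz (g : R * R -> R) : (forall p, derivable g p (dir_x R)) ->
  continuous ('D_(dir_x R) g) -> exists L, 0 <= L /\ forall t x y, 0 <= t <= T ->
    0 <= x <= 1 -> 0 <= y <= 1 -> `|g (t, x) - g (t, y)| <= L * `|x - y|.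
Proof.
move=> dg cg; have [L [L0 HL]] := continuous_rect_bounded cg.
exists L; split => // t.
have D r := is_derive_snd (dg (t, r)).
have main x y : 0 <= t <= T -> 0 <= x -> x <= y -> y <= 1 ->
    `|g (t, y) - g (t, x)| <= L * `|y - x|.
  move=> tT x0 xy y1.
  have cf : {within `[x, y], continuous (fun r => g (t, r))}.
    by apply: derivable_within_continuous => r _; have [] := D r.
  have [c] := MVT_segment xy (fun r _ => D r) cf; rewrite in_itv/= => cxy ->.
  by rewrite normrM ler_wpM2r// HL//; lra.
move=> x y tT /andP[x0 x1] /andP[y0 y1]; case: (leP x y) => xy.
  by rewrite distrC [`|x - y|]distrC; exact: main.
exact: main (ltW xy) _.
Qed.

Lemma test_cut : exists ph pt px L C, cut_test T phi ph pt px L C.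
Proof.
have [a [a0 a2 strip]] := test_strip.
have [L1 [L10 HL1]] := snd_lipschitz phi_dx fx_cont.
have [L2 [L20 HL2]] := snd_lipschitz ft_dx ftx_cont.
have [L3 [L30 HL3]] := snd_lipschitz fx_dx fxx_cont.
have [C1 [C10 HC1]] := continuous_rect_bounded ft_cont.
have [C2 [C20 HC2]] := continuous_rect_bounded fx_cont.
pose c x := Num.max (a / 2) (Num.min x (1 - a / 2)).
have c01 x : a / 2 <= c x <= 1 - a / 2.
  by rewrite /c le_max lexx/= ge_max ge_min lexx orbT andbT; lra.
have c_in x : a / 2 <= x <= 1 - a / 2 -> c x = x.
  by move=> /andP[h1 h2]; rewrite /c (min_idPl h2) (max_idPr h1).
have c_low x : x <= a / 2 -> c x = a / 2.
  move=> h; rewrite /c (min_idPl _) ?(max_idPl _)//; lra.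
have c_high x : 1 - a / 2 <= x -> c x = 1 - a / 2.
  move=> h; rewrite /c (min_idPr _) ?(max_idPr _)//; lra.
have c_lip x y : `|c x - c y| <= `|x - y|.
  have main u u' : u <= u' -> `|c u - c u'| <= `|u - u'|.
    move=> uu'; rewrite [leRHS]distrC [leRHS]ger0_norm ?subr_ge0// ler_norml.
    case: (leP u (a / 2)) => h1; first rewrite (c_low u)//.
      case: (leP u' (a / 2)) => h2; first by rewrite c_low//; lra.
      case: (leP u' (1 - a / 2)) => h3; first by rewrite c_in; lra.
      by rewrite c_high; lra.
    case: (leP u (1 - a / 2)) => h2; last by rewrite !c_high; lra.
    rewrite (c_in u); last lra.
    case: (leP u' (1 - a / 2)) => h3; first by rewrite c_in; lra.
    by rewrite c_high; lra.
  case: (leP x y) => xy; first exact: main.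
  by rewrite distrC [leRHS]distrC main// ltW.
have cc01 x : 0 <= c x <= 1 by have := c01 x; lra.
have strip_c t x : 0 <= t <= T -> x < a \/ 1 - a < x ->
    [/\ phi (t, c x) = 0, ft (t, c x) = 0 & fx (t, c x) = 0].
  move=> tT xa; apply: strip => //; first by have := c01 x; lra.
  case: xa => h; [left|right].
    by case: (leP x (a / 2)) => h'; [rewrite c_low//; lra | rewrite c_in; lra].
  by case: (leP (1 - a / 2) x) => h'; [rewrite c_high//; lra | rewrite c_in; lra].
have in_c t x : 0 <= t <= T -> 0 < x < 1 ->
    [/\ phi (t, c x) = phi (t, x), ft (t, c x) = ft (t, x) & fx (t, c x) = fx (t, x)].
  move=> tT x01; case: (boolP ((x < a) || (1 - a < x))) => [/orP h|].
    by have [-> -> ->] := strip_c t x tT h; have [-> -> ->] := strip t x tT x01 h.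
  by rewrite negb_or -!leNgt => h; rewrite c_in//; lra.
have cont_c (q : R * R -> R) (X : R -> R) u u' : continuous q ->
    {within `[u, u'], continuous X} -> {within `[u, u'], continuous (fun s => q (s, c (X s)))}.
  move=> cq /within_itv_epsP cX; apply/within_itv_epsP => s su e e0.
  have [d d0 Hd] := continuous_pair_eps (cq (s, c (X s))) e0.
  have [d' d'0 Hd'] := cX s su d d0.
  exists (Num.min d d'); first by rewrite lt_min d0.
  move=> s' su'; rewrite lt_min => /andP[h1 h2]; apply: Hd => //.
  by apply: (le_lt_trans (c_lip _ _)); exact: Hd'.
pose L := L1 + L2 + L3.
exists (fun t x => phi (t, c x)), (fun t x => ft (t, c x)), (fun t x => fx (t, c x)),
  L, (C1 + C2); split.
- by rewrite /L; lra.
- exact: in_c.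
- by move=> t x tT x01; apply: strip_c => //; case: x01 => h; [left|right]; lra.
- move=> x; have T0 := T_gt0; have [_ [K [cK KS phi0]]] := Hphi.
  have clK : closed K by apply: compact_closed => //; exact: norm_hausdorff.
  have /nbhs_ballP[r /= r0 Hr] : nbhs (T, c x) (~` K).
    apply: open_nbhs_nbhs; split; first exact: closed_openC.
    by move=> /KS[/=]; rewrite in_itv/= ltxx andbF.
  apply: (eq0_limit (continuous_fst_slice (t := T) (x := c x) phi_cont)) => d dd.
  pose e := Num.min d (Num.min r T).
  have e0 : 0 < e by rewrite lt_min dd lt_min r0.
  have ed : e <= d by rewrite ge_min lexx.
  have er : e <= r by rewrite !ge_min lexx orbT.
  have eT : e <= T by rewrite !ge_min lexx !orbT.
  have nrm : `|T - e / 2 - T| = e / 2 by rewrite addrAC subrr add0r normrN gtr0_norm; lra.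
  exists (T - e / 2); first by rewrite nrm; lra.
  apply: phi0; first by split; rewrite /= in_itv/=; have := c01 x; lra.
  by apply: Hr; split; rewrite /ball/= ?subrr ?normr0// distrC nrm; lra.
- move=> t x y tT; have cl := c_lip x y.
  have Lx (L' : R) : 0 <= L' -> L' <= L -> L' * `|c x - c y| <= L * `|x - y|.
    by move=> h1 h2; apply: ler_pM.
  split; [apply: (le_trans (HL1 _ _ _ _ _ _))|apply: (le_trans (HL2 _ _ _ _ _ _))|
    apply: (le_trans (HL3 _ _ _ _ _ _))] => //; apply: Lx => //; rewrite /L; lra.
- move=> t x tT; split.
    by apply: (le_trans (HC1 _ _ tT (cc01 x))); lra.
  by apply: (le_trans (HC2 _ _ tT (cc01 x))); lra.
- move=> X u u' cX; split.
  + exact: (cont_c phi X u u' phi_cont cX).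
  + exact: (cont_c ft X u u' ft_cont cX).
  + exact: (cont_c fx X u u' fx_cont cX).
- move=> X X' t tT dX.
  have locally_zero (S : R -> Prop) : (forall y, S y -> y < a \/ 1 - a < y) -> S (X t) ->
      (exists2 e, 0 < e & forall y, `|y - X t| < e -> S y) ->
      is_derive t 1 (fun s => phi (s, c (X s))) (ft (t, c (X t)) + X' * fx (t, c (X t))).
    move=> Sa SX [e e0 He].
    have [_ -> ->] := strip_c t (X t) ltac:(lra) (Sa _ SX).
    rewrite mulr0 addr0; have [d d0 Hd] := is_derive_near_close dX e0.
    have tm : 0 < Num.min d (Num.min t (T - t)) by rewrite !lt_min d0; lra.
    apply: (is_derive_near_eq (is_derive_cst (0 : R) t 1) tm) => s.
    rewrite !lt_min !ltr_norml => h.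
    have st : `|s - t| < d by rewrite ltr_norml; lra.
    by have [-> _ _] := strip_c s (X s) ltac:(lra) (Sa _ (He _ (Hd s st))).
  case: (ltP (X t) a) => Xa.
    apply: (locally_zero (fun y => y < a)) => // [y ya|]; first by left.
    by exists (a - X t); [lra | move=> y; rewrite ltr_norml; lra].
  case: (ltP (1 - a) (X t)) => Xa'.
    apply: (locally_zero (fun y => 1 - a < y)) => // [y ya|]; first by right.
    by exists (X t - (1 - a)); [lra | move=> y; rewrite ltr_norml; lra].
  have a4 : 0 < a / 2 by lra.
  have [d d0 Hd] := is_derive_near_close dX a4.
  rewrite c_in; last lra.
  apply: (is_derive_near_eq (is_derive_curve phi_dt phi_dx ft_cont fx_cont dX) d0) => s /Hd.
  by rewrite ltr_norml => h; rewrite c_in//; lra.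
Qed.


End CutTest.

(** * The weak formulation *)

Section ParticleSums.
Context {R : realType}.
Notation mu := (@lebesgue_measure R).
Variables (T : R) (m M : nat) (delta rhomax vmax l V K : R).
Variables (v : R -> R) (w : nat -> R) (z : nat -> nat -> R -> R).
Variables (phi : R * R -> R) (ph pt px : R -> R -> R) (L C : R).
Hypothesis T_gt0 : 0 < T.
Hypothesis m_gt0 : (0 < m)%N.
Hypothesis delta_gt0 : 0 < delta.
Hypothesis v_lip : forall a b, 0 <= a <= rhomax -> 0 <= b <= rhomax ->
  `|v a - v b| <= K * `|a - b|.
Hypothesis Hflow : flow T m M delta rhomax vmax l V v w z.
Hypothesis Hcut : cut_test T phi ph pt px L C.
Let tg := tgrid T m.

Definition Bsum k t := \sum_(p < M) w p * ph t (z k p t).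
Definition bsum k t := \sum_(p < M)
  w p * (pt t (z k p t) + v (dens w (z k) p t) * px t (z k p t)).

Lemma tgrid_in k t : (k < m)%N -> tg k <= t <= tg k.+1 -> 0 <= t <= T.
Proof.
move=> km /andP[kt tk]; apply/andP; split.
  by apply: le_trans kt; rewrite /tg /tgrid mulr_ge0// divr_ge0// ltW.
apply: (le_trans tk); rewrite /tg /tgrid mulrA ler_pdivrMr ?ltr0n//.
by rewrite mulrC ler_pM2l// ler_nat.
Qed.

Lemma tgrid_lt k : tg k < tg k.+1.
Proof. by rewrite /tg /tgrid ltr_pM2r ?ltr_nat// divr_gt0// ltr0n. Qed.

Lemma v_dens_cont k p : (k < m)%N -> (p < M)%N ->
  {within `[tg k, tg k.+1], continuous (fun s => v (dens w (z k) p s))}.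
Proof.
move=> km pM.
have /within_itv_epsP cd := flow_dens_cont Hflow km pM.
have K0 : 0 < `|K| + 1 by have := normr_ge0 K; lra.
apply/within_itv_epsP => t tk e e0.
have [d d0 H] := cd t tk (e / (`|K| + 1)) ltac:(by rewrite divr_gt0).
exists d => // u uk ut.
have [_ r1] := flow_gap Hflow km pM tk; have [_ r2] := flow_gap Hflow km pM uk.
have dg := delta_gt0.
have := H u uk ut; rewrite ltr_pdivlMr// => h.
have h1 : `|v (dens w (z k) p u) - v (dens w (z k) p t)| <=
    K * `|dens w (z k) p u - dens w (z k) p t| by apply: v_lip; lra.
apply: (le_lt_trans h1); apply: le_lt_trans h; rewrite mulrC ler_wpM2l//.
by have := ler_norm K; lra.
Qed.

Lemma bsum_cont k : (k < m)%N -> {within `[tg k, tg k.+1], continuous (bsum k)}.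
Proof.
move=> km; apply: (@within_continuous_sum R M (fun p t =>
  w p * (pt t (z k p t) + v (dens w (z k) p t) * px t (z k p t)))) => p pM x.
have [_ c2 c3] := cut_cont Hcut (flow_cont Hflow km (ltnW pM)).
apply: (@cvgM R _ _ _ (fun=> w p)); first exact: cvg_cst.
by apply: (@cvgD _ R^o); [exact: c2 | apply: cvgM; [exact: v_dens_cont | exact: c3]].
Qed.

Lemma Bsum_cont k : (k < m)%N -> {within `[tg k, tg k.+1], continuous (Bsum k)}.
Proof.
move=> km; apply: (@within_continuous_sum R M (fun p t => w p * ph t (z k p t))) => p pM x.
have [c1 _ _] := cut_cont Hcut (flow_cont Hflow km (ltnW pM)).
by apply: (@cvgM R _ _ _ (fun=> w p)); [exact: cvg_cst | exact: c1].
Qed.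

Lemma Bsum_derive k t : (k < m)%N -> tg k < t < tg k.+1 ->
  is_derive t 1 (Bsum k) (bsum k t).
Proof.
move=> km kt.
have kt' : tg k <= t <= tg k.+1 by lra.
have tT : 0 < t < T.
  have := tgrid_in km kt'; have k1 := tgrid_in km (t := tg k.+1).
  have := k1; rewrite lexx ltW ?tgrid_lt// => /(_ isT).
  have k0 := tgrid_in km (t := tg k).
  have := k0; rewrite lexx ltW ?tgrid_lt// => /(_ isT); lra.
apply: (@is_derive_lincomb R M w (fun p s => ph s (z k p s))
  (fun p => pt t (z k p t) + v (dens w (z k) p t) * px t (z k p t)) t) => p pM.
apply: (cut_derive Hcut tT); exact: (flow_derive Hflow km pM).
Qed.

Lemma bsum_integrable k : (k < m)%N ->
  mu.-integrable `]tg k, tg k.+1[ (EFin \o bsum k).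
Proof.
move=> km; apply: (@integrableS _ _ _ mu `[tg k, tg k.+1]) => //.
  by move=> t /=; rewrite !in_itv/= => /andP[/ltW -> /ltW ->].
apply: continuous_compact_integrable; first exact: segment_compact.
exact: bsum_cont.
Qed.

Lemma bsum_FTC k : (k < m)%N ->
  \int[mu]_(t in `]tg k, tg k.+1[) bsum k t = Bsum k (tg k.+1) - Bsum k (tg k).
Proof.
move=> km; have lt := tgrid_lt k.
have [_ cr cl] := (continuous_within_itvP (Bsum k) lt).1 (Bsum_cont km).
have dB : derivable_oo_LRcontinuous (Bsum k) (tg k) (tg k.+1).
  split => // t; rewrite in_itv/= => kt.
  by have [] := Bsum_derive km kt.
have dB' : {in `]tg k, tg k.+1[, derive1 (Bsum k) =1 bsum k}.
  by move=> t; rewrite in_itv/= derive1E => kt; have [_ ->] := Bsum_derive km kt.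
have E := continuous_FTC2 lt (bsum_cont km) dB dB'.
rewrite /Rintegral -[RHS]/(fine ((Bsum k (tg k.+1))%:E - (Bsum k (tg k))%:E)%E) -E.
congr fine.
refine (esym (@integral_itv_bndoo R _ _ (EFin \o bsum k) true false _)).
exact: (measurable_int mu (bsum_integrable km)).
Qed.

End ParticleSums.

Section Sampling.
Context {R : realType}.
Notation mu := (@lebesgue_measure R).

Lemma lipschitz_continuous (g : R -> R) (L : R) :
  (forall x y, `|g x - g y| <= L * `|x - y|) -> continuous g.
Proof.
move=> gL x.
apply/cvgrPdist_lt => e e0; apply/nbhs_ballP.
have L0 : 0 < `|L| + 1 by have := normr_ge0 L; lra.
exists (e / (`|L| + 1)) => /=; first by rewrite divr_gt0.
move=> y; rewrite /ball/= ltr_pdivlMr// => h; apply: (le_lt_trans (gL x y)).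
by apply: le_lt_trans h; rewrite mulrC ler_wpM2l//; have := ler_norm L; lra.
Qed.

Lemma lipschitz_measurable (g : R -> R) (L : R) (D : set R) :
  (forall x y, `|g x - g y| <= L * `|x - y|) -> measurable_fun D g.
Proof.
move=> /lipschitz_continuous gL; apply: measurable_funTS.
exact: continuous_measurable_fun.
Qed.

Lemma itv_oo_integrableB (f g : R -> R) (a b : R) :
  mu.-integrable `]a, b[ (EFin \o f) -> mu.-integrable `]a, b[ (EFin \o g) ->
  mu.-integrable `]a, b[ (EFin \o (fun t => f t - g t)).
Proof.
move=> intf intg.
have := @integrableB _ _ R mu `]a, b[%classic (measurable_itv _) _ _ intf intg.
by apply: eq_integrable => // y _ /=; rewrite EFinB.
Qed.

Lemma Rintegral_oo_support (f : R -> R) (a b : R) : a <= 0 -> 1 <= b ->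
  mu.-integrable `]a, b[ (EFin \o f) -> (forall y, y <= 0 \/ 1 <= y -> f y = 0) ->
  \int[mu]_(y in `]0, 1[) f y = \int[mu]_(y in `]a, b[) f y.
Proof.
move=> a0 b1 int f0.
have b0 : 0 <= b by lra.
rewrite (Rintegral_oo_split a0 b0 int).
have int' : mu.-integrable `]0, b[ (EFin \o f).
  apply: integrableS int => // y /=; rewrite !in_itv/= => /andP[y0 ->].
  by rewrite (le_lt_trans a0).
rewrite (Rintegral_oo_split (@ler01 R) b1 int').
have z1 : \int[mu]_(y in `]a, 0[) f y = 0.
  rewrite /Rintegral integral0_eq// => y /=; rewrite in_itv/= => /andP[_ /ltW y0].
  by rewrite f0//; left.
have z2 : \int[mu]_(y in `]1, b[) f y = 0.
  rewrite /Rintegral integral0_eq// => y /=; rewrite in_itv/= => /andP[/ltW y0 _].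
  by rewrite f0//; right.
by rewrite z1 z2 add0r addr0.
Qed.

Lemma step_fun_test (M : nat) (z r : nat -> R) (g : R -> R) (B L : R) :
  (forall p, (p < M)%N -> z p <= z p.+1) -> z 0%N <= 0 -> 1 <= z M ->
  (forall p, (p < M)%N -> `|r p| <= B) ->
  (forall x y, `|g x - g y| <= L * `|x - y|) ->
  (forall y, y <= 0 \/ 1 <= y -> g y = 0) ->
  `|\int[mu]_(y in `]0, 1[) (step_fun M z r y * g y) -
    \sum_(p < M) r p * (z p.+1 - z p) * g (z p)| <=
  \sum_(p < M) B * L * (z p.+1 - z p) ^+ 2.
Proof.
move=> zinc z0 zM rB gL g0.
have L0 : 0 <= L by have := gL 0 1; have := normr_ge0 (g 0 - g 1); rewrite sub0r normrN normr1; lra.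
have gb y : `|g y| <= L.
  have g00 := g0 0 ltac:(by left).
  case: (leP y 0) => y0; first by rewrite g0 ?normr0//; left.
  case: (leP 1 y) => y1; first by rewrite g0 ?normr0//; right.
  have := gL y 0; rewrite g00 !subr0 (gtr0_norm y0) => /le_trans; apply.
  by rewrite -[leRHS]mulr1 ler_wpM2l// ltW.
have zle i j : (i <= j)%N -> (j <= M)%N -> z i <= z j.
  elim: j => [|j IH]; first by rewrite leqn0 => /eqP ->.
  rewrite leq_eqVlt => /orP[/eqP->//|]; rewrite ltnS => ij jM.
  by apply: (le_trans (IH ij (ltnW jM))); exact: zinc.
pose f y := step_fun M z r y * g y.
have mf D' : measurable_fun D' f.
  by apply: measurable_funM; [exact: step_fun_measurable | exact: lipschitz_measurable gL].
have fcell p y : (p < M)%N -> z p <= y < z p.+1 -> f y = r p * g y.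
  by move=> pM yp; rewrite /f (step_fun_cell _ zinc pM yp).
have int : mu.-integrable `]z 0%N, z M[ (EFin \o f).
  apply: (@itv_oo_integrable _ _ (`|B| * L)) => // y /andP[y0 /(cell_exists (ltW y0))[p pM yp]].
  rewrite (fcell p)// normrM ler_pM//; apply: le_trans (ler_norm B); exact: rB.
rewrite (@Rintegral_oo_support f (z 0%N) (z M))//; last first.
  by move=> y y01; rewrite /f g0// mulr0.
suff H P : (P <= M)%N -> `|\int[mu]_(y in `]z 0%N, z P[) f y -
    \sum_(p < P) r p * (z p.+1 - z p) * g (z p)| <=
    \sum_(p < P) B * L * (z p.+1 - z p) ^+ 2 by exact: H.
elim: P => [_|P IH PM].
  by rewrite !big_ord0 subr0 set_itv_ge ?bnd_simp ?ltxx// Rintegral_set0 normr0.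
have zP := zinc P PM.
have intS a b : z 0%N <= a -> b <= z M -> mu.-integrable `]a, b[ (EFin \o f).
  move=> a0 bM; apply: integrableS int => // y /=; rewrite !in_itv/= => /andP[ya yb].
  by rewrite (le_lt_trans a0 ya) (lt_le_trans yb bM).
rewrite (Rintegral_oo_split (zle 0%N P (leq0n P) (ltnW PM)) zP);
  last exact: (intS _ _ (lexx _) (zle _ _ PM (leqnn M))).
rewrite !big_ord_recr/=.
have : `|\int[mu]_(y in `]z P, z P.+1[) f y - r P * (z P.+1 - z P) * g (z P)| <=
   B * L * (z P.+1 - z P) ^+ 2; last first.
  move: (IH (ltnW PM)); set a := Rintegral _ _ _; set b := Rintegral _ _ _.
  by rewrite !ler_norml; lra.
pose e := B * L * (z P.+1 - z P).
have bd : {ae mu, forall y, z P < y < z P.+1 ->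
    r P * g (z P) - e <= f y <= r P * g (z P) + e}.
  apply: aeW => y /andP[y0 y1]; rewrite (fcell P)//; last by rewrite (ltW y0).
  rewrite -ler_distl -mulrBr normrM /e -mulrA ler_pM//; first exact: rB.
  apply: (le_trans (gL _ _)); rewrite ler_wpM2l// gtr0_norm ?subr_gt0//; lra.
have := Rintegral_oo_bounds zP (mf _) bd
  (intS _ _ (zle 0%N P (leq0n P) (ltnW PM)) (zle _ _ PM (leqnn M))).
by rewrite /e ler_norml expr2; set I := Rintegral _ _ _; nra.
Qed.

End Sampling.

Section PlaneMeasure.
Context {R : realType}.
Notation mu := (@lebesgue_measure R).

Lemma open_plane_measurable (U : set (R * R)) : open U -> measurable U.
Proof.
move=> oU.
pose B (a b c : rat) : set (R * R) :=
  [set x : R | `|x - ratr a| < ratr c] `*` [set y : R | `|y - ratr b| < ratr c].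
have mB1 (a c : rat) : measurable [set x : R | `|x - ratr a| < ratr c].
  rewrite (_ : [set _ | _] = `]ratr a - ratr c, ratr a + ratr c[%classic)//.
  by apply/seteqP; split => x /=; rewrite in_itv/= ltr_distl.
pose B' a b c := if `[< B a b c `<=` U >] then B a b c else set0.
have -> : U = \bigcup_(a : rat) \bigcup_(b : rat) \bigcup_(c : rat) B' a b c.
  apply/seteqP; split => [[x y] Uxy|p]; last first.
    move=> [a _ [b _ [c _]]]; move: p.
    by rewrite /B'; case: ifPn => // /asboolP BU; exact: BU.
  have [e /= e0 He] : exists2 e : R, 0 < e & forall u w,
      `|u - x| < e -> `|w - y| < e -> U (u, w).
    have /nbhs_ballP[e /= e0 He] := oU _ Uxy.
    by exists e => // u w ux wy; apply: He; split; rewrite /ball/= distrC.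
  have e4 : 0 < e / 4 by rewrite divr_gt0.
  have [a Ha] : exists a : rat, x - e / 4 < ratr a < x + e / 4.
    have [a] := @rat_in_itvoo R (x - e / 4) (x + e / 4) ltac:(lra).
    by rewrite in_itv/= => Ha; exists a.
  have [b Hb] : exists b : rat, y - e / 4 < ratr b < y + e / 4.
    have [b] := @rat_in_itvoo R (y - e / 4) (y + e / 4) ltac:(lra).
    by rewrite in_itv/= => Hb; exists b.
  have [c Hc] : exists c : rat, e / 4 < ratr c < e / 2.
    have [c] := @rat_in_itvoo R (e / 4) (e / 2) ltac:(lra).
    by rewrite in_itv/= => Hc; exists c.
  exists a => //; exists b => //; exists c => //.
  have BU : B a b c `<=` U.
    move=> [u w] /= [hu hw]; rewrite /= in hu hw; apply: He.
      by move: hu; rewrite !ltr_distl; lra.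
    by move: hw; rewrite !ltr_distl; lra.
  have -> : B' a b c = B a b c by rewrite /B' asboolT.
  by split; rewrite /= ltr_distl; lra.
apply: bigcupT_measurable_rat => a; apply: bigcupT_measurable_rat => b.
apply: bigcupT_measurable_rat => c; rewrite /B'; case: ifP => // _.
by apply: measurableX; exact: mB1.
Qed.

Lemma continuous_plane_measurable (g : R * R -> R) : continuous g ->
  measurable_fun [set: R * R] g.
Proof.
move=> cg; apply: (measurability _ (RGenOpens.measurableE R)).
move=> _ [_ [a [b ->] <-]]; rewrite setTI; apply: open_plane_measurable.
by have := (@continuousP _ _ g).1 cg; apply; exact: interval_open.
Qed.

Variable T : R.
Hypothesis T_gt0 : 0 < T.

Lemma integral_domain_iterated (F : R * R -> R) (C : R) :
  measurable_fun [set: R * R] F -> (forall p, domain T p -> `|F p| <= C) ->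
  let Inn t := \int[mu]_(y in `]0, 1[) F (t, y) in
  mu.-integrable `]0, T[ (EFin \o Inn) /\
  \int[leb2 R]_(p in domain T) F p = \int[mu]_(t in `]0, T[) Inn t.
Proof.
move=> mF FC Inn.
pose G := (EFin \o F) \_ (domain T).
have iF : (leb2 R).-integrable (domain T) (EFin \o F).
  refine (@bounded_integrable _ _ R (leb2 R) (domain T)
    (domain_measurable T) (domain_finite T_gt0) F C _ FC).
  exact: measurable_funTS.
have iG : (leb2 R).-integrable [set: R * R] G.
  refine ((@integrable_mkcond _ _ R (leb2 R) (domain T) (EFin \o F) (domain_measurable T)).1 iF).
have GE t : fubini_F mu G t = ((EFin \o Inn) \_ (`]0, T[%classic : set R)) t.
  rewrite /fubini_F patchE; case: ifPn => tT; last first.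
    apply: integral0_eq => y _; rewrite /G patchE; case: ifPn => // /set_mem[/= h _].
    by move: tT; rewrite mem_set.
  have -> : (\int[mu]_y G (t, y) = \int[mu]_(y in `]0%R, 1%R[) (F (t, y))%:E)%E.
    rewrite [RHS]integral_mkcond; apply: eq_integral => y _.
    rewrite /G !patchE; congr (if _ then _ else _).
    apply/idP/idP => [/set_mem[_ /= h]|/set_mem h]; first by rewrite mem_set.
    by rewrite mem_set//; split => //; exact: set_mem tT.
  rewrite /= /Inn /Rintegral fineK//; apply: integrable_fin_num => //.
  apply: (@itv_oo_integrable _ (fun y => F (t, y)) C).
    apply: measurable_funTS; apply: (measurableT_comp mF).
    by apply: measurable_fun_pair.
  move=> y y01; apply: FC; split => /=; last by rewrite in_itv.
  exact: set_mem tT.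
have GF : fubini_F mu G = (EFin \o Inn) \_ (`]0, T[%classic : set R).
  by apply/funext => t; exact: GE.
have iI : mu.-integrable `]0, T[ (EFin \o Inn).
  refine ((@integrable_mkcond _ _ R mu `]0, T[%classic (EFin \o Inn) (measurable_itv `]0, T[)).2 _).
  rewrite -GF; exact: (@integrable_fubini_F _ _ _ _ R mu mu G iG).
split=> //.
have E1 : (\int[leb2 R]_(p in domain T) (F p)%:E = \int[leb2 R]_p G p)%E.
  refine (@integral_mkcond _ _ R (leb2 R) (domain T) (EFin \o F)).
have E2 := @integral12_prod_meas1 _ _ _ _ R mu mu G iG.
have E3 : (\int[mu]_(t in `]0%R, T[) (EFin \o Inn) t = \int[mu]_t ((EFin \o Inn) \_ `]0%R, T[) t)%E.
  exact: integral_mkcond.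
rewrite -GF E2 -E1 in E3.
exact: (congr1 fine (esym E3)).
Qed.

End PlaneMeasure.

Section WeakResidual.
Context {R : realType}.
Notation mu := (@lebesgue_measure R).
Variables (T : R) (m M : nat) (delta rhomax vmax l V K : R).
Variables (v : R -> R) (w : nat -> R) (z : nat -> nat -> R -> R).
Variables (phi : R * R -> R) (ph pt px : R -> R -> R) (L C : R).
Hypothesis T_gt0 : 0 < T.
Hypothesis m_gt0 : (0 < m)%N.
Hypothesis delta_gt0 : 0 < delta.
Hypothesis delta_le : delta <= rhomax.
Hypothesis v_lip : forall a b, 0 <= a <= rhomax -> 0 <= b <= rhomax ->
  `|v a - v b| <= K * `|a - b|.
Hypothesis v_range : forall r, 0 <= r <= rhomax -> 0 <= v r <= vmax.
Hypothesis Hflow : flow T m M delta rhomax vmax l V v w z.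
Hypothesis Hcut : cut_test T phi ph pt px L C.
Let tg := tgrid T m.
Let eps := M%:R * (rhomax * (1 + vmax) * L * (l / delta) ^+ 2).
Let bs := bsum M v w z pt px.
Let Bs := Bsum M w z ph.

Lemma inner_bsum k t : (k < m)%N -> tg k <= t <= tg k.+1 ->
  `|\int[mu]_(y in `]0, 1[) (rho M w z k t y * pt t y +
      rho M w z k t y * v (rho M w z k t y) * px t y) - bs k t| <= eps.
Proof.
move=> km kt; have tT := tgrid_in T_gt0 m_gt0 km kt.
have d0 := delta_gt0; have dm := delta_le.
pose r p := dens w (z k) p t; pose zt p := z k p t.
have zinc := flow_inc Hflow km kt.
have [z0 zM] := flow_cover Hflow km kt.
have rr p : (p < M)%N -> 0 <= r p <= rhomax.
  by move=> pM; have [_] := flow_gap Hflow km pM kt; rewrite /r; lra.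
have vr p : (p < M)%N -> 0 <= v (r p) <= vmax by move=> pM; exact: v_range (rr p pM).
have gapE p : (p < M)%N -> r p * (zt p.+1 - zt p) = w p.
  move=> pM; have [g0 _] := flow_gap Hflow km pM kt.
  by rewrite /r /dens divfK// gt_eqF.
have ptL x y : `|pt t x - pt t y| <= L * `|x - y| by have [_ ? _] := cut_lip Hcut x y tT.
have pxL x y : `|px t x - px t y| <= L * `|x - y| by have [_ _ ?] := cut_lip Hcut x y tT.
have pt0 y : y <= 0 \/ 1 <= y -> pt t y = 0 by move=> h; have [_ ? _] := cut_out Hcut tT h.
have px0 y : y <= 0 \/ 1 <= y -> px t y = 0 by move=> h; have [_ _ ?] := cut_out Hcut tT h.
have rB p : (p < M)%N -> `|r p| <= rhomax.
  by move=> pM; have := rr p pM; rewrite ler_norml; lra.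
have rvB p : (p < M)%N -> `|r p * v (r p)| <= rhomax * vmax.
  move=> pM; rewrite normrM; apply: ler_pM => //; first exact: rB.
  by have := vr p pM; rewrite ler_norml; lra.
have E1 := step_fun_test zinc z0 zM rB ptL pt0.
have E2 := step_fun_test zinc z0 zM rvB pxL px0.
have bE : bs k t = \sum_(p < M) r p * (zt p.+1 - zt p) * pt t (zt p) +
   \sum_(p < M) r p * v (r p) * (zt p.+1 - zt p) * px t (zt p).
  rewrite -big_split/=; apply: eq_bigr => p _.
  by rewrite mulrDr -(gapE p (ltn_ord p)) /r /zt; ring.
pose f1 y := step_fun M zt r y * pt t y.
pose f2 y := step_fun M zt (fun p => r p * v (r p)) y * px t y.
have i1 : mu.-integrable `]0, 1[ (EFin \o f1).
  apply: (@itv_oo_integrable _ _ (rhomax * C)).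
    by apply: measurable_funM; [exact: step_fun_measurable | exact: lipschitz_measurable ptL].
  move=> y y01; rewrite normrM; apply: ler_pM => //; last by have [] := cut_bound Hcut y tT.
  by have := rho_range Hflow km kt (y := y); rewrite /rho -/r -/zt ler_norml; lra.
have cellv y : 0 < y < 1 -> step_fun M zt (fun p => r p * v (r p)) y =
    rho M w z k t y * v (rho M w z k t y).
  move=> y01; have y0 : zt 0%N <= y by rewrite /zt; lra.
  have yM : y < zt M by rewrite /zt; lra.
  have [p pM zp] := @cell_exists R M zt y y0 yM.
  by rewrite /rho !(step_fun_cell _ zinc pM zp).
have i2 : mu.-integrable `]0, 1[ (EFin \o f2).
  apply: (@itv_oo_integrable _ _ (rhomax * vmax * C)).
    by apply: measurable_funM; [exact: step_fun_measurable | exact: lipschitz_measurable pxL].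
  move=> y y01; rewrite normrM; apply: ler_pM => //; last by have [] := cut_bound Hcut y tT.
  have := rho_range Hflow km kt (y := y); rewrite cellv// => h.
  have h1 : 0 <= rho M w z k t y <= rhomax by lra.
  have := v_range h1; rewrite normrM => h2.
  by apply: ler_pM => //; rewrite ler_norml; lra.
have -> : \int[mu]_(y in `]0, 1[) (rho M w z k t y * pt t y +
      rho M w z k t y * v (rho M w z k t y) * px t y) =
    \int[mu]_(y in `]0, 1[) f1 y + \int[mu]_(y in `]0, 1[) f2 y.
  rewrite -RintegralD//; apply: eq_Rintegral => y /set_mem /=; rewrite in_itv/= => y01.
  by rewrite /f2 cellv.
rewrite bE; apply: (@le_trans _ _ (\sum_(p < M) rhomax * L * (zt p.+1 - zt p) ^+ 2 +
   \sum_(p < M) rhomax * vmax * L * (zt p.+1 - zt p) ^+ 2)).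
  move: E1 E2; rewrite -/f1 -/f2.
  set a := Rintegral _ _ _; set b := Rintegral _ _ _.
  set c := \sum_(p < M) _; set d := \sum_(p < M) _.
  set e := \sum_(p < M) _; set g := \sum_(p < M) _.
  by rewrite !ler_norml; lra.
have Gp p : (p < M)%N -> (zt p.+1 - zt p) ^+ 2 <= (l / delta) ^+ 2.
  move=> pM; have [g0 rd] := flow_gap Hflow km pM kt; rewrite /gap in g0.
  have gl : zt p.+1 - zt p <= l / delta.
    rewrite ler_pdivlMr//; have := gapE p pM; have := flow_w Hflow p.
    by move: g0 rd; rewrite -/(zt p) -/(zt p.+1) -/(r p); nra.
  by rewrite ler_pXn2r// nnegrE; move: g0; rewrite -/(zt p) -/(zt p.+1); lra.
have L0 := cut_L Hcut; have v0 : 0 <= vmax by have := v_range (r := 0); lra.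
rewrite -big_split/= /eps mulr_natl -[X in _ *+ X]card_ord -sumr_const; apply: ler_sum => p _.
have := Gp p (ltn_ord p); have := sqr_ge0 (zt p.+1 - zt p).
set G := _ ^+ 2; set H := _ ^+ 2 => G0 GH.
rewrite -mulrDl (_ : rhomax * L + rhomax * vmax * L = rhomax * (1 + vmax) * L); last by ring.
by rewrite ler_wpM2l// !mulr_ge0//; lra.
Qed.

Lemma Bsum_rearrange k : (k.+1 < m)%N -> Bs k.+1 (tg k.+1) = Bs k (tg k.+1).
Proof.
move=> km; have tT : 0 <= tg k.+1 <= T.
  by apply: (tgrid_in T_gt0 m_gt0 (ltnW km)); rewrite lexx ltW// tgrid_lt.
have kt : tg k <= tg k.+1 <= tg k.+1 by rewrite lexx ltW// tgrid_lt.
have inc := flow_inc Hflow (ltnW km) kt.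
have [a [b [/andP[ab bM] [za zb] keep lo hi]]] := flow_rearrange Hflow km.
have zle i j : (i <= j)%N -> (j <= M)%N -> z k i (tg k.+1) <= z k j (tg k.+1).
  elim: j => [|j IH]; first by rewrite leqn0 => /eqP ->.
  rewrite leq_eqVlt => /orP[/eqP->//|]; rewrite ltnS => ij jM.
  by apply: (le_trans (IH ij (ltnW jM))); exact: inc.
apply: eq_bigr => p _; congr (_ * _); have pM := ltnW (ltn_ord p).
have ph0 y : y <= 0 \/ 1 <= y -> ph (tg k.+1) y = 0.
  by move=> h; have [? _ _] := cut_out Hcut tT h.
case: (leqP a p) => pa; last first.
  rewrite !ph0//; left; last exact: lo.
  by apply: le_trans za; apply: zle; [exact: ltnW | exact: leq_trans (ltnW ab) bM].
case: (leqP p b) => pb; first by rewrite keep// pa pb.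
rewrite !ph0//; right; last by apply: hi; rewrite pb pM.
by apply: (le_trans zb); apply: zle => //; exact: ltnW.
Qed.

Lemma weak_residual (F : R * R -> R) (B : R) : measurable_fun [set: R * R] F ->
  (forall p, domain T p -> `|F p| <= B) ->
  (forall t y, 0 < t < T -> 0 < y < 1 -> F (t, y) =
    density T m M w z t y * 'D_(dir_t R) phi (t, y) +
    density T m M w z t y * v (density T m M w z t y) * 'D_(dir_x R) phi (t, y)) ->
  `|\int[leb2 R]_(p in domain T) F p + Bs 0%N 0| <= eps * T.
Proof.
move=> mF FB FE.
pose Inn t := \int[mu]_(y in `]0, 1[) F (t, y).
have [intI ->] : mu.-integrable `]0, T[ (EFin \o Inn) /\
  \int[leb2 R]_(p in domain T) F p = \int[mu]_(t in `]0, T[) Inn t :=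
  integral_domain_iterated T_gt0 mF FB.
have tgT : tg m = T by rewrite /tg /tgrid mulrC divfK// pnatr_eq0 -lt0n.
have tle i j : (i <= j)%N -> tg i <= tg j.
  by move=> ij; rewrite /tg /tgrid ler_wpM2r ?ler_nat// divr_ge0// ltW.
have tg0 : tg 0 = 0 by rewrite /tg /tgrid mul0r.
have intS a b : 0 <= a -> b <= T -> mu.-integrable `]a, b[ (EFin \o Inn).
  move=> a0 bT; apply: integrableS intI => // y /=; rewrite !in_itv/= => /andP[ya yb].
  by rewrite (le_lt_trans a0 ya) (lt_le_trans yb bT).
have stp k : (k < m)%N -> `|\int[mu]_(t in `]tg k, tg k.+1[) Inn t -
    (Bs k (tg k.+1) - Bs k (tg k))| <= eps * (tg k.+1 - tg k).
  move=> km; have lt := tgrid_lt T_gt0 m_gt0 k.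
  have tk0 : 0 <= tg k by rewrite -tg0 tle.
  have tkT : tg k.+1 <= T by rewrite -tgT tle.
  have ib := bsum_integrable delta_gt0 v_lip Hflow Hcut km.
  have iI := intS _ _ tk0 tkT.
  have <- := bsum_FTC T_gt0 m_gt0 delta_gt0 v_lip Hflow Hcut km.
  rewrite -RintegralB//.
  have iB : mu.-integrable `]tg k, tg k.+1[ (EFin \o (fun t => Inn t - bs k t)).
    exact: itv_oo_integrableB.
  have bd : {ae mu, forall t, tg k < t < tg k.+1 -> - eps <= Inn t - bs k t <= eps}.
    apply: aeW => t kt; have kt' : tg k <= t <= tg k.+1 by lra.
    rewrite -ler_norml; apply: le_trans (inner_bsum km kt'); rewrite le_eqVlt; apply/orP; left.
    apply/eqP; congr (`|_ - _|); apply: eq_Rintegral => y /set_mem /=; rewrite in_itv/= => y01.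
    have tT : 0 < t < T by lra.
    have tT' : 0 <= t <= T by lra.
    have kt2 : tg k < t <= tg k.+1 by lra.
    have [_ -> ->] := cut_in Hcut tT' y01.
    by rewrite FE// (densityE _ _ _ T_gt0 _ km kt2).
  have mB : measurable_fun (`]tg k, tg k.+1[%classic : set R) (fun t => Inn t - bs k t).
    by apply/measurable_EFinP; exact: (measurable_int mu iB).
  have := Rintegral_oo_bounds (ltW lt) mB bd iB.
  by rewrite ler_norml mulNr.
have main k : (k <= m)%N -> `|\int[mu]_(t in `]0, tg k[) Inn t -
    (Bs k.-1 (tg k) - Bs 0%N 0)| <= eps * tg k.
  elim: k => [_|k IH km].
    by rewrite tg0 set_itv_ge ?bnd_simp ?ltxx// Rintegral_set0 subrr subr0 normr0 mulr0.
  have tk0 : 0 <= tg k by rewrite -tg0 tle.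
  have tkT : tg k.+1 <= T by rewrite -tgT tle.
  rewrite (Rintegral_oo_split tk0 (ltW (tgrid_lt T_gt0 m_gt0 k)) (intS _ _ (lexx _) tkT)).
  have BE : Bs k (tg k) = Bs k.-1 (tg k).
    by case: (k) km => // j jm; exact: Bsum_rearrange.
  move: (IH (ltnW km)) (stp k km); rewrite BE/=.
  set a := Rintegral _ _ _; set b := Rintegral _ _ _.
  by rewrite !ler_norml; lra.
have B0 : Bs m.-1 T = 0.
  by apply: big1 => p _; rewrite (cut_final Hcut) mulr0.
by have := main m (leqnn m); rewrite tgT B0 sub0r opprK.
Qed.

End WeakResidual.

Section InitialResidual.
Context {R : realType}.
Notation mu := (@lebesgue_measure R).
Variables (delta rhomax : R) (rhobar : R -> R).
Hypothesis delta_gt0 : 0 < delta.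
Hypothesis delta_le : delta <= rhomax.
Hypothesis rhobar_meas : measurable_fun (`]0, 1[%classic : set R) rhobar.
Hypothesis rhobar_range : {ae mu, forall x, 0 < x < 1 -> delta <= rhobar x <= rhomax}.
Variable n : nat.
Hypothesis n_gt0 : (0 < n)%N.
Let l := cell_mass rhobar n.

Lemma init_inner_test (g : R -> R) (L : R) :
  (forall x y, `|g x - g y| <= L * `|x - y|) ->
  `|\int[mu]_(y in `]0, 1[) (rhobar y * g y) - \sum_(i < n) l * g (init_inner rhobar n i)|
    <= n%:R * (rhomax * L * (l / delta) ^+ 2).
Proof.
move=> gL; have d0 := delta_gt0; have dm := delta_le.
have L0 : 0 <= L.
  by have := gL 0 1; have := normr_ge0 (g 0 - g 1); rewrite sub0r normrN normr1; lra.
have l0 : 0 < l := cell_mass_gt0 delta_gt0 delta_le rhobar_meas rhobar_range n_gt0.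
have ld0 : 0 < l / delta by rewrite divr_gt0.
pose c := clamp delta rhomax rhobar.
pose x i := init_inner rhobar n i.
have cell i (iN : (i < n)%N) :=
  init_inner_cell delta_gt0 delta_le rhobar_meas rhobar_range n_gt0 iN.
have crange y : delta <= c y <= rhomax by exact: clamp_range.
have mg D : measurable_fun D g by exact: lipschitz_measurable gL.
have mc (a b : R) : 0 <= a -> b <= 1 -> measurable_fun `]a, b[ c.
  by move=> a0 b1; exact: clamp_meas_sub.
have mf (a b : R) : 0 <= a -> b <= 1 -> measurable_fun `]a, b[ (fun y => c y * g y).
  by move=> a0 b1; apply: measurable_funM; [exact: mc | exact: mg].
have -> : \int[mu]_(y in `]0, 1[) (rhobar y * g y) = \int[mu]_(y in `]0, 1[) (c y * g y).
  apply: (@Rintegral_clampE R delta rhomax rhobar rhobar_range (fun y r => r * g y)) => //.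
    by apply: measurable_funM => //; exact: mg.
  by apply: mf.
have x_in i : (i <= n)%N -> 0 <= x i <= 1.
  by move=> iN; have [] := init_inner_spec delta_gt0 delta_le rhobar_meas rhobar_range n_gt0 iN.
have intf (a b : R) : 0 <= a -> b <= 1 -> mu.-integrable `]a, b[ (EFin \o (fun y => c y * g y)).
  move=> a0 b1; apply: (@itv_oo_integrable _ _ (rhomax * (`|g 0| + L))); first exact: mf.
  move=> y /andP[ay yb]; rewrite normrM; apply: ler_pM => //.
    by have := crange y; rewrite ler_norml; lra.
  have := gL y 0; rewrite subr0 => h; have := ler_normD (g y - g 0) (g 0).
  rewrite subrK => h2; apply: (le_trans h2); rewrite addrC lerD2l.
  apply: (le_trans h); rewrite -[leRHS]mulr1 ler_wpM2l// ler_norml; lra.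
suff H k : (k <= n)%N -> `|\int[mu]_(y in `]0, x k[) (c y * g y) - \sum_(i < k) l * g (x i)|
    <= k%:R * (rhomax * L * (l / delta) ^+ 2).
  have := H n (leqnn n).
  by rewrite /x (init_inner_last delta_gt0 delta_le rhobar_meas rhobar_range n_gt0).
elim: k => [_|k IH kn].
  by rewrite big_ord0 mul0r /x /= set_itv_ge ?bnd_simp ?ltxx// Rintegral_set0 subrr normr0.
have [xk0 xk1 xkk Jk /andP[_ gapk]] := cell k kn.
rewrite -/l -/(x k) -/(x k.+1) in xk0 xk1 xkk Jk gapk.
rewrite (Rintegral_oo_split xk0 xkk (intf _ _ (lexx 0) xk1)) big_ord_recr/=.
have icx : mu.-integrable `]x k, x k.+1[ (EFin \o c).
  apply: (@itv_oo_integrable _ _ rhomax); first exact: mc.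
  by move=> y _; have := crange y; rewrite ler_norml; lra.
have icg : mu.-integrable `]x k, x k.+1[ (EFin \o (fun y => c y * g (x k))).
  apply: (@itv_oo_integrable _ _ (rhomax * `|g (x k)|)).
    by apply: measurable_funM => //; exact: mc.
  by move=> y _; rewrite normrM ler_wpM2r//; have := crange y; rewrite ler_norml; lra.
have Jg : \int[mu]_(y in `]x k, x k.+1[) (c y * g (x k)) = l * g (x k).
  by rewrite RintegralZr// -Jk.
have iB : mu.-integrable `]x k, x k.+1[ (EFin \o (fun y => c y * g y - c y * g (x k))).
  by apply: itv_oo_integrableB => //; exact: intf.
have bd : {ae mu, forall y, x k < y < x k.+1 ->
    - (rhomax * (L * (l / delta))) <= c y * g y - c y * g (x k) <= rhomax * (L * (l / delta))}.
  apply: aeW => y yk; rewrite -ler_norml -mulrBr normrM; apply: ler_pM => //.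
    by have := crange y; rewrite ler_norml; lra.
  by apply: (le_trans (gL _ _)); rewrite ler_wpM2l// ler_norml; lra.
have mB : measurable_fun `]x k, x k.+1[ (fun y => c y * g y - c y * g (x k)).
  by apply/measurable_EFinP; exact: (measurable_int mu iB).
have := Rintegral_oo_bounds xkk mB bd iB.
rewrite (RintegralB _ (intf _ _ xk0 xk1) icg)// Jg; move: (IH (ltnW kn)).
set a := Rintegral _ _ _; set b := Rintegral _ _ _; set e := \sum_(i < k) _.
have : rhomax * (L * (l / delta)) * (x k.+1 - x k) <= rhomax * L * (l / delta) ^+ 2.
  rewrite expr2 [leRHS]mulrA [rhomax * (L * _)]mulrA ler_wpM2l//.
  by apply: mulr_ge0 (ltW ld0); apply: mulr_ge0 => //; lra.
by rewrite -natr1 mulrDl mul1r !ler_norml; lra.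
Qed.

Variables (T vmax : R) (v rho0 rho1 : R -> R) (m : nat) (x : nat -> int -> R -> R).
Hypothesis T_gt0 : 0 < T.
Hypothesis vmax_gt0 : 0 < vmax.
Hypothesis m_gt0 : (0 < m)%N.
Hypothesis rho0_range : forall t, 0 <= t -> delta <= rho0 t <= rhomax.
Hypothesis x_scheme : ftl_scheme T rhomax vmax v rhobar rho0 rho1 n m x.
Let N := queue_size T rhomax vmax rhobar n.

Lemma initial_residual (phi : R * R -> R) (ph pt px : R -> R -> R) (L C : R) :
  cut_test T phi ph pt px L C ->
  `|\int[mu]_(y in `]0, 1[) (rhobar y * phi (0, y)) -
     Bsum (n + N) (masses T rhomax vmax rhobar n) (particles T rhomax vmax rhobar n x) ph 0%N 0|
    <= n%:R * (rhomax * L * (l / delta) ^+ 2).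
Proof.
move=> Hcut; have T0 : 0 <= (0 : R) <= T by rewrite lexx ltW.
have gL a b : `|ph 0 a - ph 0 b| <= L * `|a - b| by have [] := cut_lip Hcut a b T0.
have := init_inner_test gL.
have -> : \int[mu]_(y in `]0, 1[) (rhobar y * ph 0 y) =
    \int[mu]_(y in `]0, 1[) (rhobar y * phi (0, y)).
  apply: eq_Rintegral => y /set_mem /=; rewrite in_itv/= => y01.
  by have [-> _ _] := cut_in Hcut T0 y01.
have l0 : 0 < l := cell_mass_gt0 delta_gt0 delta_le rhobar_meas rhobar_range n_gt0.
have r00 : 0 < rho0 0 by have := rho0_range (lexx 0); have := delta_gt0; lra.
have [N0 _] :=
  queue_sizeP T_gt0 delta_gt0 delta_le vmax_gt0 rhobar_meas rhobar_range n_gt0.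
have /andP[q0 _] :=
  last_mass_range T_gt0 delta_gt0 delta_le vmax_gt0 rhobar_meas rhobar_range n_gt0.
suff -> : Bsum (n + N) (masses T rhomax vmax rhobar n) (particles T rhomax vmax rhobar n x)
    ph 0%N 0 = \sum_(i < n) l * ph 0 (init_inner rhobar n i) by [].
have start := particles_start T_gt0 delta_gt0 delta_le vmax_gt0 rhobar_meas rhobar_range
  n_gt0 m_gt0 x_scheme.
rewrite /Bsum addnC big_split_ord/= big1 ?add0r => [|p _].
  apply: eq_bigr => p _; rewrite /masses addn_eq0 (gtn_eqF N0)/= start; last first.
    by rewrite addnC leq_add2r ltnW.
  by rewrite addn_eq0 (gtn_eqF N0)/= ltnNge leq_addr/= addKn.
have zp : particles T rhomax vmax rhobar n x 0%N p 0 <= 0.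
  rewrite start; last by rewrite (leq_trans (ltnW (ltn_ord p)))// leq_addl.
  rewrite ltn_ord; case: ifP => _; last by rewrite mulNr oppr_le0 mulr_ge0// divr_ge0// ltW.
  rewrite mulNr -opprD oppr_le0; apply: addr_ge0; last by rewrite divr_ge0// ltW.
  by rewrite mulr_ge0// divr_ge0// ltW.
by have [-> _ _] := cut_out Hcut T0 (or_introl zp); rewrite mulr0.
Qed.

End InitialResidual.

Section Extension.
Context {R : realType}.
Variables (rhomax K : R) (v : R -> R).
Hypothesis rhomax_ge0 : 0 <= rhomax.

Lemma clip_range r : 0 <= Num.max 0 (Num.min r rhomax) <= rhomax.
Proof. by rewrite le_max lexx/= ge_max rhomax_ge0 ge_min lexx orbT. Qed.

Hypothesis v_lip : forall a b, 0 <= a <= rhomax -> 0 <= b <= rhomax ->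
  `|v a - v b| <= K * `|a - b|.

Lemma vext_lipschitz a b : 0 <= K -> `|vext rhomax v a - vext rhomax v b| <= K * `|a - b|.
Proof.
move=> K0; apply: (le_trans (v_lip (clip_range a) (clip_range b))); apply: ler_wpM2l => //.
have m0 := rhomax_ge0; have n0 := normr_ge0 (a - b).
have cl c : [\/ c <= 0 /\ Num.max 0 (Num.min c rhomax) = 0,
    0 <= c <= rhomax /\ Num.max 0 (Num.min c rhomax) = c |
    rhomax <= c /\ Num.max 0 (Num.min c rhomax) = rhomax].
  case: (leP c 0) => c0.
    by apply: Or31; split => //; apply: max_idPl; rewrite ge_min c0.
  case: (leP c rhomax) => cr; last by apply: Or33; split; [exact: ltW | exact: max_idPr].
  by apply: Or32; split; [rewrite (ltW c0) | apply: max_idPr; exact: ltW].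
have := ler_norm (a - b); have := ler_norm (b - a); rewrite (distrC b a) => h1 h2.
by case: (cl a) => -[? ->]; case: (cl b) => -[? ->]; rewrite ler_norml; lra.
Qed.

End Extension.

Section SchemeResidual.
Context {R : realType}.
Notation mu := (@lebesgue_measure R).
Variables (T rhomax vmax delta K L0 L1 V1 : R) (v rhobar rho0 rho1 : R -> R).
Hypothesis T_gt0 : 0 < T.
Hypothesis delta_gt0 : 0 < delta.
Hypothesis delta_le : delta <= rhomax.
Hypothesis vmax_gt0 : 0 < vmax.
Hypothesis K_ge0 : 0 <= K.
Hypothesis v_lip : forall a b, 0 <= a <= rhomax -> 0 <= b <= rhomax ->
  `|v a - v b| <= K * `|a - b|.
Hypothesis v_range : forall r, 0 <= r <= rhomax -> 0 <= v r <= vmax.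
Hypothesis rho0_range : forall t, 0 <= t -> delta <= rho0 t <= rhomax.
Hypothesis rhobar_meas : measurable_fun (`]0, 1[%classic : set R) rhobar.
Hypothesis rhobar_range : {ae mu, forall x, 0 < x < 1 -> delta <= rhobar x <= rhomax}.

Variables (n m : nat) (x : nat -> int -> R -> R).
Hypothesis n_gt0 : (0 < n)%N.
Hypothesis m_gt0 : (0 < m)%N.
Hypothesis x_scheme : ftl_scheme T rhomax vmax v rhobar rho0 rho1 n m x.
Let l := cell_mass rhobar n.
Let N := queue_size T rhomax vmax rhobar n.
Let w := masses T rhomax vmax rhobar n.
Let z := particles T rhomax vmax rhobar n x.
Hypothesis n_large : l < T * vmax * rhomax.
Hypothesis Hflow : flow T m (n + N) delta rhomax vmax l
  (2 * rhomax + V1 + (L0 + L1) * T) v w z.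

Lemma ftl_densityE t y :
  ftl_density T rhomax vmax rhobar n m x t y = density T m (n + N) w z t y.
Proof.
rewrite /ftl_density /density -/N; apply: eq_bigr => k _.
rewrite /rho /step_fun mulr_suml; apply: eq_bigr => p _; congr (_ * _).
have e1 : p%:Z - N%:Z + 1 = p.+1%:Z - N%:Z by rewrite intS; ring.
have e2 : (p%:Z - N%:Z == - N%:Z) = (p == 0 :> nat).
  by rewrite -subr_eq0 opprK subrK eqz_nat.
by rewrite /cell_density -/N e1 e2.
Qed.

Definition flux_integrand (phi : R * R -> R) (f : R * R -> R) (p : R * R) : R :=
  f p * 'D_(dir_t R) phi p + f p * vext rhomax v (f p) * 'D_(dir_x R) phi p.

Lemma flux_integrand_measurable phi f (D : set (R * R)) : smooth phi ->
  measurable_fun D f -> measurable_fun D (flux_integrand phi f).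
Proof.
move=> sphi mf; have [ct _] := sphi [:: false]; have [cx _] := sphi [:: true].
have mt : measurable_fun D (fun p => 'D_(dir_t R) phi p).
  exact: (measurable_funTS (continuous_plane_measurable ct)).
have mx : measurable_fun D (fun p => 'D_(dir_x R) phi p).
  exact: (measurable_funTS (continuous_plane_measurable cx)).
have mv : measurable_fun [set: R] (vext rhomax v).
  have r0 : 0 <= rhomax by apply: le_trans delta_le; exact: ltW.
  by apply: (@lipschitz_measurable R _ K) => a b; exact: vext_lipschitz.
apply: measurable_funD; apply: measurable_funM => //; apply: measurable_funM => //.
exact: measurableT_comp.
Qed.

Lemma flux_integrand_bound phi ph pt px L C f p : cut_test T phi ph pt px L C ->
  domain T p -> 0 <= f p <= rhomax ->
  `|flux_integrand phi f p| <= rhomax * C + rhomax * vmax * C.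
Proof.
move=> Hcut; case: p => t y [] /=; rewrite !in_itv/= => tT y01 fp.
have tT' : 0 <= t <= T by lra.
have [_ e1 e2] := cut_in Hcut tT' y01; have [b1 b2] := cut_bound Hcut y tT'.
rewrite e1 in b1; rewrite e2 in b2.
have r0 : 0 <= rhomax by lra.
have := v_range fp; rewrite /flux_integrand vextE// => vp.
apply: (le_trans (ler_normD _ _)); rewrite !normrM.
have nf : `|f (t, y)| <= rhomax by rewrite ler_norml; lra.
have nv : `|v (f (t, y))| <= vmax by rewrite ler_norml; lra.
by apply: lerD; apply: ler_pM => //; apply: ler_pM.
Qed.

Lemma scheme_residual phi ph pt px L C : smooth phi -> cut_test T phi ph pt px L C ->
  `|\int[leb2 R]_(p in domain T) flux_integrand phi (fun p : R * R =>
      density T m (n + N) w z p.1 p.2 * \1_(`]0, 1[%classic) p.2) p +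
    \int[mu]_(y in `]0, 1[) (rhobar y * phi (0, y))| <=
  (rhomax + queue_mass T rhomax vmax + T * vmax * rhomax) *
    (rhomax * (1 + vmax) * L * T + rhomax * L) / delta ^+ 2 * l.
Proof.
move=> sphi Hcut; set f := fun p : R * R => _.
have d0 := delta_gt0; have L_ge0 := cut_L Hcut.
have l0 : 0 < l := cell_mass_gt0 delta_gt0 delta_le rhobar_meas rhobar_range n_gt0.
have fE t y : 0 < t < T -> 0 < y < 1 -> f (t, y) = density T m (n + N) w z t y.
  by move=> tT y01; rewrite /f indicE mem_set ?mulr1//= in_itv.
have fr t y : 0 < t < T -> 0 < y < 1 -> delta <= f (t, y) <= rhomax.
  move=> tT y01; rewrite fE//.
  have tT' : 0 < t <= T by lra. have y01' : 0 <= y < 1 by lra.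
  exact: density_range T_gt0 m_gt0 Hflow _ _ tT' y01'.
have mf : measurable_fun [set: R * R] f.
  apply: measurable_funM; first exact: density_measurable Hflow.
  exact: (measurableT_comp (measurable_indic (measurable_itv `]0, 1[)) measurable_snd).
have H1 := @weak_residual R T m (n + N) delta rhomax vmax l _ K v w z phi ph pt px L C
  T_gt0 m_gt0 delta_gt0 delta_le v_lip v_range Hflow Hcut (flux_integrand phi f)
  (rhomax * C + rhomax * vmax * C).
have {}H1 := H1 (flux_integrand_measurable sphi mf).
have FB p : domain T p -> `|flux_integrand phi f p| <= rhomax * C + rhomax * vmax * C.
  move=> Dp; apply: (flux_integrand_bound Hcut Dp).
  case: p Dp => t y [] /=; rewrite !in_itv/= => tT y01.
  by have := fr t y tT y01; lra.
have FE t y : 0 < t < T -> 0 < y < 1 -> flux_integrand phi f (t, y) =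
    density T m (n + N) w z t y * 'D_(dir_t R) phi (t, y) +
    density T m (n + N) w z t y * v (density T m (n + N) w z t y) * 'D_(dir_x R) phi (t, y).
  move=> tT y01; have := fr t y tT y01; rewrite /flux_integrand fE// => h.
  by rewrite vextE//; lra.
have {}H1 := H1 FB FE.
have H2 := @initial_residual R delta rhomax rhobar delta_gt0 delta_le rhobar_meas rhobar_range
  n n_gt0 T vmax v rho0 rho1 m x T_gt0 vmax_gt0 m_gt0 rho0_range x_scheme phi ph pt px L C Hcut.
have Tot := masses_total T_gt0 delta_gt0 delta_le vmax_gt0 rhobar_meas rhobar_range n_gt0.
have /andP[_ Mb] := mass_bounds delta_gt0 delta_le rhobar_meas rhobar_range.
have rm : 0 <= rhomax by have := delta_le; lra.
rewrite -/N -/l in Tot H2.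
set Tt := rhomax + _ + _. have {}Tot : (n + N)%:R * l <= Tt by have := n_large; rewrite /Tt; lra.
have nTot : n%:R * l <= Tt.
  by apply: le_trans Tot; rewrite ler_wpM2r ?ler_nat ?leq_addr// ltW.
apply: (@le_trans _ _ ((n + N)%:R * (rhomax * (1 + vmax) * L * (l / delta) ^+ 2) * T +
   n%:R * (rhomax * L * (l / delta) ^+ 2))).
  move: H1 H2; set a := Rintegral _ _ _; set b := Rintegral _ _ _; set c := Bsum _ _ _ _ _ _.
  by rewrite !ler_norml; lra.
have v0 := vmax_gt0; have T0 := T_gt0.
have -> : Tt * (rhomax * (1 + vmax) * L * T + rhomax * L) / delta ^+ 2 * l =
  Tt * (rhomax * (1 + vmax) * L * T * (l / delta ^+ 2)) + Tt * (rhomax * L * (l / delta ^+ 2)).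
  by field; rewrite gt_eqF.
have -> : (n + N)%:R * (rhomax * (1 + vmax) * L * (l / delta) ^+ 2) * T =
   (n + N)%:R * l * (rhomax * (1 + vmax) * L * T * (l / delta ^+ 2)).
  by field; rewrite gt_eqF.
have -> : n%:R * (rhomax * L * (l / delta) ^+ 2) = n%:R * l * (rhomax * L * (l / delta ^+ 2)).
  by field; rewrite gt_eqF.
have ld : 0 <= l / delta ^+ 2 by rewrite divr_ge0 ?exprn_ge0// ltW.
have p1 : 0 <= rhomax * (1 + vmax) * L * T * (l / delta ^+ 2).
  by apply: mulr_ge0 ld; rewrite !mulr_ge0//; lra.
have p2 : 0 <= rhomax * L * (l / delta ^+ 2) by apply: mulr_ge0 ld; exact: mulr_ge0.
by apply: lerD; apply: ler_wpM2r.
Qed.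

End SchemeResidual.

Theorem theorem1p4 (R : realType) (T rhomax vmax delta : R)
    (v dv rhobar rho0 rho1 : R -> R)
    (T_gt0 : 0 < T) (rhomax_gt0 : 0 < rhomax) (vmax_gt0 : 0 < vmax)
    (delta_gt0 : 0 < delta)
    (v_C1 : C1_on 0 rhomax v dv)
    (v_range : forall r : R, 0 <= r <= rhomax -> 0 <= v r <= vmax)
    (dv_lt0 : forall r : R, 0 <= r <= rhomax -> dv r < 0)
    (v_0 : v 0 = vmax) (v_rhomax : v rhomax = 0)
    (rhobar_meas : measurable_fun (`]0, 1[%classic : set R) rhobar)
    (rhobar_range : {ae @lebesgue_measure R,
       forall x : R, 0 < x < 1 -> delta <= rhobar x <= rhomax})
    (rhobar_BV : BV_class 0 1 rhobar)
    (rho0_range : forall t : R, 0 <= t -> delta <= rho0 t <= rhomax)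
    (rho1_range : forall t : R, 0 <= t -> delta <= rho1 t <= rhomax)
    (rho0_lip : exists K : R, K.-lipschitz_(`[0, +oo[) rho0)
    (rho1_lip : exists K : R, K.-lipschitz_(`[0, +oo[) rho1)
    (rho0_BV : BV_halfline rho0) (rho1_BV : BV_halfline rho1)
    (n m : nat -> nat)
    (n_oo : n j @[j --> \oo] --> \oo) (m_oo : m j @[j --> \oo] --> \oo)
    (x : nat -> nat -> int -> R -> R)
    (x_scheme : \forall j \near \oo,
       ftl_scheme T rhomax vmax v rhobar rho0 rho1 (n j) (m j) (x j)) :
  exists (sigma : nat -> nat) (rho : R * R -> R),
    let rho_ (j : nat) (p : R * R) : R :=
      ftl_density T rhomax vmax rhobar (n (sigma j)) (m (sigma j))
        (x (sigma j)) p.1 p.2 * \1_(`]0, 1[%classic) p.2 in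
    [/\ increasing_seq sigma,
        cvg_ae (leb2 R) (domain T) rho_ rho,
        cvg_L1 (leb2 R) (domain T) rho_ rho &
        weak_solution T rhomax v rhobar rho].
Proof.
have delta_le : delta <= rhomax by have := rho0_range 0 (lexx 0); lra.
have [K0 v_lip0] := C1_on_lipschitz (ltW rhomax_gt0) v_C1.
pose K := `|K0|; have K_ge0 : 0 <= K by exact: normr_ge0.
have v_lip a b : 0 <= a <= rhomax -> 0 <= b <= rhomax -> `|v a - v b| <= K * `|a - b|.
  by move=> a0 b0; apply: (le_trans (v_lip0 a b a0 b0)); rewrite ler_wpM2r// ler_norm.
have v_dec := C1_on_nonincreasing v_C1 dv_lt0.
have [L0 rho0_L] := halfline_lipschitz rho0_lip.
have [L1 rho1_L] := halfline_lipschitz rho1_lip.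
have [V1 [V1_ge0 V1_tv]] := init_tv delta_gt0 delta_le rhobar_meas rhobar_range rhobar_BV.
have /andP[_ mass_le] := mass_bounds delta_gt0 delta_le rhobar_meas rhobar_range.
pose l j := cell_mass rhobar (n j).
pose M j := (n j + queue_size T rhomax vmax rhobar (n j))%N.
pose w j := masses T rhomax vmax rhobar (n j).
pose z j := particles T rhomax vmax rhobar (n j) (x j).
have n_ge P : \forall j \near \oo, (P <= n j)%N := n_oo _ (nbhs_infty_ge P).
have m_ge P : \forall j \near \oo, (P <= m j)%N := m_oo _ (nbhs_infty_ge P).
have l_small e : 0 < e -> \forall j \near \oo, l j < e.
  move=> e0; apply: filterS (n_ge (Num.truncn (rhomax / e)).+1) => j nj.
  have n0 : 0 < (n j)%:R :> R by rewrite ltr0n; exact: leq_ltn_trans nj.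
  rewrite /l /cell_mass ltr_pdivrMr//; apply: (le_lt_trans mass_le).
  rewrite mulrC -ltr_pdivrMr//; apply: (lt_le_trans (truncnS_gt _)).
  by rewrite ler_nat.
pose G : set nat := [set j | [/\ ftl_scheme T rhomax vmax v rhobar rho0 rho1 (n j) (m j) (x j),
  (0 < n j)%N, (0 < m j)%N & l j < T * vmax * rhomax]].
have G_oo : \forall j \near \oo, G j.
  have h0 : 0 < T * vmax * rhomax by rewrite !mulr_gt0.
  near=> j; split; [near: j; exact: x_scheme | near: j; exact: n_ge |
    near: j; exact: m_ge | near: j; exact: l_small].
pose V := 2 * rhomax + V1 + (L0 + L1) * T.
have Hflow j : G j -> flow T (m j) (M j) delta rhomax vmax (l j) V v (w j) (z j).
  move=> [sj nj mj lj].
  exact: (scheme_is_flow T_gt0 delta_gt0 delta_le vmax_gt0 v_lip v_dec v_0 v_rhomax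
    rho0_range rho1_range rho0_L rho1_L rhobar_meas rhobar_range V1_tv nj lj mj sj).
have m0 j : G j -> (0 < m j)%N by case.
have M0 j : G j -> (0 < M j)%N by move=> [_ nj _ _]; rewrite /M addn_gt0 nj.
pose f := cut_density T m M w z.
have f_range j p : G j -> domain T p -> 0 <= f j p <= rhomax.
  move=> Gj; case: p => t y [] /=; rewrite !in_itv/= => tT y01.
  have tT' : 0 < t <= T by lra.
  have y01' : 0 <= y < 1 by lra.
  have := density_range T_gt0 (m0 j Gj) (Hflow j Gj) tT' y01'.
  by rewrite /f /cut_density/= indicE mem_set ?mulr1//= ?in_itv//; lra.
have [U [UU oU]] := ultraFilterLemma eventually_filter.
have UP : ProperFilter U by exact: ultra_proper.
have UG : U G by exact: oU.
have cauchy := density_cauchy UU UG T_gt0 delta_gt0 delta_le (ltW vmax_gt0) K_ge0 v_lip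
  m0 M0 Hflow.
have f_meas j : G j -> measurable_fun (domain T) (f j).
  by move=> Gj; apply: measurable_funTS; exact: (cut_density_measurable Hflow Gj).
have [sigma [g [sigma_inc sigma_G g_meas g_range f_ae]]] :=
  @L1_subsequence _ _ R (leb2 R) (domain T) (domain_measurable T) U G f rhomax UP
    (fun N => oU _ (nbhs_infty_ge N)) UG f_meas f_range cauchy.
have {}g_range p : 0 <= g p <= rhomax by case: (g_range p) => //; lra.
have fb k p : domain T p -> `|f (sigma k) p| <= rhomax.
  by move=> Dp; have := f_range _ _ (sigma_G k) Dp; rewrite ler_norml; lra.
have [fL1 _] := @bounded_dominated_convergence _ _ R (leb2 R) (domain T)
  (domain_measurable T) (domain_finite T_gt0) (fun k => f (sigma k)) g rhomax
  (fun k => f_meas _ (sigma_G k)) g_meas fb f_ae.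
exists sigma, g => rho_.
have -> : rho_ = fun k => f (sigma k).
  apply/funext => k; apply/funext => p; rewrite /rho_ /f /cut_density; congr (_ * _).
  exact: ftl_densityE.
split => //; split; first by apply: aeW => p _; exact: g_range.
move=> phi Hphi; have sphi : smooth phi by case: Hphi.
have [ph [pt [px [L [C Hcut]]]]] := test_cut T_gt0 Hphi.
pose F k := flux_integrand rhomax v phi (f (sigma k)).
pose Fg := flux_integrand rhomax v phi g.
have F_ae : cvg_ae (leb2 R) (domain T) F Fg.
  have FF : Filter (almost_everywhere (leb2 R)) by exact: ae_filter_ringOfSetsType.
  apply: filterS f_ae => p fp Dp; have {}fp := fp Dp.
  rewrite /F /Fg /flux_integrand; apply: cvgD.
    by apply: cvgM; [exact: fp | exact: cvg_cst].
  apply: cvgM; last exact: cvg_cst.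
  apply: cvgM; first exact: fp.
  have cv : continuous (vext rhomax v).
    by apply: (@lipschitz_continuous R _ K) => a b;
      exact: vext_lipschitz (ltW rhomax_gt0) v_lip a b K_ge0.
  exact: (continuous_cvg _ (cv _) fp).
have F_meas k : measurable_fun (domain T) (F k).
  exact: (flux_integrand_measurable delta_gt0 delta_le K_ge0 v_lip sphi (f_meas _ (sigma_G k))).
have Fg_meas : measurable_fun (domain T) Fg.
  exact: (flux_integrand_measurable delta_gt0 delta_le K_ge0 v_lip sphi g_meas).
have F_bound k p : domain T p -> `|F k p| <= rhomax * C + rhomax * vmax * C.
  by move=> Dp; exact: (flux_integrand_bound v_range Hcut Dp (f_range _ _ (sigma_G k) Dp)).
have [_ F_lim] := @bounded_dominated_convergence _ _ R (leb2 R) (domain T)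
  (domain_measurable T) (domain_finite T_gt0) F Fg _ F_meas Fg_meas F_bound F_ae.
have -> : \int[leb2 R]_(p in domain T)
    (g p * 'D_(dir_t R) phi p + g p * v (g p) * 'D_(dir_x R) phi p) =
    \int[leb2 R]_(p in domain T) Fg p.
  by apply: eq_Rintegral => p _; rewrite /Fg /flux_integrand vextE.
pose c := \int[@lebesgue_measure R]_(y in `]0, 1[) (rhobar y * phi (0, y)).
rewrite -/c.
pose C' := (rhomax + queue_mass T rhomax vmax + T * vmax * rhomax) *
  (rhomax * (1 + vmax) * L * T + rhomax * L) / delta ^+ 2.
have residual k : `|\int[leb2 R]_(p in domain T) F k p + c| <= C' * l (sigma k).
  have [sj nj mj lj] := sigma_G k.
  exact: (scheme_residual T_gt0 delta_gt0 delta_le vmax_gt0 K_ge0 v_lip v_range rho0_range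
    rhobar_meas rhobar_range nj mj sj lj (Hflow _ (sigma_G k)) sphi Hcut).
apply/eqP; rewrite -normr_le0; apply/ler_addgt0Pr => e e0; rewrite add0r.
have C0 : 0 < `|C'| + 1 by have := normr_ge0 C'; lra.
have [k0 _ Hk0] := l_small (e / 2 / (`|C'| + 1)) ltac:(by rewrite !divr_gt0).
have near_lim : \forall k \near \oo, `|\int[leb2 R]_(p in domain T) Fg p -
    \int[leb2 R]_(p in domain T) F k p| < e / 2.
  by apply: (@cvgr_dist_lt _ R^o _ _ _ _ _ F_lim); rewrite divr_gt0.
have [k1 _ Hk1] := near_lim.
pose k := maxn k0 k1.
have hk1 := Hk1 k (leq_maxr k0 k1).
have sk : (k0 <= sigma k)%N.
  apply: (leq_trans (leq_maxl k0 k1)); rewrite -/k.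
  have sS i : (sigma i < sigma i.+1)%N.
    by move/increasing_seqP: sigma_inc => /(_ i).
  by elim: (k) => // i IH; exact: leq_ltn_trans IH (sS i).
have lk : l (sigma k) < e / 2 / (`|C'| + 1) := Hk0 _ sk.
have l_ge0 : 0 <= l (sigma k).
  have [_ nj _ _] := sigma_G k.
  exact: ltW (cell_mass_gt0 delta_gt0 delta_le rhobar_meas rhobar_range nj).
have hC : C' * l (sigma k) <= e / 2.
  apply: (@le_trans _ _ ((`|C'| + 1) * l (sigma k))).
    by apply: ler_wpM2r => //; have := ler_norm C'; lra.
  by rewrite mulrC -ler_pdivlMr// ltW.
have := residual k; move: hk1; set a := Rintegral _ _ _; set b := Rintegral _ _ _.
have := ler_normD (a - b) (b + c); rewrite addrA subrK => h1 h2 h3.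
by apply: (le_trans h1); lra.
Unshelve. all: by end_near. Qed.
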